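(* Let $n\ge2$. The variety of products of linear forms $$\operatorname{Split}_n(\mathbb C)=\{[\ell_1\cdots\ell_n]:\ell_i\in\mathbb C[x,y,t]_1\setminus\{0\}\}\subset\mathbf P(\operatorname{Sym}^n\mathbb C^3)$$ is irreducible of dimension $2n$ and codimension $\binom n2$. For fixed $\alpha,\beta\in\mathbb R^n$, each with pairwise distinct coordinates, let $\Theta_{\alpha,\beta}(w)=[h_w]$ for $w\in\mathbb R^{2n}$, and let $\operatorname{Split}_n(\mathbb R)$ denote the set of (classes of) products of $n$ real linear forms. Then $$\Theta_{\alpha,\beta}^{-1}(\operatorname{Split}_n(\mathbb R))=\operatorname{span}\{\mathbf 1_n\oplus0,\ 0\oplus\mathbf 1_n,\ \alpha^\circ\oplus\beta^\circ\}.$$ Its dimension is three. The difference between this dimension and the transverse expected dimension $2n-\binom n2$ is $\binom{n-2}{2}$.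
   Context: Finite free additive convolution: for $p(x)=\sum_{k=0}^n(-1)^ka_kx^{n-k}$ and $q(x)=\sum_{k=0}^n(-1)^kb_kx^{n-k}$ with $a_0=b_0=1$, set $(p\boxplus_n q)(x)=\sum_{k=0}^n(-1)^kc_kx^{n-k}$ with $c_k=\sum_{i+j=k}\frac{(n-i)!(n-j)!}{n!(n-k)!}a_ib_j$. $P_\alpha(x)=\prod_{i=1}^n(x-\alpha_i)$. For $w=u\oplus v\in\mathbb R^{2n}$, $h_w(x,y,t)=(P_{y\alpha+tu}\boxplus_nP_{y\beta+tv})(x)$, a real homogeneous polynomial of degree $n$ in $(x,y,t)$, monic in $x$; $[h_w]$ is its class in the projective space of ternary forms of degree $n$. $\mathbb C[x,y,t]_1$ is the space of linear forms. $\mathbf 1_n$ is the all-ones vector; $\rho^\circ=\rho-\left(\frac1n\sum_i\rho_i\right)\mathbf 1_n$. Convention: $\binom{0}{2}=\binom12=0$. *)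

(* Defs.v *)
From HB Require Import structures.
From mathcomp Require Import all_boot all_order all_algebra.
From mathcomp Require Import mpoly complex.
From mathcomp Require Import classical_sets reals.

Set Implicit Arguments.
Unset Strict Implicit.
Unset Printing Implicit Defensive.

Import Order.TTheory GRing.Theory Num.Theory.

Local Open Scope ring_scope.
Local Open Scope classical_set_scope.

(** * Projective spaces and their Zariski topology *)

(** Points of the projective space P(V) are the lines of V. *)
Definition proj (K : fieldType) (V : vectType K) : Type :=
  {L : {vspace V} | (\dim L == 1)%N}.

Lemma dim_line_eq1 (K : fieldType) (V : vectType K) (v : V) :
  v != 0 -> (\dim <[v]>%VS == 1)%N.
Proof. by move=> v0; rewrite dim_vline v0. Qed.

Definition pclass (K : fieldType) (V : vectType K) (v : V) (v0 : v != 0) :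
    proj V :=
  exist _ <[v]>%VS (dim_line_eq1 v0).

(** A polynomial function on V is a polynomial in the coordinates of the
    vectors of V in the basis [vbasis {:V}]; which basis is used does not
    affect the closed sets. *)
Definition poly_fun (K : fieldType) (V : vectType K)
    (F : {mpoly K[\dim {:V}]}) (v : V) : K :=
  F.@[fun i => coord (vbasis {:V}) i v].

Definition zariski_closed (K : fieldType) (V : vectType K)
    (Z : set (proj V)) : Prop :=
  exists S : set {mpoly K[\dim {:V}]},
    (forall F, S F -> exists d, F \is d.-homog) /\
    Z = [set p : proj V |
          forall F, S F -> forall v, v \in val p -> poly_fun F v = 0].

(** Closed for the topology induced on [Y]. *)
Definition closed_in (K : fieldType) (V : vectType K)
    (Y Z : set (proj V)) : Prop :=
  exists2 A, zariski_closed A & Z = Y `&` A.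

Definition irreducible_set (K : fieldType) (V : vectType K)
    (Z : set (proj V)) : Prop :=
  Z !=set0 /\
  forall A B, zariski_closed A -> zariski_closed B ->
    Z `<=` A `|` B -> Z `<=` A \/ Z `<=` B.

Definition irreducible_chain (K : fieldType) (V : vectType K)
    (Y : set (proj V)) (d : nat) (Z : nat -> set (proj V)) : Prop :=
  (forall i, (i <= d)%N -> closed_in Y (Z i) /\ irreducible_set (Z i)) /\
  (forall i, (i < d)%N -> Z i `<` Z i.+1).

(** The Krull dimension: [d] is the largest length of a strictly increasing
    chain Z_0 < ... < Z_d of irreducible closed subsets of [Y]. *)
Definition has_dim (K : fieldType) (V : vectType K)
    (Y : set (proj V)) (d : nat) : Prop :=
  (exists Z, irreducible_chain Y d Z) /\
  (forall e Z, irreducible_chain Y e Z -> (e <= d)%N).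

(** The codimension in the ambient projective space, dim P(V) - dim Y. *)
Definition has_codim (K : fieldType) (V : vectType K)
    (Y : set (proj V)) (c : nat) : Prop :=
  exists N d : nat,
    [/\ has_dim [set: proj V] N, has_dim Y d & N = (d + c)%N].

(** * Ternary forms and products of linear forms *)

Notation ternary_form K n := (dhomog 3 K n).

Lemma prod_linear_homog (K : fieldType) (n : nat)
    (l : 'I_n -> ternary_form K 1) :
  \prod_(i < n) (l i : {mpoly K[3]}) \is n.-homog.
Proof.
elim: n l => [|n IHn] l; first by rewrite big_ord0 dhomog1.
rewrite big_ord_recl -[X in _ \is X.-homog]add1n.
by apply: dhomogM; [exact: dhomog_is_dhomog|].
Qed.

Definition prod_linear (K : fieldType) (n : nat)
    (l : 'I_n -> ternary_form K 1) : ternary_form K n :=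
  DHomog (prod_linear_homog l).

Definition SplitForms (K : fieldType) (n : nat) : set (proj (ternary_form K n)) :=
  [set p | exists l : 'I_n -> ternary_form K 1,
             (forall i, l i != 0) /\ val p = <[prod_linear l]>%VS].

Arguments SplitForms : clear implicits.

(** * Finite free additive convolution *)

(** For [p] of degree at most [n], p = \sum_(k <= n) (-1)^k a_k X^(n-k) with
    a_k = [signed_coef n p k]. *)
Definition signed_coef (A : nzRingType) (n : nat) (p : {poly A}) (k : nat) : A :=
  (-1) ^+ k * p`_(n - k).

(** The ring [A] is general because [fconv] is used both over a field of
    characteristic zero and over the polynomials over it; the factorials are
    invertible in either. *)
Definition fconv_coef (A : comUnitRingType) (n : nat) (p q : {poly A})
    (k : nat) : A :=
  \sum_(i < k.+1)
    ((n - i)`! * (n - (k - i))`!)%:R / (n`! * (n - k)`!)%:R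
      * (signed_coef n p i * signed_coef n q (k - i)).

Definition fconv (A : comUnitRingType) (n : nat) (p q : {poly A}) : {poly A} :=
  \sum_(k < n.+1) ((-1) ^+ k * fconv_coef n p q k) *: 'X^(n - k).

Definition root_poly (A : comNzRingType) (n : nat) (a : 'rV[A]_n) : {poly A} :=
  \prod_(i < n) ('X - (a 0 i)%:P).

(** * The form h_w and the map Theta *)

Definition ix : 'I_3 := @Ordinal 3 0 isT.
Definition iy : 'I_3 := @Ordinal 3 1 isT.
Definition it : 'I_3 := @Ordinal 3 2 isT.

(** The row y a + t u over the ring of polynomials in x, y, t. *)
Definition pencil (R : numFieldType) (n : nat) (a u : 'rV[R]_n) :
    'rV[{mpoly R[3]}]_n :=
  \row_i (a 0 i *: 'X_iy + u 0 i *: 'X_it).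

Definition hpoly (R : numFieldType) (n : nat) (alpha beta : 'rV[R]_n)
    (w : 'rV[R]_(n + n)) : {mpoly R[3]} :=
  (fconv n (root_poly (pencil alpha (lsubmx w)))
           (root_poly (pencil beta (rsubmx w)))).['X_ix].

Section HPoly.
Variable R : numFieldType.

Lemma size_root_poly (A : comNzRingType) n (a : 'rV[A]_n) :
  size (root_poly a) = n.+1.
Proof. by rewrite size_prod_XsubC /index_enum -enumT size_enum_ord. Qed.

Lemma homogC0 (c : R) : (c%:MP : {mpoly R[3]}) \is 0.-homog.
Proof. by rewrite -alg_mpolyC; apply: dhomogZ; exact: dhomog1. Qed.

Lemma homog_pencil n (a u : 'rV[R]_n) i : pencil a u 0 i \is 1.-homog.
Proof. by rewrite mxE; apply: dhomogD; apply: dhomogZ; rewrite dhomogX /= mdeg1. Qed.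

Lemma homog_coef_prod (I : Type) (s : seq I) (c : I -> {mpoly R[3]}) :
  (forall i, c i \is 1.-homog) -> forall k, (k <= size s)%N ->
  (\prod_(i <- s) ('X - (c i)%:P))`_(size s - k) \is k.-homog.
Proof.
move=> hc; elim: s => [|i s IHs] k.
  by rewrite leqn0 => /eqP->; rewrite big_nil subn0 coef1 dhomog1.
rewrite big_cons /= mulrBl coefB coefXM coefCM => ks.
apply: dhomogD.
  case: eqP => [_|/eqP nz]; first exact: dhomog0.
  have ks' : (k <= size s)%N by move: nz; rewrite subn_eq0 -ltnNge ltnS.
  by rewrite subSn //=; exact: IHs.
rewrite dhomogN; case: k ks => [_|k ks].
  rewrite subn0 nth_default ?mulr0 ?dhomog0 //.
  by rewrite size_prod_XsubC.
by rewrite subSS -[X in _ \is X.-homog]add1n; apply: dhomogM => //; apply: IHs.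
Qed.

Lemma homog_signed_coef n (a u : 'rV[R]_n) k : (k <= n)%N ->
  signed_coef n (root_poly (pencil a u)) k \is k.-homog.
Proof.
move=> kn; rewrite /signed_coef -signr_odd.
have := @homog_coef_prod _ (index_enum 'I_n) (fun i => pencil a u 0 i)
   (homog_pencil a u) k.
rewrite /index_enum -enumT size_enum_ord => /(_ kn).
rewrite /root_poly /index_enum -enumT => h.
by case: (odd k); rewrite ?expr0 ?expr1 ?mul1r // mulN1r dhomogN.
Qed.

Lemma homog_hpoly n (alpha beta : 'rV[R]_n) w :
  hpoly alpha beta w \is n.-homog.
Proof.
rewrite /hpoly /fconv horner_sum; apply: rpred_sum => k _.
have kn : (k <= n)%N by rewrite -ltnS.
rewrite hornerZ hornerXn -[in X in _ \is X.-homog](subnKC kn).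
apply: dhomogM; last first.
  rewrite -[(n - k)%N in X in X.-homog]mul1n; apply: dhomogMn.
  by rewrite dhomogX /= mdeg1.
rewrite -signr_odd.
suff h : fconv_coef n (root_poly (pencil alpha (lsubmx w)))
   (root_poly (pencil beta (rsubmx w))) k \is k.-homog.
  by case: (odd k); rewrite ?expr0 ?expr1 ?mul1r // mulN1r dhomogN.
apply: rpred_sum => i _.
have ik : (i <= k)%N by rewrite -ltnS.
rewrite -[X in _ \is X.-homog]add0n; apply: dhomogM.
  rewrite -2!mpolyC_nat -fmorphV -rmorphM; exact: homogC0.
rewrite -[X in _ \is X.-homog](subnKC ik); apply: dhomogM.
  exact/homog_signed_coef/(leq_trans ik).
exact/homog_signed_coef/(leq_trans (leq_subr _ _)).
Qed.

Lemma unit_mpoly_nat m : (0 < m)%N -> (m%:R : {mpoly R[3]}) \is a GRing.unit.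
Proof.
move=> m0; rewrite -(rmorph_nat (@mpolyC 3 R)); apply: rmorph_unit.
by rewrite unitfE pnatr_eq0 -lt0n.
Qed.

Lemma map_fconv (A B : comUnitRingType) (f : {rmorphism A -> B}) n
    (p q : {poly A}) :
  (forall m, (0 < m)%N -> (m%:R : A) \is a GRing.unit) ->
  map_poly f (fconv n p q) = fconv n (map_poly f p) (map_poly f q).
Proof.
move=> un; rewrite /fconv rmorph_sum; apply: eq_bigr => k _.
rewrite /= map_polyZ map_polyXn rmorphM rmorph_sign; congr (_ * _ *: _).
rewrite /fconv_coef rmorph_sum; apply: eq_bigr => i _ /=.
rewrite [LHS]rmorphM /=; congr (_ * _).
  by rewrite rmorph_div ?un ?muln_gt0 ?fact_gt0 // !(rmorph_nat f).
rewrite /signed_coef !coef_map /= [LHS]rmorphM.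
by rewrite [in LHS](rmorphM f) (rmorphM f _ q`__) !rmorph_sign.
Qed.

(** The values of [hpoly] are those of the convolution over R. *)
Lemma hpolyE n (alpha beta u v : 'rV[R]_n) (x y t : R) :
  (hpoly alpha beta (row_mx u v)).@[tnth [tuple x; y; t]] =
  (fconv n (root_poly (y *: alpha + t *: u))
           (root_poly (y *: beta + t *: v))).[x].
Proof.
set e := tnth _.
have root_ev (a b : 'rV[R]_n) :
    map_poly (meval e) (root_poly (pencil a b)) = root_poly (y *: a + t *: b).
  rewrite rmorph_prod; apply: eq_bigr => i _.
  rewrite rmorphB /= map_polyX map_polyC /= !mxE; congr (_ - _%:P).
  by rewrite mevalD !mevalZ !mevalXU /= mulrC [t * _]mulrC.
rewrite /hpoly row_mxKl row_mxKr -!root_ev -map_fconv; last exact: unit_mpoly_nat.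
by rewrite -[meval e _](horner_map (meval e)) /= mevalXU.
Qed.

Lemma hpoly_neq0 n (alpha beta : 'rV[R]_n) w : hpoly alpha beta w != 0.
Proof.
suff : (hpoly alpha beta w).@[tnth [tuple 1; 0; 0]] != 0.
  by apply: contra_neq => ->; rewrite meval0.
rewrite -[w]hsubmxK hpolyE !scale0r addr0.
have -> : root_poly (0 : 'rV[R]_n) = 'X^n.
  rewrite /root_poly (eq_bigr (fun=> 'X)) ?prodr_const ?card_ord // => i _.
  by rewrite mxE subr0.
have sc k : (k <= n)%N -> signed_coef n ('X^n : {poly R}) k = (k == 0%N)%:R.
  move=> kn; rewrite /signed_coef coefXn; case: k kn => [|k] kn.
    by rewrite expr0 mul1r subn0 eqxx.
  by rewrite eqn_leq leq_subr leqNgt ltn_subrL (leq_trans _ kn) // mulr0.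
rewrite horner_sum big_ord_recl big1 => [|k _].
  rewrite addr0 hornerZ hornerXn expr1n mulr1 expr0 mul1r /fconv_coef big_ord1.
  rewrite !subn0 !sc // !mulr1 divff ?oner_neq0 //.
  by rewrite pnatr_eq0 muln_eq0 negb_or -!lt0n !fact_gt0.
rewrite hornerZ /fconv_coef big1 ?mulr0 ?mul0r // => i _.
have kn : (bump 0 k <= n)%N by rewrite /bump /= add1n.
have ik : (i <= bump 0 k)%N by rewrite -ltnS.
rewrite !sc ?(leq_trans ik kn) ?(leq_trans (leq_subr _ _) kn) //.
case: eqP => [->|_]; last by rewrite mul0r mulr0.
by rewrite subn0 /bump /= !mulr0.
Qed.

End HPoly.

Definition hform (R : numFieldType) (n : nat) (alpha beta : 'rV[R]_n)
    (w : 'rV[R]_(n + n)) : ternary_form R n :=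
  DHomog (homog_hpoly alpha beta w).

Lemma hform_neq0 (R : numFieldType) n (alpha beta : 'rV[R]_n) w :
  hform alpha beta w != 0.
Proof. by rewrite -val_eqE /=; exact: hpoly_neq0. Qed.

Definition Theta (R : numFieldType) (n : nat) (alpha beta : 'rV[R]_n)
    (w : 'rV[R]_(n + n)) : proj (ternary_form R n) :=
  pclass (hform_neq0 alpha beta w).

Definition ones (R : numFieldType) (n : nat) : 'rV[R]_n := const_mx 1.

Definition centered (R : numFieldType) (n : nat) (rho : 'rV[R]_n) : 'rV[R]_n :=
  rho - (n%:R^-1 * \sum_(i < n) rho 0 i) *: ones R n.

Definition Theta_span (R : numFieldType) (n : nat) (alpha beta : 'rV[R]_n) :
    {vspace 'rV[R]_(n + n)} :=
  <<[:: row_mx (ones R n) 0; row_mx 0 (ones R n);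
        row_mx (centered alpha) (centered beta)]>>%VS.

(* Main.v *)
(** The preimage of the split forms. Over the reals, n! (P boxplus Q)(x) is the apolar pairing
    [sum_j P^(j)(x) Q^(n-j)(0)], and removing a root a of P from the pairing replaces Q by
    its polar derivative n Q + (c - X) Q' at c = x - a. Polar derivatives preserve stability
    (Laguerre), which gives real-rootedness of P boxplus Q and a Rayleigh inequality. From
    the latter, a root of multiplicity m >= 2 of P boxplus Q is mu + nu for roots mu of P and nu
    of Q whose multiplicities add up to at least n + m. If h_w splits, then any two of its
    linear factors meet at some direction (y, t), where y alpha + t u and y beta + t v thus have
    large sets of equal entries; for two different directions these sets would overlap in more
    than one index. So all factors meet at a single direction, where both rows are constant.

    The variety of split forms. If Z_0 < ... < Z_e are irreducible closed sets, then forms F_i of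
    a common degree vanishing on Z_(i-1) but not on Z_i are algebraically independent on Z_e;
    comparing the growth of the monomials in the F_i with that of the multihomogeneous
    polynomials in the coefficients of the linear factors bounds e by 2 n. Closures of the sets of
    products with factors in a flag give a chain of length 2 n. For closedness, a form f with
    f(1, 0, 0) = 1 splits iff for some permutation s it equals prod_i (x - a_i y - b_(s i) t), where
    a and b are the roots of f(x, 1, 0) and f(x, 0, 1) in x; the product over all s of the
    differences is symmetric in a and in b, hence polynomial in the coefficients of f. *)

Require Import Defs.
From HB Require Import structures.
From mathcomp Require Import all_boot all_order all_algebra.
From mathcomp Require Import fingroup perm.
From mathcomp Require Import mpoly complex.
From mathcomp Require Import boolp classical_sets reals.
From mathcomp Require Import ring lra zify.

Set Implicit Arguments.
Unset Strict Implicit.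
Unset Printing Implicit Defensive.

Import Order.TTheory GRing.Theory Num.Theory.

Local Open Scope ring_scope.

(** * Polar derivatives and stability *)

Definition XsubCs (A : nzRingType) (s : seq A) : {poly A} := \prod_(a <- s) ('X - a%:P).

(** Laguerre's polar derivative with pole [a]. The index [n] is a formal degree: a [Q] of lower
    degree is read as having its missing roots at infinity. *)
Definition polar (A : nzRingType) (n : nat) (a : A) (Q : {poly A}) : {poly A} :=
  Q *+ n + (a%:P - 'X) * Q^`().

Lemma deriv_XsubCs (A : comNzRingType) (s : seq A) : 
  (XsubCs s)^`() = \sum_(a <- s) XsubCs (rem a s).
Proof.
elim: s => [|a s IH]; first by rewrite big_nil /XsubCs big_nil derivC.
rewrite {1}/XsubCs !big_cons derivM derivXsubC mul1r /= eqxx; congr (_ + _).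
rewrite -/(XsubCs s) IH mulr_sumr; apply: eq_big_seq => b bs.
transitivity (XsubCs (a :: rem b s)); first by rewrite /XsubCs big_cons.
apply: perm_big; case: eqVneq => [->|_//].
by rewrite perm_sym perm_to_rem.
Qed.

Lemma XsubCs_nseq (A : comNzRingType) n (a : A) : XsubCs (nseq n a) = ('X - a%:P) ^+ n.
Proof.
elim: n => [|n IH]; first by rewrite /XsubCs big_nil.
by rewrite exprS -IH /XsubCs big_cons.
Qed.

Lemma polar_XsubC_exp (A : comNzRingType) n (a c : A) :
  polar n a (c *: ('X - a%:P) ^+ n) = 0.
Proof.
rewrite /polar derivZ deriv_exp derivXsubC mul1r -[a%:P - _]opprB mulNr -scalerAr mulrnAr.
case: n => [|n]; first by rewrite !mulr0n scaler0 subr0.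
by rewrite -exprS scalerMnr subrr.
Qed.

Section S.
Variable F : fieldType.
Lemma horner_deriv_XsubCs (s : seq F) (z : F) : z \notin s ->
  (XsubCs s)^`().[z] = (XsubCs s).[z] * \sum_(a <- s) (z - a)^-1.
Proof.
rewrite /XsubCs; elim: s => [|a s IH]; first by rewrite !big_nil derivC horner0 mulr0.
rewrite inE negb_or => /andP[za /IH e]; rewrite !big_cons derivM derivXsubC mul1r.
rewrite hornerD !hornerM !hornerXsubC e mulrDr [X in _ = X + _]mulrAC divff ?subr_eq0 //.
by rewrite mul1r; congr (_ + _); rewrite mulrA.
Qed.

Lemma XsubCs_root (s : seq F) z : root (XsubCs s) z = (z \in s).
Proof. by rewrite /XsubCs root_prod_XsubC. Qed.
End S.

Section Stable.
Variable R : rcfType.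
Local Notation C := R[i].
Local Notation Re := complex.Re.
Local Notation Im := complex.Im.

Definition stable (Q : {poly C}) := forall z : C, 0 < Im z -> Q.[z] != 0.

(** The squared modulus with values in [R], since the norm on [C] takes its values in [C]. *)
Definition sqn (z : C) : R := Re z ^+ 2 + Im z ^+ 2.

Lemma sqn_ge0 z : 0 <= sqn z. Proof. by rewrite addr_ge0 ?sqr_ge0. Qed.
Lemma sqn_eq0 z : (sqn z == 0) = (z == 0).
Proof. by case: z => a b; rewrite paddr_eq0 ?sqr_ge0 //= !sqrf_eq0 eq_complex. Qed.

Lemma Im_inv (z : C) : Im z^-1 = - Im z * sqn z^-1.
Proof.
have [->|z0] := eqVneq z 0; first by rewrite invr0 /= oppr0 mul0r.
have := z0; rewrite -sqn_eq0; case: z z0 => a b z0; rewrite /sqn /= => h.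
by field.
Qed.

Lemma raddf_Re_sum (I : Type) (s : seq I) (f : I -> C) :
  Re (\sum_(i <- s) f i) = \sum_(i <- s) Re (f i).
Proof. exact: raddf_sum. Qed.
Lemma raddf_Im_sum (I : Type) (s : seq I) (f : I -> C) :
  Im (\sum_(i <- s) f i) = \sum_(i <- s) Im (f i).
Proof. exact: raddf_sum. Qed.


Lemma stable_roots (Q : {poly C}) : Q != 0 -> stable Q ->
  exists rs, Q = lead_coef Q *: XsubCs rs /\ {in rs, forall b, Im b <= 0}.
Proof.
move=> Q0 st; have [rs e] := closed_field_poly_normal Q; exists rs; split=> // b br.
rewrite leNgt; apply/negP => /st; apply/negP; rewrite negbK e hornerZ.
by move: br; rewrite -[b \in rs]XsubCs_root => /rootP ->; rewrite mulr0.
Qed.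

(* xi |-> y |xi|^2 + Im xi is convex and nonpositive at (z - b)^-1 for every
   root b of Q; a zero z of the polar makes n (z - a)^-1 the sum of these. *)
Lemma polar_stable n a (Q : {poly C}) z : (size Q <= n.+1)%N -> 0 <= Im a ->
  stable Q -> 0 < Im z -> (polar n a Q).[z] = 0 -> polar n a Q = 0.
Proof.
move=> sQ a0 st z0.
case: n sQ => [|n] sQ.
  by rewrite /polar mulr0n (size1_polyC sQ) derivC mulr0 addr0.
have [->|Q0] := eqVneq Q 0; first by rewrite /polar mul0rn deriv0 mulr0 addr0.
have [rs [eQ hrs]] := stable_roots Q0 st.
have c0 : lead_coef Q != 0 by rewrite lead_coef_eq0.
have Qz := st z z0.
have zrs : z \notin rs.
  by apply: contra Qz; rewrite eQ hornerZ -XsubCs_root => /rootP ->; rewrite mulr0.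
set S := \sum_(b <- rs) (z - b)^-1.
have dQ : Q^`().[z] = Q.[z] * S.
  by rewrite {1 2}eQ derivZ !hornerZ horner_deriv_XsubCs // mulrA.
rewrite /polar hornerD hornerM hornerMn dQ hornerD hornerN hornerX hornerC.
rewrite -mulr_natr mulrCA -mulrDr => /eqP; rewrite mulf_eq0 (negPf Qz) /= => /eqP eS.
have za : z - a != 0.
  apply/eqP => za; move/eqP: eS.
  by rewrite -opprB za oppr0 mul0r addr0 pnatr_eq0.
set zt := (z - a)^-1.
have ezt : S = n.+1%:R * zt.
  rewrite /zt; apply: (mulfI za); rewrite mulrCA divff // mulr1.
  by rewrite -[RHS]subr0 -eS; ring.
pose N := \sum_(b <- rs) sqn (z - b)^-1.
have hN : Im z * N <= - Im S.
  rewrite /S /N raddf_Im_sum mulr_sumr -sumrN !big_seq; apply: ler_sum => b /hrs hb.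
  rewrite Im_inv mulNr opprK; apply: ler_wpM2r; first exact: sqn_ge0.
  by case: z b hb {z0 S eS dQ zt ezt zrs Qz za N} => z1 z2 [b1 b2] /=; lra.
have ImS : Im S = n.+1%:R * Im zt.
  by rewrite ezt -(rmorph_nat (real_complex R)); case: zt {ezt} => u v /=; ring.
have ReS : Re S = n.+1%:R * Re zt.
  by rewrite ezt -(rmorph_nat (real_complex R)); case: zt {ezt ImS} => u v /=; ring.
have Imzt : Im zt = - (Im z - Im a) * sqn zt.
  by rewrite /zt Im_inv; case: (z) (a) => [z1 z2] [a1 a2].
have var : \sum_(b <- rs) sqn ((z - b)^-1 - zt) =
    N - 2 * (Re zt * Re S + Im zt * Im S) + (size rs)%:R * sqn zt.
  rewrite /S raddf_Im_sum raddf_Re_sum !mulr_sumr -big_split /= mulr_sumr.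
  rewrite /N -sumrN -big_split /= -sum1_size natr_sum mulr_suml -big_split /=.
  apply: eq_bigr => b _; rewrite mul1r /sqn.
  by case: (_^-1) zt {ezt ImS ReS Imzt} => [u v] [s t] /=; ring.
have szt : 0 < sqn zt by rewrite lt0r sqn_ge0 sqn_eq0 invr_eq0 za.
have mrs : (size rs <= n.+1)%N.
  by move: sQ; rewrite eQ size_scale // size_prod_XsubC.
have V0 : 0 <= \sum_(b <- rs) sqn ((z - b)^-1 - zt).
  by apply: sumr_ge0 => b _; exact: sqn_ge0.
(* The variance about [zt] plus the degree defect equals N - (n + 1) |zt|^2. By [hN] and Im a >= 0
   its product with Im z is nonpositive, while both terms are nonnegative. *)
have key : Im z * (\sum_(b <- rs) sqn ((z - b)^-1 - zt)
      + (n.+1%:R - (size rs)%:R) * sqn zt) <= 0.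
  have -> : \sum_(b <- rs) sqn ((z - b)^-1 - zt) =
      N - n.+1%:R * sqn zt *+ 2 + (size rs)%:R * sqn zt.
    by rewrite var ReS ImS /sqn; ring.
  have h1 : Im z * N <= n.+1%:R * ((Im z - Im a) * sqn zt).
    by apply: le_trans hN _; rewrite ImS Imzt; lra.
  have h2 : 0 <= n.+1%:R * (Im a * sqn zt).
    by rewrite mulr_ge0 ?ler0n ?mulr_ge0 // ltW.
  by move: h1 h2; set k := n.+1%:R; set u := sqn zt; lra.
have nm : 0 <= (n.+1%:R - (size rs)%:R : R) by rewrite subr_ge0 ler_nat.
have P0 : 0 <= (n.+1%:R - (size rs)%:R) * sqn zt by rewrite mulr_ge0 // ltW.
have {key} key : \sum_(b <- rs) sqn ((z - b)^-1 - zt)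
      + (n.+1%:R - (size rs)%:R) * sqn zt <= 0.
  by rewrite -(pmulr_rle0 _ z0).
(* Both terms therefore vanish: [Q] has full degree and every root equals [a], so its polar
   derivative is zero. *)
have esz : size rs = n.+1.
  apply/eqP; rewrite -(eqr_nat R) eq_sym -subr_eq0.
  have /eqP : (n.+1%:R - (size rs)%:R) * sqn zt = 0 by lra.
  by rewrite mulf_eq0 (gt_eqF szt) orbF.
have V1 : \sum_(b <- rs) sqn ((z - b)^-1 - zt) == 0 by rewrite eq_le V0 andbT; lra.
have all_a : {in rs, forall b, b = a}.
  move=> b brs; move: V1; rewrite psumr_eq0 => [|? _]; last exact: sqn_ge0.
  move=> /allP /(_ b brs) /=; rewrite sqn_eq0 subr_eq0 => /eqP /invr_inj /addrI.
  exact: oppr_inj.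
have ers : rs = nseq n.+1 a by rewrite -esz; apply/all_pred1P/allP => b /all_a /= ->.
rewrite eQ ers XsubCs_nseq; exact: polar_XsubC_exp.
Qed.

End Stable.

(** * The apolar pairing and the removal of one root *)

Section Apolar.
Variable A : comNzRingType.
Implicit Types P Q : {poly A}.

(** Both arguments carry the formal degree [n]. No factorial is divided out, so the pairing makes
    sense over every commutative ring. *)
Definition apolar n P Q (x : A) : A := \sum_(j < n.+1) P^`(j).[x] * Q^`(n - j).[0].

Lemma apolarD n P1 P2 Q x : apolar n (P1 + P2) Q x = apolar n P1 Q x + apolar n P2 Q x.
Proof.
by rewrite -big_split; apply: eq_bigr => j _; rewrite derivnD hornerD mulrDl.
Qed.

Lemma apolarZ n c P Q x : apolar n (c *: P) Q x = c * apolar n P Q x.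
Proof. by rewrite mulr_sumr; apply: eq_bigr => j _; rewrite derivnZ hornerZ mulrA. Qed.

Lemma apolarB n P1 P2 Q x : apolar n (P1 - P2) Q x = apolar n P1 Q x - apolar n P2 Q x.
Proof. by rewrite -scaleN1r apolarD apolarZ mulN1r. Qed.

Lemma apolar_sum n (I : Type) (r : seq I) (P : I -> {poly A}) Q x :
  apolar n (\sum_(i <- r) P i) Q x = \sum_(i <- r) apolar n (P i) Q x.
Proof.
apply: (big_morph (fun P => apolar n P Q x)) => [P1 P2|]; first exact: apolarD.
by rewrite -[0]subr0 apolarB subrr.
Qed.

(** The top derivative of [P] is zero, and all remaining terms see [Q] only through its
    derivative. *)
Lemma apolar_deriv n P Q x : (size P <= n.+1)%N ->
  apolar n.+1 P Q x = apolar n P Q^`() x.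
Proof.
move=> sP; rewrite /apolar big_ord_recr (derivn_poly0 sP) /= horner0 mul0r addr0.
apply: eq_bigr => j _; have jn : (j <= n)%N by rewrite -ltnS.
by rewrite subSn // derivSn.
Qed.

Lemma derivn_XsubCM j a P : (('X - a%:P) * P)^`(j) =
  ('X - a%:P) * P^`(j) + P^`(j.-1) *+ j.
Proof.
elim: j => [|j IH]; first by rewrite mulr0n addr0.
rewrite derivnS IH derivD derivM derivXsubC mul1r derivMn -derivnS addrAC addrC.
congr (_ + _); case: j {IH} => [|j] /=; first by rewrite mulr0n addr0.
by rewrite -derivnS -mulrS.
Qed.

Lemma derivn_polar n a Q k : (polar n a Q)^`(k) =
  Q^`(k) *+ n + (a%:P - 'X) * Q^`(k.+1) - Q^`(k) *+ k.
Proof.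
rewrite /polar -opprB mulNr derivnB derivnMn derivn_XsubCM -derivSn opprD mulNr.
rewrite addrA; congr (_ - _); case: k => [|k]; first by rewrite !mulr0n.
by rewrite -derivSn.
Qed.

(** The terms of degree n + 1 in (n + 1) Q and in X Q' cancel. *)
Lemma size_polar n a Q : (size Q <= n.+2)%N -> (size (polar n.+1 a Q) <= n.+1)%N.
Proof.
move=> sQ; apply/leq_sizeP => k nk; rewrite /polar mulrBl coefD coefMn coefB coefCM.
rewrite coefXM !coef_deriv; case: k nk => [|k] // nk.
have -> : Q`_k.+2 = 0 by apply: nth_default; exact: leq_trans sQ _.
rewrite mul0rn mulr0 sub0r /=; move: nk; rewrite leq_eqVlt => /orP[/eqP[<-]|nk].
  by rewrite subrr.
by rewrite [Q`__]nth_default ?mul0rn ?subrr //; exact: leq_trans sQ _.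
Qed.

(** By Leibniz, P^(j)(x) is paired with (x - a) Q^(n+1-j)(0) + (j + 1) Q^(n-j)(0), which is the
    derivative of order n - j at 0 of the polar derivative with pole x - a. *)
Lemma apolar_XsubCM n a P Q x : (size P <= n.+1)%N ->
  apolar n.+1 (('X - a%:P) * P) Q x = apolar n P (polar n.+1 (x - a) Q) x.
Proof.
move=> sP; rewrite /apolar.
under eq_bigr => j _ do rewrite derivn_XsubCM hornerD hornerM hornerMn hornerXsubC
  mulrDl.
rewrite big_split /= big_ord_recr (derivn_poly0 sP) /= horner0 mulr0 mul0r addr0.
rewrite [X in _ + X = _]big_ord_recl /= mulr0n mul0r add0r -big_split /=.
apply: eq_bigr => j _; rewrite /bump /= add1n subSS.
have jn : (j <= n)%N by rewrite -ltnS.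
rewrite derivn_polar subSn // hornerD hornerN hornerD !hornerMn hornerM.
rewrite hornerD hornerN hornerC hornerX subr0.
have e : n.+1%:R = j.+1%:R + (n - j)%:R :> A by rewrite -natrD addSn subnKC.
rewrite add0n -[_ *+ j.+1]mulr_natr -[_ *+ n.+1]mulr_natr -[_ *+ (n - j)]mulr_natr e.
move: (j.+1%:R) ((n - j)%:R) P^`(j).[x] Q^`((n - j).+1).[0] Q^`(n - j).[0].
by move=> u v p q1 q2; ring.
Qed.

End Apolar.

Lemma map_polar (A B : nzRingType) (f : {rmorphism A -> B}) n a (Q : {poly A}) :
  map_poly f (polar n a Q) = polar n (f a) (map_poly f Q).
Proof.
by rewrite /polar rmorphD rmorphMn rmorphM rmorphB /= map_polyC map_polyX deriv_map.
Qed.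

Lemma map_XsubCs (A B : comNzRingType) (f : {rmorphism A -> B}) s :
  map_poly f (XsubCs s) = XsubCs (map f s).
Proof.
rewrite rmorph_prod /= /XsubCs big_map.
by apply: eq_bigr => a _; rewrite rmorphB /= map_polyC map_polyX.
Qed.

Section RealRooted.
Variable R : rcfType.
Local Notation C := R[i].
Local Notation Re := complex.Re.
Local Notation Im := complex.Im.
Local Notation iota := (real_complex R).

Lemma size_XsubCs (A : comNzRingType) (s : seq A) : size (XsubCs s) = (size s).+1.
Proof. exact: size_prod_XsubC. Qed.

Lemma XsubCs_neq0 (s : seq R) : XsubCs s != 0.
Proof. by rewrite -size_poly_eq0 size_XsubCs. Qed.

(** Induction on the roots: removing [a] replaces [Q] by its polar derivative with pole x - a in the
    open upper half plane, which is again stable. *)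
Lemma apolar_stable (s : seq C) (Q : {poly C}) x :
  {in s, forall a, Im a <= 0} -> stable Q -> (size Q <= (size s).+1)%N ->
  0 < Im x -> apolar (size s) (XsubCs s) Q x != 0.
Proof.
move=> + + + x0; elim: s Q => [|a s IH] Q hs st sQ.
  rewrite /apolar big_ord1 /XsubCs big_nil derivn0 hornerC mul1r subn0 derivn0.
  by have := st x x0; rewrite (size1_polyC sQ) !hornerC.
rewrite /XsubCs big_cons -/(XsubCs s) /= apolar_XsubCM ?size_XsubCs //.
have xa : 0 < Im (x - a).
  have := hs a (mem_head _ _); case: (x) (a) x0 => [x1 x2] [a1 a2] /= *; lra.
(* At its own pole the polar derivative is a positive multiple of [Q], which does not vanish
   there. *)
have p0 : polar (size s).+1 (x - a) Q != 0.
  apply: contraTneq (st _ xa) => /(congr1 (horner^~ (x - a))).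
  rewrite /polar horner0 hornerD hornerM hornerD hornerN hornerX hornerC subrr mul0r.
  by rewrite addr0 hornerMn => /eqP; rewrite mulrn_eq0 /= => /eqP ->; rewrite eqxx.
apply: IH; [| |exact: size_polar].
  by move=> b bs; apply: hs; rewrite inE bs orbT.
move=> z z0; apply: contra_neq p0.
by apply: (polar_stable sQ) => //; exact: ltW.
Qed.

Definition real_rooted (Q : {poly R}) := Q = 0 \/ stable (map_poly iota Q).

Lemma real_rooted_roots Q : Q != 0 -> real_rooted Q ->
  exists s, Q = lead_coef Q *: XsubCs s.
Proof.
move=> Q0 [Q00|st]; first by rewrite Q00 eqxx in Q0.
have Q1 : map_poly iota Q != 0 by rewrite map_poly_eq0.
have [rs [e hrs]] := stable_roots Q1 st.
exists (map (@complex.Re R) rs); apply: (map_inj_poly (fmorph_inj iota)); first exact: rmorph0.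
rewrite linearZ /= map_XsubCs -map_comp -lead_coef_map {1}e; congr (_ *: XsubCs _).
rewrite -[LHS]map_id; apply/eq_in_map => b br /=.
suff : Im b = 0 by case: b {br} => u v /= ->.
apply/eqP; rewrite eq_le hrs //= leNgt; apply/negP => b0.
(* A nonreal root [b] lies below the axis, so its conjugate, a root because [Q] is real, lies above
   it. *)
have cb : (map_poly iota Q).[conjc b] = 0.
  have -> : map_poly iota Q = map_poly (@conjc R) (map_poly iota Q).
    by rewrite -map_poly_comp; apply: eq_map_poly => u /=; rewrite oppr0.
  have /rootP rb : root (map_poly iota Q) b by rewrite e rootZ ?lead_coef_eq0 // XsubCs_root.
  by rewrite horner_map /= rb rmorph0.
have /st : 0 < Im (conjc b) by case: (b) b0 => u v /=; rewrite oppr_gt0.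
by rewrite cb eqxx.
Qed.

Lemma real_rootedZ c s : real_rooted (c *: XsubCs s).
Proof.
have [->|c0] := eqVneq c 0; [by left; rewrite scale0r|right => z z0].
rewrite linearZ /= map_XsubCs hornerZ mulf_neq0 ?fmorph_eq0 //.
rewrite -[_ == 0]/(root _ _) XsubCs_root; apply: contraTN z0 => /mapP[b _ ->].
by rewrite ltxx.
Qed.

Lemma real_rooted_polar n a (Q : {poly R}) : (size Q <= n.+1)%N -> real_rooted Q ->
  real_rooted (polar n a Q).
Proof.
move=> sQ [->|st]; first by left; rewrite /polar mul0rn deriv0 mulr0 addr0.
have [|p0] := eqVneq (polar n a Q) 0; [by left|right => z z0].
apply: contra_neq p0 => pz; apply: (map_inj_poly (fmorph_inj iota)); first exact: rmorph0.
rewrite map_polar rmorph0; apply: (polar_stable (z := z)) => //=.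
  by rewrite size_map_poly.
by rewrite -map_polar.
Qed.

End RealRooted.

(** * The Rayleigh inequality and multiple roots of derivatives *)

Section Rayleigh.
Variable R : rcfType.
Local Notation C := R[i].
Local Notation iota := (real_complex R).

(** The sign of the discriminant, written with derivatives at 0 as the base case of the Rayleigh
    inequality needs it. *)
Lemma real_rooted_quadratic (Q : {poly R}) : (size Q <= 3)%N -> real_rooted Q ->
  2 * Q.[0] * Q^`(2).[0] <= Q^`(1).[0] ^+ 2.
Proof.
move=> sQ; have eQ : Q = (Q`_0)%:P + Q`_1 *: 'X + Q`_2 *: 'X^2.
  apply/polyP => i; rewrite !coefD !coefZ coefC coefX coefXn.
  case: i => [|[|[|i]]]; rewrite /= ?mulr1 ?mulr0 ?addr0 ?add0r //.
  by rewrite nth_default // (leq_trans sQ).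
move: (Q`_0) (Q`_1) (Q`_2) eQ => c0 c1 c2 eQ rr.
have -> : Q.[0] = c0 by rewrite eQ !hornerE /=; ring.
have -> : Q^`(1).[0] = c1 by rewrite eQ derivn1 !derivE !hornerE /=.
have -> : Q^`(2).[0] = 2 * c2.
  by rewrite eQ derivnS derivn1 !derivE !hornerE /= -mulr_natl; ring.
rewrite leNgt; apply/negP => h.
case: rr => [Q0|st].
  have [e0 e1] : c0 = 0 /\ c1 = 0.
    by split; [move: (congr1 (horner^~ 0) Q0) | move: (congr1 (horner^~ 0 \o @deriv _) Q0)];
       rewrite eQ /= ?derivE !hornerE /= => <-; ring.
  by move: h; rewrite e0 e1; lra.
have c20 : c2 != 0 by apply/eqP => c20; move: h; rewrite c20; have := sqr_ge0 c1; lra.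
pose D := 4 * c0 * c2 - c1 ^+ 2.
have D0 : 0 < D by rewrite /D; lra.
(* A root u + i v from the quadratic formula; the absolute value of [c2] selects the one in the
   upper half plane. *)
pose v := Num.sqrt D / (2 * `|c2|); pose u := - c1 / (2 * c2).
have v0 : 0 < v by rewrite divr_gt0 ?sqrtr_gt0 // mulr_gt0 // normr_gt0.
have v2 : v ^+ 2 = D / (4 * c2 ^+ 2).
  rewrite /v expr_div_n sqr_sqrtr ?ltW // exprMn real_normK ?num_real //.
  by congr (_ / _); ring.
have := st (Complex u v) v0; rewrite eQ !rmorphD /= !linearZ /= map_polyC map_polyX map_polyXn.
rewrite !hornerE /= => /negP; apply; rewrite eq_complex /=.
apply/andP; split; apply/eqP.
  transitivity (c0 + c1 * u + c2 * (u ^+ 2 - v ^+ 2)); first by ring.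
  by rewrite v2 /u /D; field.
transitivity (v * (c1 + 2 * c2 * u)); first by ring.
by rewrite /u; field.
Qed.

(** Removing a common root from all four lists gives the same inequality for a polar derivative.
    With no common root left, the difference of the two sides is Q'(0)^2 - 2 Q(0) Q''(0),
    independently of a, b and x. *)
Lemma apolar_rayleigh (s : seq R) (Q : {poly R}) a b x :
  (size Q <= (size s).+3)%N -> real_rooted Q ->
  let L P := apolar (size s).+2 P Q x in
  is_true (L (XsubCs s) * L (XsubCs [:: a, b & s]) <=
           L (XsubCs (a :: s)) * L (XsubCs (b :: s))).
Proof.
elim: s Q => [|c s IH] Q sQ rr L.
  rewrite /L /apolar !big_ord_recr !big_ord0 /XsubCs !big_cons !big_nil /=.
  rewrite !derivE !hornerE /=; have /= := real_rooted_quadratic sQ rr.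
  by move: (Q.[0]) (Q^`().[0]) (Q^`()^`().[0]) => q0 q1 q2; nra.
have perm (t : seq R) : perm_eq (t ++ c :: s) (c :: t ++ s)
  by apply: (permEl (perm_catCA t [:: c] s)).
have e (t : seq R) : (size t <= 2)%N ->
    L (XsubCs (t ++ c :: s)) =
    apolar (size s).+2 (XsubCs (t ++ s)) (polar (size s).+3 (x - c) Q) x.
  move=> st; rewrite /L /= {1}/XsubCs (perm_big _ (perm t)) big_cons apolar_XsubCM //.
  by rewrite size_XsubCs size_cat ltnS -addn2 addnC leq_add2l.
have := IH (polar (size s).+3 (x - c) Q) (size_polar _ sQ) (real_rooted_polar _ sQ rr).
by rewrite (e [::]) // (e [:: a]) // (e [:: b]) // (e [:: a; b]).
Qed.

(** Equal roots give polar derivatives with the same pole x - mu, and each multiplies the value at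
    that pole by the current formal degree. *)
Lemma apolar_exp n mu (Q : {poly R}) x : (size Q <= n.+1)%N ->
  apolar n (('X - mu%:P) ^+ n) Q x = n`!%:R * Q.[x - mu].
Proof.
elim: n Q => [|n IH] Q sQ.
  by rewrite /apolar big_ord1 expr0 !derivn0 hornerC !mul1r (size1_polyC sQ) !hornerC.
rewrite exprS apolar_XsubCM ?size_exp_XsubC // IH ?size_polar //.
rewrite /polar hornerD hornerM hornerD hornerN hornerC hornerX subrr mul0r addr0.
by rewrite hornerMn factS mulnC natrM -mulrA !mulr_natl.
Qed.

Lemma deriv2_XsubCs (s : seq R) z : z \notin s ->
  (XsubCs s)^`()^`().[z] = (XsubCs s).[z] *
    ((\sum_(a <- s) (z - a)^-1) ^+ 2 - \sum_(a <- s) (z - a)^-1 ^+ 2).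
Proof.
elim: s => [|a s IH].
  by rewrite /XsubCs !big_nil derivC derivC horner0 expr0n subrr mulr0.
rewrite inE negb_or => /andP[za zs].
have := horner_deriv_XsubCs zs; have := IH zs; rewrite {IH}.
rewrite /XsubCs !big_cons -/(XsubCs s) !derivE !hornerE.
move: (\sum_(_ <- _) _) (\sum_(_ <- _) _) => S1 S2 /= -> ->.
have za0 : z - a != 0 by rewrite subr_eq0.
by field.
Qed.

(** If Q(nu) were nonzero, Q'(nu) = Q''(nu) = 0 would make the sum of the (nu - a)^-2 over the real
    roots vanish. So nu is a root of [Q], and then its multiplicity drops by exactly one in Q'. A
    simple root of Q' need not be a root of [Q], hence the bound on [j]. *)
Lemma real_rooted_lift (Q : {poly R}) nu j : real_rooted Q -> (1 < size Q)%N ->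
  (2 <= j)%N -> ('X - nu%:P) ^+ j %| Q^`() -> ('X - nu%:P) ^+ j.+1 %| Q.
Proof.
move=> rr sQ j2 dv.
have Q0 : Q != 0 by rewrite -size_poly_gt0 (ltn_trans _ sQ).
have [s eQ] := real_rooted_roots Q0 rr.
have c0 : lead_coef Q != 0 by rewrite lead_coef_eq0.
have szs : (0 < size s)%N by move: sQ; rewrite eQ size_scale // size_XsubCs.
have [m [q]] := multiplicity_XsubC Q nu; rewrite Q0 /= => qnu eQm.
have m0 : (0 < m)%N.
  rewrite lt0n; apply: contraNneq qnu => m0; move: eQm; rewrite m0 expr0 mulr1 => <-.
  rewrite rootE eQ hornerZ mulf_eq0 (negPf c0) -[_ == 0]/(root _ _) XsubCs_root /=.
  apply/negPn/negP => nus.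
  have /dvdpP [g eg] : ('X - nu%:P) ^+ 2 %| Q^`().
    by apply: dvdp_trans dv; rewrite dvdp_exp2l.
  have XQ0 : (XsubCs s).[nu] != 0 by rewrite -[_ == 0]/(root _ _) XsubCs_root.
  have e1 : (XsubCs s)^`().[nu] = 0.
    apply: (mulfI c0); rewrite mulr0 -hornerZ -derivZ -eQ eg !hornerE.
    by rewrite /= subrr; ring.
  have e2 : (XsubCs s)^`()^`().[nu] = 0.
    apply: (mulfI c0); rewrite mulr0 -hornerZ -!derivZ -eQ eg !derivE !hornerE.
    by rewrite /= subrr; ring.
  move/eqP: e1; rewrite horner_deriv_XsubCs // mulf_eq0 (negPf XQ0) /= => /eqP e1.
  move/eqP: e2; rewrite deriv2_XsubCs // e1 mulf_eq0 (negPf XQ0) /= expr0n sub0r oppr_eq0.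
  rewrite psumr_eq0 => [|a _]; last exact: sqr_ge0.
  case: s nus szs {eQ e1 XQ0} => [//|a s]; rewrite inE negb_or => /andP[na _] _.
  by rewrite /= sqrf_eq0 invr_eq0 subr_eq0 (negPf na).
case: m m0 eQm => // m _ eQm; rewrite eQm dvdp_mull // dvdp_exp2l // ltnS.
rewrite leqNgt; apply/negP => lt.
have e : Q^`() = ('X - nu%:P) ^+ m * (q^`() * ('X - nu%:P) + q *+ m.+1).
  rewrite eQm derivM deriv_exp derivXsubC mul1r exprS mulrnAr -mulrnAl /=.
  by move: (_ *+ m.+1) => r; ring.
have : ('X - nu%:P) ^+ m.+1 %| Q^`().
  by apply: dvdp_trans dv; rewrite dvdp_exp2l.
rewrite e exprSr dvdp_mul2l ?expf_neq0 ?polyXsubC_eq0 // dvdp_XsubCl rootE.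
rewrite hornerD hornerM hornerMn hornerXsubC subrr mulr0 add0r mulrn_eq0 /=.
by rewrite -[_ == 0]/(root _ _) (negPf qnu).
Qed.

End Rayleigh.

(** * Multiple roots of a finite free convolution *)

Lemma XsubCs_cons (A : nzRingType) a (s : seq A) : XsubCs (a :: s) = ('X - a%:P) * XsubCs s.
Proof. exact: big_cons. Qed.

Lemma XsubCs_perm (A : comNzRingType) (s t : seq A) : perm_eq s t -> XsubCs s = XsubCs t.
Proof. exact: perm_big. Qed.

Lemma mup_XsubCs (F : fieldType) (s : seq F) mu : mup mu (XsubCs s) = count_mem mu s.
Proof.
elim: s => [|a s IH]; first by rewrite /XsubCs big_nil mupNroot // rootE hornerC oner_neq0.
rewrite XsubCs_cons mupM ?polyXsubC_eq0 -?size_poly_eq0 ?size_XsubCs //= IH.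
by rewrite -['X - _]expr1 mup_XsubCX; case: eqVneq.
Qed.

Lemma leq_size_derivn (A : nzRingType) (P : {poly A}) k : (size P^`(k) <= size P)%N.
Proof.
elim: k => // k; apply: leq_trans; rewrite derivnS.
have [->|P0] := eqVneq P^`(k) 0; first by rewrite deriv0.
by rewrite ltnW // lt_size_deriv.
Qed.

Lemma size_deriv_num (F : numDomainType) (Q : {poly F}) : size Q^`() = (size Q).-1.
Proof.
have [->|Q0] := eqVneq Q 0; first by rewrite deriv0 size_poly0.
case sQ : (size Q) => [|[|n]]; first by move/eqP: sQ; rewrite size_poly_eq0 (negPf Q0).
  by rewrite (size1_polyC (eq_leq sQ)) derivC size_poly0.
apply/eqP; rewrite -sQ eqn_leq -ltnS prednK ?size_poly_gt0 // lt_size_deriv //=.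
rewrite sQ /= ltnNge; apply: contra Q0 => lt; rewrite -lead_coef_eq0 lead_coefE sQ.
have := nth_default 0 lt; rewrite coef_deriv => /eqP.
by rewrite mulrn_eq0.
Qed.

Section DoubleRoot.
Variable R : rcfType.
Local Notation iota := (real_complex R).
Local Notation Im := complex.Im.

(** Gauss-Lucas: in the upper half plane every summand of Q'/Q = sum of (z - b)^-1 has negative
    imaginary part. *)
Lemma real_rooted_deriv (Q : {poly R}) : real_rooted Q -> real_rooted Q^`().
Proof.
move=> [->|st]; first by left; rewrite deriv0.
have [sQ|sQ] := leqP (size Q) 1; first by left; rewrite (size1_polyC sQ) derivC.
have Q0 : map_poly iota Q != 0 by rewrite map_poly_eq0 -size_poly_gt0 (ltn_trans _ sQ).
have [rs [e hrs]] := stable_roots Q0 st.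
right=> z z0; rewrite -deriv_map.
have c0 : lead_coef (map_poly iota Q) != 0 by rewrite lead_coef_eq0.
have zrs : z \notin rs.
  by apply: contraTN z0 => /hrs; rewrite leNgt.
rewrite e derivZ hornerZ horner_deriv_XsubCs // !mulf_neq0 //.
  by rewrite -[_ == 0]/(root _ _) XsubCs_root.
suff : Im (\sum_(b <- rs) (z - b)^-1) < 0 by apply: contraTneq => ->; rewrite ltxx.
have h b : b \in rs -> Im (z - b)^-1 < 0.
  move=> /[dup] /hrs hb brs; rewrite Im_inv mulNr oppr_lt0 mulr_gt0 //.
    by case: z b hb z0 {zrs brs} => z1 z2 [b1 b2] /=; lra.
  rewrite lt0r sqn_ge0 sqn_eq0 invr_eq0 subr_eq0 andbT.
  by apply: contraNneq zrs => ->.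
have : size rs != 0.
  by move: sQ; rewrite -(size_map_poly iota) e size_scale // size_XsubCs ltnS lt0n.
case: rs h {e hrs zrs} => // b rs h _; rewrite big_cons raddfD /= raddf_Im_sum.
rewrite ltr_wnDr ?h ?mem_head // big_seq sumr_le0 // => c cs.
by rewrite ltW // h // inE cs orbT.
Qed.

Lemma dvdp_XsubC_sqr (Q : {poly R}) nu : Q.[nu] = 0 -> Q^`().[nu] = 0 ->
  ('X - nu%:P) ^+ 2 %| Q.
Proof.
move=> /rootP /factor_theorem [q ->]; rewrite derivM derivXsubC mulr1 !hornerE /=.
rewrite subrr mulr0 add0r => /rootP /factor_theorem [r ->].
by rewrite -mulrA -expr2 dvdp_mull.
Qed.

(* Moving one of two equal roots mu by t and one of two equal roots mu2 by c t,
   the Rayleigh inequality for the two unmoved ones reads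
   0 <= c t^2 (G2 - t w1) (G1 - c t w2); small t and c = 1, -1 contradict it. *)
Lemma apolar_two_clusters (w : seq R) (Q : {poly R}) mu mu2 x :
  let L t := apolar (size w).+4 (XsubCs t) Q x in
  (size Q <= (size w).+4.+1)%N -> real_rooted Q ->
  L [:: mu, mu, mu2, mu2 & w] = 0 ->
  L [:: mu, mu2, mu2 & w] = 0 -> L [:: mu, mu, mu2 & w] = 0 ->
  L [:: mu, mu2 & w] = 0 ->
  L [:: mu, mu & w] != 0 -> L [:: mu2, mu2 & w] != 0 -> False.
Proof.
move=> L sQ rr L4 L3 L3' L2 G2 G1.
have Lp s t : perm_eq s t -> L s = L t by move=> h; rewrite /L (XsubCs_perm h).
have ex t c v : L [:: mu + t, mu2 + c * t & v] =
    L [:: mu, mu2 & v] - t * L (mu2 :: v) - c * t * L (mu :: v) + c * t ^+ 2 * L v.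
  rewrite /L -!apolarZ -!apolarB -apolarD !XsubCs_cons; congr (apolar _ _ _ _).
  by rewrite -!mul_polyC !polyCD !polyCM; ring.
have Ray t c : 0 <= c * t ^+ 2 * (L [:: mu, mu & w] - t * L (mu :: w)) *
    (L [:: mu2, mu2 & w] - c * t * L (mu2 :: w)).
  have := @apolar_rayleigh R [:: mu + t, mu2 + c * t & w] Q mu mu2 x sQ rr.
  rewrite /= -!/(L _).
  rewrite (Lp [:: mu, mu2, _, _ & _] [:: mu + t, mu2 + c * t, mu, mu2 & w]); last first.
    exact: (permEl (perm_catCA [:: mu; mu2] [:: _; _] w)).
  rewrite (Lp [:: mu, _, _ & _] [:: mu + t, mu2 + c * t, mu & w]); last first.
    exact: (permEl (perm_catCA [:: mu] [:: _; _] w)).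
  rewrite (Lp [:: mu2, _, _ & _] [:: mu + t, mu2 + c * t, mu2 & w]); last first.
    exact: (permEl (perm_catCA [:: mu2] [:: _; _] w)).
  rewrite !ex.
  rewrite (Lp [:: mu, mu2, mu, mu2 & w] [:: mu, mu, mu2, mu2 & w]); last first.
    by rewrite perm_cons; exact: (permEl (perm_catCA [:: mu2] [:: mu] _)).
  rewrite (Lp [:: mu2, mu, mu2 & w] [:: mu, mu2, mu2 & w]); last first.
    exact: (permEl (perm_catCA [:: mu2] [:: mu] _)).
  rewrite (Lp [:: mu, mu2, mu & w] [:: mu, mu, mu2 & w]); last first.
    by rewrite perm_cons; exact: (permEl (perm_catCA [:: mu2] [:: mu] _)).
  rewrite (Lp [:: mu2, mu & w] [:: mu, mu2 & w]); last first.
    exact: (permEl (perm_catCA [:: mu2] [:: mu] _)).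
  rewrite L4 L3 L3' L2 -subr_ge0 => h; apply: le_trans h _.
  by rewrite le_eqVlt; apply/orP; left; apply/eqP; ring.
move: Ray G1 G2.
move: (L [:: mu, mu & w]) (L (mu :: w)) (L [:: mu2, mu2 & w]) (L (mu2 :: w)).
move=> g2 w1 g1 w2 Ray G1 G2.
(* Since D exceeds |r1| and |r2|, at t = D^-1 the last two factors have the signs of g2 and g1, and
   [Ray] reads 0 <= c g1 g2. *)
pose r1 := w1 / g2; pose r2 := w2 / g1; pose D := 1 + r1 ^+ 2 + r2 ^+ 2.
have D0 : 0 < D by rewrite /D; have := sqr_ge0 r1; have := sqr_ge0 r2; lra.
have e1 : w1 = r1 * g2 by rewrite divfK.
have e2 : w2 = r2 * g1 by rewrite divfK.
have pos c : c ^+ 2 = 1 -> 0 <= c * (g1 * g2).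
  move=> c1; have := Ray D^-1 c; rewrite e1 e2.
  have -> : c * D^-1 ^+ 2 * (g2 - D^-1 * (r1 * g2)) * (g1 - c * D^-1 * (r2 * g1)) =
     (c * (g1 * g2)) * (D^-1 ^+ 2 * (1 - D^-1 * r1) * (1 - D^-1 * (c * r2))) by ring.
  have Di : 0 < D^-1 by rewrite invr_gt0.
  rewrite pmulr_lge0 // !mulr_gt0 // ?exprn_gt0 //.
    by rewrite subr_gt0 mulrC ltr_pdivrMr // mul1r /D; have := sqr_ge0 (r1 - 1);
       have := sqr_ge0 r2; nra.
  rewrite subr_gt0 mulrC ltr_pdivrMr // mul1r /D.
  have e : (c * r2) ^+ 2 = r2 ^+ 2 by rewrite exprMn c1 mul1r.
  by have := sqr_ge0 (c * r2 - 1); have := sqr_ge0 r1; rewrite -e; nra.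
have p1 := pos 1 (expr1n _ _); have p2 := pos (-1) (sqrr_sign _ 1).
have : g1 * g2 == 0 by rewrite eq_le; lra.
by rewrite mulf_eq0 (negPf G1) (negPf G2).
Qed.


(** By the Rayleigh inequality the pairing vanishes on P/(X - a) for every root a of P. If it also
    vanishes on the derivative of some P/(X - a), induction applies to this quotient and Q'.
    Otherwise all roots of P are multiple, and two distinct ones contradict
    [apolar_two_clusters]. *)
Lemma apolar_double_root n (s : seq R) (Q : {poly R}) x :
  size s = n -> size Q = n.+1 -> real_rooted Q ->
  apolar n (XsubCs s) Q x = 0 -> apolar n (XsubCs s)^`() Q x = 0 ->
  exists mu nu j, [/\ mu + nu = x, ('X - nu%:P) ^+ j %| Q &
                     (n.+2 <= count_mem mu s + j)%N].
Proof.
elim: n s Q => [|n IH] s Q ss sQ rr L0 L1.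
  move: L0; rewrite (size0nil ss) /apolar big_ord1 /XsubCs big_nil !derivn0 hornerC mul1r.
  have [c eQ] : exists c, Q = c%:P by exists Q`_0; apply: size1_polyC; rewrite sQ.
  by move: sQ; rewrite eQ size_polyC hornerC => + c0; rewrite c0 eqxx.
pose L t := apolar n.+1 (XsubCs t) Q x.
have Lp t1 t2 : perm_eq t1 t2 -> L t1 = L t2 by move=> h; rewrite /L (XsubCs_perm h).
have prem a b : a \in s -> b \in s -> a != b ->
    [/\ b \in rem a s, perm_eq s [:: a, b & rem b (rem a s)],
       perm_eq (rem a s) (b :: rem b (rem a s)) &
       perm_eq (rem b s) (a :: rem b (rem a s))].
  move=> sa sb ab; have bs : b \in rem a s.
    by rewrite -has_pred1 has_count count_mem_rem (negPf ab) subn0 -has_count has_pred1.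
  have h1 := perm_to_rem bs.
  have h2 : perm_eq s [:: a, b & rem b (rem a s)].
    by apply: (perm_trans (perm_to_rem sa)); rewrite perm_cons.
  split=> //; rewrite -(perm_cons b).
  rewrite -(permPl (perm_to_rem sb)) (permPl h2).
  exact: (permEl (perm_catCA [:: a] [:: b] _)).
have szw a b : a \in s -> b \in rem a s -> (size (rem b (rem a s))).+2 = n.+1.
  move=> sa sb; rewrite -ss (perm_size (perm_to_rem sa)) /=.
  by rewrite (perm_size (perm_to_rem sb)).
have nonneg a b : a \in s -> b \in s -> 0 <= L (rem a s) * L (rem b s).
  move=> sa sb; have [->|ab] := eqVneq a b; first by rewrite -expr2 sqr_ge0.
  have [rb p1 p2 p3] := prem a b sa sb ab.
  rewrite (Lp _ _ p2) (Lp _ _ p3) mulrC.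
  have /= := @apolar_rayleigh R (rem b (rem a s)) Q a b x.
  rewrite szw // sQ => /(_ (leqnn _) rr); rewrite -!/(L _) -(Lp _ _ p1).
  by rewrite [L s]L0 mulr0.
have L1' : \sum_(a <- s) L (rem a s) = 0 by move: L1; rewrite deriv_XsubCs apolar_sum.
(* The values L (rem a s) sum to the pairing with P', which is 0, and their pairwise products are
   nonnegative; so each of their squares vanishes. *)
have Lrem b : b \in s -> L (rem b s) = 0.
  move=> sb; have : \sum_(a <- s) L (rem a s) * L (rem b s) == 0.
    by rewrite -mulr_suml L1' mul0r.
  rewrite big_seq psumr_eq0 => [/allP /(_ b sb)|a sa]; last exact: nonneg.
  by rewrite sb /= mulf_eq0 orbb => /eqP.
have Lrem2 a b : a \in s -> b \in s -> a != b -> L (rem b (rem a s)) = 0.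
  move=> sa sb ab; have [rb p1 p2 p3] := prem a b sa sb ab.
  have : L (rem a s) - L (rem b s) = (a - b) * L (rem b (rem a s)).
    rewrite (Lp _ _ p2) (Lp _ _ p3) /L !XsubCs_cons -apolarB -apolarZ.
    by congr (apolar _ _ _ _); rewrite -mulrBl -mul_polyC polyCB; ring.
  rewrite !Lrem // subrr => /esym/eqP; rewrite mulf_eq0 subr_eq0 (negPf ab) /=.
  by move/eqP.
have size_rem' a : a \in s -> size (rem a s) = n.
  by move=> sa; rewrite size_rem // ss.
(* Only the summands that remove [a] a second time survive, by [Lrem2]. *)
have Lder a : a \in s -> apolar n.+1 (XsubCs (rem a s))^`() Q x =
    (count_mem a (rem a s))%:R * L (rem a (rem a s)).
  move=> sa; rewrite deriv_XsubCs apolar_sum -sum1_count natr_sum mulr_suml.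
  rewrite [RHS]big_mkcond; apply: eq_big_seq => b bs /=.
  have [->|ba] := eqVneq b a; first by rewrite mul1r.
  by apply: Lrem2 => //; [exact: mem_rem bs | rewrite eq_sym].
have [/hasP[a sa /eqP cG]|] :=
  boolP (has (fun a => (count_mem a (rem a s))%:R * L (rem a (rem a s)) == 0) s).
  have sP1 : (size (XsubCs (rem a s)) <= n.+1)%N by rewrite size_XsubCs size_rem'.
  have sP2 : (size (XsubCs (rem a s))^`() <= n.+1)%N.
    by apply: leq_trans sP1; apply: ltnW; apply: lt_size_deriv; exact: XsubCs_neq0.
  have [|||||mu [nu [j [e dv cnt]]]] := IH (rem a s) Q^`().
  - exact: size_rem'.
  - by rewrite size_deriv_num sQ.
  - exact: real_rooted_deriv.
  - by rewrite -apolar_deriv //; exact: Lrem.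
  - by rewrite -apolar_deriv // Lder.
  (* This bound forces j >= 2, as lifting the root from Q' to Q requires. *)
  have cn : (count_mem mu (rem a s) <= n)%N by rewrite -(size_rem' a sa) count_size.
  exists mu, nu, j.+1; split=> //.
    apply: real_rooted_lift => //; first by rewrite sQ.
    by have := leq_trans cnt (leq_add cn (leqnn j)); rewrite -addn2 leq_add2l.
  have -> : count_mem mu s = ((a == mu) + count_mem mu (rem a s))%N.
    by have /seq.permP -> := perm_to_rem sa.
  by rewrite addnS ltnS; apply: (leq_trans cnt); rewrite leq_add2r leq_addl.
rewrite -all_predC => /allP /= Gn0.
have Gne a : a \in s -> (1 < count_mem a s)%N /\ L (rem a (rem a s)) != 0.
  move=> /[dup] sa /Gn0; rewrite mulf_eq0 negb_or pnatr_eq0 -lt0n => /andP[ca ->].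
  by split=> //; have /seq.permP -> := perm_to_rem sa; rewrite /= eqxx add1n ltnS.
have [mu smu] : exists mu, mu \in s.
  by case: (s) ss => // b t _; exists b; exact: mem_head.
(* If all roots equal mu, the two hypotheses say that Q and Q' vanish at x - mu. *)
have [/all_pred1P sn|] := boolP (all (pred1 mu) s).
  rewrite ss in sn.
  exists mu, (x - mu), 2; split; first by rewrite addrC subrK.
    apply: dvdp_XsubC_sqr.
      move/eqP: L0; rewrite sn XsubCs_nseq apolar_exp ?sQ // mulf_eq0 pnatr_eq0.
      by rewrite eqn0Ngt fact_gt0 => /eqP.
    move/eqP: L1; rewrite sn XsubCs_nseq deriv_exp derivXsubC mul1r /= -scaler_nat apolarZ.
    rewrite apolar_deriv ?size_exp_XsubC // apolar_exp ?size_deriv_num ?sQ //.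
    by rewrite !mulf_eq0 !pnatr_eq0 /= eqn0Ngt fact_gt0 => /eqP.
  by rewrite sn count_nseq /= eqxx mul1n addn2.
rewrite -has_predC => /hasP[mu2 smu2 /= mu2mu].
have [c1 G1] := Gne _ smu; have [c2 G2] := Gne _ smu2.
pose w := rem mu2 (rem mu2 (rem mu (rem mu s))).
have crem (t : seq R) b : (0 < count_mem b t)%N -> b \in t.
  by rewrite -has_count has_pred1.
have m1 : mu \in rem mu s by apply: crem; rewrite count_mem_rem eqxx subn_gt0.
have m2 : mu2 \in rem mu (rem mu s).
  by apply: crem; rewrite !count_mem_rem [mu == _]eq_sym (negPf mu2mu) !subn0 ltnW.
have m3 : mu2 \in rem mu2 (rem mu (rem mu s)).
  apply: crem; rewrite !count_mem_rem eqxx [mu == _]eq_sym (negPf mu2mu) !subn0.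
  by rewrite subn_gt0.
have ps : perm_eq s [:: mu, mu, mu2, mu2 & w].
  apply: (perm_trans (perm_to_rem smu)); rewrite perm_cons.
  apply: (perm_trans (perm_to_rem m1)); rewrite perm_cons.
  apply: (perm_trans (perm_to_rem m2)); rewrite perm_cons.
  exact: perm_to_rem.
have hr (a : R) (t u : seq R) : perm_eq t (a :: u) -> perm_eq (rem a t) u.
  move=> h; have ta : a \in t by rewrite (perm_mem h) mem_head.
  by rewrite -(perm_cons a) -(permPl (perm_to_rem ta)).
have sw : (size w).+4 = n.+1 by rewrite -ss (perm_size ps).
have ps2 : perm_eq s [:: mu2, mu2, mu, mu & w].
  by apply: (perm_trans ps); exact: (permEl (perm_catCA [:: mu; mu] [:: mu2; mu2] w)).
have ps3 : perm_eq (rem mu2 s) [:: mu, mu, mu2 & w].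
  have h := hr _ _ _ ps2; apply: (perm_trans h).
  exact: (permEl (perm_catCA [:: mu2] [:: mu; mu] w)).
have ps4 : perm_eq (rem mu (rem mu2 s)) [:: mu, mu2 & w] by exact: hr.
have ps5 : perm_eq (rem mu2 (rem mu2 s)) [:: mu, mu & w] by do 2!apply: (hr).
have ps6 : perm_eq (rem mu (rem mu s)) [:: mu2, mu2 & w] by do 2!apply: (hr).
exfalso; apply: (@apolar_two_clusters w Q mu mu2 x) => //; rewrite sw ?sQ // -/(L _).
- by rewrite -(Lp _ _ ps).
- by rewrite -(Lp _ _ (hr _ _ _ ps)) Lrem.
- by rewrite -(Lp _ _ ps3) Lrem.
- by rewrite -(Lp _ _ ps4) Lrem2.
- by rewrite -(Lp _ _ ps5).
- by rewrite -(Lp _ _ ps6).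
Qed.

(** Induction on the multiplicity, differentiating both P and Q. The multiplicities found in P' and
    Q' add up to at least n + m + 2 and neither exceeds n, so both are at least 2 and each gains one
    when lifted. *)
Lemma apolar_multiple_root m n (s : seq R) (Q : {poly R}) x :
  size s = n -> size Q = n.+1 -> real_rooted Q ->
  (forall k, (k < m.+2)%N -> apolar n (XsubCs s)^`(k) Q x = 0) ->
  exists mu nu j, [/\ mu + nu = x, ('X - nu%:P) ^+ j %| Q &
                     (n + m.+2 <= count_mem mu s + j)%N].
Proof.
elim: m n s Q => [|m IH] n s Q ss sQ rr L0.
  rewrite addn2; apply: apolar_double_root => //; first exact: (L0 0%N).
  by rewrite -derivn1; exact: L0.
case: n ss sQ L0 => [|n] ss sQ L0.
  have := L0 0%N isT; rewrite (size0nil ss) /apolar big_ord1 /XsubCs big_nil !derivn0.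
  rewrite hornerC mul1r; have [c eQ] : exists c, Q = c%:P.
    by exists Q`_0; apply: size1_polyC; rewrite sQ.
  by move: sQ; rewrite eQ size_polyC hornerC => + c0; rewrite c0 eqxx.
have sP : size (XsubCs s) = n.+2 by rewrite size_XsubCs ss.
have sP' : size (XsubCs s)^`() = n.+1 by rewrite size_deriv_num sP.
have P'0 : (XsubCs s)^`() != 0 by rewrite -size_poly_eq0 sP'.
have rrP : real_rooted (XsubCs s) by rewrite -[XsubCs s]scale1r; exact: real_rootedZ.
have [s' es'] := real_rooted_roots P'0 (real_rooted_deriv rrP).
have c0 : lead_coef (XsubCs s)^`() != 0 by rewrite lead_coef_eq0.
have ss' : size s' = n.
  by apply/succn_inj; rewrite -size_XsubCs -sP' [in RHS]es' size_scale.
have sQ' : size Q^`() = n.+1 by rewrite size_deriv_num sQ.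
have [|k km|mu [nu [j [e dv cnt]]]] := IH n s' Q^`() ss' _ (real_rooted_deriv rr).
- exact: sQ'.
- apply: (mulfI c0); rewrite mulr0 -apolarZ -derivnZ -es' -derivSn -apolar_deriv.
    exact: L0.
  by rewrite derivSn; apply: leq_trans (leq_size_derivn _ _) _; rewrite sP'.
have cn : (count_mem mu s' <= n)%N by rewrite -ss' count_size.
have jn : (j <= n)%N.
  rewrite -ltnS -sQ' -(size_exp_XsubC j nu); apply: dvdp_leq => //.
  by rewrite -size_poly_eq0 sQ'.
have j2 : (2 <= j)%N.
  have := leq_trans cnt (leq_add cn (leqnn j)); rewrite leq_add2l.
  by apply: leq_trans; rewrite !ltnS.
have c2 : (2 <= count_mem mu s')%N.
  have := leq_trans cnt (leq_add (leqnn _) jn); rewrite [(count_mem _ _ + _)%N]addnC leq_add2l.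
  by apply: leq_trans; rewrite !ltnS.
exists mu, nu, j.+1; split=> //.
  by apply: real_rooted_lift => //; rewrite sQ.
have : (count_mem mu s' < count_mem mu s)%N.
  rewrite -(mup_XsubCs s) mup_geq ?XsubCs_neq0 //; apply: real_rooted_lift => //.
    by rewrite sP.
  by rewrite es' dvdpZr // -mup_geq ?XsubCs_neq0 // mup_XsubCs.
move=> lt; rewrite addSnnS addnS [leqRHS]addnS ltnS addnS.
by apply: leq_trans (leq_add lt (leqnn j)); rewrite addSn ltnS.
Qed.

End DoubleRoot.

(** * The convolution as an apolar pairing *)

Lemma horner_eq0 (F : numDomainType) (p : {poly F}) : (forall x, p.[x] = 0) -> p = 0.
Proof.
move=> p0; apply/eqP; apply: contraT => pn0.
have := @max_poly_roots _ p [seq i%:R | i <- iota 0 (size p)] pn0.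
rewrite size_map size_iota ltnn; apply.
  by apply/allP => _ /mapP[i _ ->]; rewrite rootE p0.
by rewrite map_inj_uniq ?iota_uniq // => i j /eqP; rewrite eqr_nat => /eqP.
Qed.

Lemma horner_inj (F : numDomainType) (p q : {poly F}) : (forall x, p.[x] = q.[x]) -> p = q.
Proof.
by move=> e; apply/subr0_eq/horner_eq0 => x; rewrite hornerD hornerN e subrr.
Qed.

Section MpolyEval.
Variable F : numDomainType.

Lemma meval_muni n (p : {mpoly F[n.+1]}) (v : 'I_n.+1 -> F) :
  p.@[v] = (map_poly (meval (fun i => v (widen_ord (leqnSn n) i))) (muni p)).[v ord_max].
Proof.
rewrite mevalE muniE rmorph_sum horner_sum; apply: eq_bigr => m _ /=.
rewrite map_polyZ map_polyXn hornerZ hornerXn /= mevalZ mevalX -mulrA big_ord_recr /=.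
by congr (_ * (_ * _)); apply: eq_bigr => i _; rewrite mnmE.
Qed.

Lemma meval_eq0 n (p : {mpoly F[n]}) : (forall v, p.@[v] = 0) -> p = 0.
Proof.
elim: n p => [|n IH] p p0.
  have e : p = (p@_0)%:MP.
    apply/mpolyP => m; rewrite mcoeffC; have -> : m = 0%MM by apply/mnmP; case.
    by rewrite eqxx mulr1.
  by have := p0 (fun=> 0); rewrite e mevalC => ->; rewrite mpolyC0.
have u0 k : (muni p)`_k = 0.
  apply: IH => v.
  have h : map_poly (meval v) (muni p) = 0.
    apply: horner_eq0 => x.
    pose w (i : 'I_n.+1) := if unlift ord_max i is Some j then v j else x.
    have := p0 w; rewrite meval_muni /w unlift_none => <-.
    congr (_.[_]); apply: eq_map_poly => q; apply: meval_eq => i.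
    have -> : widen_ord (leqnSn n) i = lift ord_max i.
      by apply/val_inj; rewrite /= /bump leqNgt ltn_ord.
    by rewrite liftK.
  by have := congr1 (fun q : {poly F} => q`_k) h; rewrite coef0 coef_map.
apply/mpolyP => m; rewrite mcoeff0.
pose m' := [multinom m (widen_ord (leqnSn n) i) | i < n].
have := congr1 (mcoeff m') (u0 (m ord_max)).
rewrite mcoeff0 muniE coef_sum raddf_sum /= => e.
have [ms|] := boolP (m \in msupp p); last exact: memN_msupp_eq0.
rewrite -e (bigD1_seq m) ?msupp_uniq //= coefZ coefXn eqxx mulr1 mcoeffZ mcoeffX eqxx mulr1.
rewrite big1 ?addr0 // => k km; rewrite coefZ coefXn.
have [ke|] := eqVneq; last by rewrite mulr0 mcoeff0.
rewrite mulr1 mcoeffZ mcoeffX; case: eqVneq => [e2|_]; last by rewrite mulr0.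
case/eqP: km; apply/mnmP => i; case: (unliftP ord_max i) => [j ->|-> //].
have -> : lift ord_max j = widen_ord (leqnSn n) j.
  by apply/val_inj; rewrite /= /bump leqNgt ltn_ord.
by have /mnmP /(_ j) := e2; rewrite !mnmE.
Qed.

Lemma meval_inj n (p q : {mpoly F[n]}) : (forall v, p.@[v] = q.@[v]) -> p = q.
Proof. by move=> e; apply/subr0_eq/meval_eq0 => v; rewrite mevalB e subrr. Qed.

End MpolyEval.

Section Fconv.
Variable F : numFieldType.
Implicit Types p q : {poly F}.

Lemma horner0_derivn p k : p^`(k).[0] = p`_k * k`!%:R.
Proof. by rewrite horner_coef0 coef_derivn addn0 ffactnn mulr_natr. Qed.

(** The factorials of the convolution turn coefficients into derivatives, so that the convolution is
    a constant-coefficient differential operator, given by q, applied to p. *)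
Lemma fconvE n p q : (size p <= n.+1)%N ->
  fconv n p q = n`!%:R^-1 *: \sum_(j < n.+1) q^`(n - j).[0] *: p^`(j).
Proof.
move=> sp; apply/polyP => m.
have -> : fconv n p q = \poly_(m < n.+1) ((-1) ^+ (n - m) * fconv_coef n p q (n - m)).
  rewrite poly_def /fconv (reindex_inj rev_ord_inj) /=; apply: eq_bigr => i _.
  by rewrite subSS subKn // -ltnS.
rewrite coef_poly coefZ coef_sum; case: ltnP => [mn|nm]; last first.
  rewrite big1 ?mulr0 // => j _; rewrite coefZ coef_derivn nth_default ?mul0rn ?mulr0 //.
  by apply: leq_trans sp (leq_trans nm (leq_addl _ _)).
set k := (n - m)%N; have kn : (k <= n)%N by rewrite leq_subr.
have mk : (n - k)%N = m by rewrite /k subKn // -ltnS.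
pose T (j : nat) := (q^`(n - j).[0] *: p^`(j))`_m.
(* For j > k the j-th derivative of p has degree below m, so these terms do not reach the
   coefficient of degree m. *)
transitivity (n`!%:R^-1 * \sum_(j < k.+1) T j); last first.
  congr (_ * _); rewrite (big_ord_widen n.+1 T) ?ltnS // big_mkcond.
  apply: eq_bigr => j _; case: ltnP => // kj; rewrite coefZ coef_derivn nth_default.
    by rewrite mul0rn mulr0.
  apply: leq_trans sp _; move: kj kn mk; clearbody k; clear; move: (nat_of_ord j) => i; lia.
rewrite /fconv_coef (reindex_inj rev_ord_inj) !mulr_sumr; apply: eq_bigr => j _ /=.
have jk : (j <= k)%N by rewrite -ltnS.
rewrite subSS subKn // /T coefZ horner0_derivn coef_derivn /signed_coef mk.
have -> : (n - (k - j) = j + m)%N by rewrite subnBA // -mk addnC addnBA.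
rewrite -[p`__ *+ _]mulr_natr -(ffact_fact (leq_addr m j)) addKn !natrM.
set P := p`_(j + m); set Q := q`_(n - j).
have sg : (-1) ^+ k * ((-1) ^+ (k - j) * (-1) ^+ j) = 1 :> F.
  by rewrite -exprD subnK // -exprD addnn -mul2n exprM sqrrN expr1n expr1n.
have m0 : m`!%:R != 0 :> F by rewrite pnatr_eq0 -lt0n fact_gt0.
have n0 : n`!%:R != 0 :> F by rewrite pnatr_eq0 -lt0n fact_gt0.
transitivity (((-1) ^+ k * ((-1) ^+ (k - j) * (-1) ^+ j)) *
  (n`!%:R^-1 * (Q * (n - j)`!%:R * (P * ((j + m) ^_ j)%:R)))); last by rewrite sg mul1r.
move: ((-1) ^+ k) ((-1) ^+ (k - j)) ((-1) ^+ j) (n`!%:R) (m`!%:R) ((n - j)`!%:R)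
  (((j + m) ^_ j)%:R) m0 n0 => s1 s2 s3 f1 f2 f3 f4 m0 n0.
by field; rewrite ?m0 ?n0.
Qed.

Lemma fconv_derivn n p q k x : (size p <= n.+1)%N ->
  (fconv n p q)^`(k).[x] = n`!%:R^-1 * apolar n p^`(k) q x.
Proof.
move=> sp; rewrite fconvE // derivnZ hornerZ linear_sum /= horner_sum; congr (_ * _).
apply: eq_bigr => j _; rewrite derivnZ hornerZ mulrC; congr (_.[x] * _).
by rewrite /derivn -!iterD addnC.
Qed.

Lemma fconvC n p q : fconv n p q = fconv n q p.
Proof.
apply: eq_bigr => k _; congr (_ * _ *: _).
rewrite /fconv_coef (reindex_inj rev_ord_inj) /=; apply: eq_bigr => i _.
have ik : (i <= k)%N by rewrite -ltnS.
rewrite subSS subKn // [X in X%:R / _]mulnC; congr (_ * _); exact: mulrC.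
Qed.

Lemma root_polyE n (a : 'rV[F]_n) : root_poly a = XsubCs [seq a 0 i | i <- enum 'I_n].
Proof. by rewrite /root_poly /XsubCs big_map big_enum. Qed.

Lemma coef_XsubCs_scale (s : seq F) c k : (k <= size s)%N ->
  (XsubCs (map ( *%R c) s))`_(size s - k) = c ^+ k * (XsubCs s)`_(size s - k).
Proof.
elim: s k => [|b s IH] k /=; first by rewrite leqn0 => /eqP ->; rewrite mul1r.
rewrite !XsubCs_cons !mulrBl !coefB !coefXM !coefCM; case: k => [|k] km.
  rewrite mul1r !subn0 /= [X in _ = _ - _ * X]nth_default ?size_XsubCs //.
  rewrite [X in _ - _ * X = _]nth_default ?size_XsubCs ?size_map // !mulr0.
  by have := IH 0%N isT; rewrite subn0 mul1r => ->.
rewrite subSS IH // mulrBr exprSr; congr (_ - _); last by ring.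
case: eqP => [_|/eqP]; first by rewrite mulr0.
rewrite subn_eq0 -ltnNge => ks.
by have := IH k.+1 ks; rewrite subnS exprSr.
Qed.

Lemma signed_coef_scale n c (a : 'rV[F]_n) k : (k <= n)%N ->
  signed_coef n (root_poly (c *: a)) k = c ^+ k * signed_coef n (root_poly a) k.
Proof.
rewrite /signed_coef mulrCA => kn; congr (_ * _).
have -> : root_poly (c *: a) = XsubCs (map ( *%R c) [seq a 0 i | i <- enum 'I_n]).
  by rewrite /root_poly /XsubCs [RHS]big_map [RHS]big_map [RHS]big_enum; apply: eq_bigr => i _; rewrite mxE.
rewrite root_polyE.
have sz : size [seq a 0 i | i <- enum 'I_n] = n by rewrite size_map size_enum_ord.
by have := @coef_XsubCs_scale [seq a 0 i | i <- enum 'I_n] c k; rewrite sz; apply.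
Qed.

Lemma coef_fconv n p q m : (fconv n p q)`_m =
  if (m < n.+1)%N then (-1) ^+ (n - m) * fconv_coef n p q (n - m) else 0.
Proof.
have -> : fconv n p q = \poly_(m < n.+1) ((-1) ^+ (n - m) * fconv_coef n p q (n - m)).
  rewrite poly_def /fconv (reindex_inj rev_ord_inj) /=; apply: eq_bigr => i _.
  by rewrite subSS subKn // -ltnS.
by rewrite coef_poly.
Qed.

(** The k-th signed coefficients scale by c^k on both sides. Comparing coefficients rather than
    substituting X / c covers c = 0. *)
Lemma fconv_scale n c (a b g : 'rV[F]_n) :
  fconv n (root_poly a) (root_poly b) = root_poly g ->
  fconv n (root_poly (c *: a)) (root_poly (c *: b)) = root_poly (c *: g).
Proof.
move=> e; have szr (h : 'rV[F]_n) : size (root_poly h) = n.+1 by exact: size_root_poly.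
apply/polyP => m; rewrite coef_fconv; case: ltnP => mn; last by rewrite nth_default ?szr.
have nm : (n - m <= n)%N by rewrite leq_subr.
have mE : (n - (n - m))%N = m by rewrite subKn.
have sq : (-1) ^+ (n - m) * (-1) ^+ (n - m) = 1 :> F by rewrite -expr2 sqrr_sign.
transitivity ((-1) ^+ (n - m) * signed_coef n (root_poly (c *: g)) (n - m)); last first.
  by rewrite /signed_coef mE mulrA sq mul1r.
congr (_ * _); rewrite signed_coef_scale // -e /signed_coef mE coef_fconv mn [(-1) ^+ _ * (_ * _)]mulrA sq mul1r.
rewrite /fconv_coef mulr_sumr; apply: eq_bigr => i _.
have ik : (i <= n - m)%N by rewrite -ltnS.
rewrite !signed_coef_scale ?(leq_trans ik nm) ?(leq_trans (leq_subr _ _) nm) //.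
have -> : c ^+ (n - m) = c ^+ i * c ^+ (n - m - i) by rewrite -exprD subnKC.
by rewrite [RHS]mulrCA; congr (_ * _); ring.
Qed.

Lemma derivn_shift p c k : (p \Po ('X - c%:P))^`(k) = p^`(k) \Po ('X - c%:P).
Proof.
elim: k => // k IH; rewrite !derivnS IH deriv_comp derivXsubC mulr1.
by [].
Qed.

Lemma root_poly_shift n (a : 'rV[F]_n) c :
  root_poly (a + const_mx c) = root_poly a \Po ('X - c%:P).
Proof.
rewrite /root_poly rmorph_prod; apply: eq_bigr => i _ /=.
by rewrite !mxE rmorphB /= comp_polyX comp_polyC polyCD opprD addrA addrAC.
Qed.

(** A differential operator with constant coefficients commutes with translations. *)
Lemma fconv_shift n (a : 'rV[F]_n) q c :
  fconv n (root_poly (a + const_mx c)) q = fconv n (root_poly a) q \Po ('X - c%:P).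
Proof.
rewrite !fconvE ?size_root_poly // comp_polyZ [X in _ = _ *: X]raddf_sum /=; congr (_ *: _).
by apply: eq_bigr => j _; rewrite comp_polyZ root_poly_shift derivn_shift.
Qed.

Lemma fconv_affine n c m m' (a b g : 'rV[F]_n) :
  fconv n (root_poly a) (root_poly b) = root_poly g ->
  fconv n (root_poly (c *: a + const_mx m)) (root_poly (c *: b + const_mx m')) =
  root_poly (c *: g + const_mx (m + m')).
Proof.
move=> /(fconv_scale c) e; rewrite fconv_shift fconvC fconv_shift fconvC e.
have -> : const_mx (m + m') = const_mx m' + const_mx m :> 'rV[F]_n.
  by apply/rowP => i; rewrite !mxE addrC.
by rewrite addrA -!root_poly_shift.
Qed.

End Fconv.

Lemma dvdp_XsubC_deriv (F : fieldType) (f : {poly F}) a m :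
  ('X - a%:P) ^+ m.+1 %| f -> ('X - a%:P) ^+ m %| f^`().
Proof.
move=> /dvdpP [q ->]; rewrite derivM deriv_exp derivXsubC mul1r /= dvdp_add //.
  by rewrite exprS mulrA dvdp_mulIr.
by rewrite mulrnAr -mulrnAl dvdp_mulIr.
Qed.

Lemma derivn_root (F : fieldType) (f : {poly F}) a m k :
  ('X - a%:P) ^+ m %| f -> (k < m)%N -> f^`(k).[a] = 0.
Proof.
elim: m k f => [//|m IH] [|k] f df km.
  by apply/rootP; rewrite -dvdp_XsubCl; apply: dvdp_trans df; rewrite exprS dvdp_mulIl.
by rewrite derivSn; apply: IH => //; exact: dvdp_XsubC_deriv.
Qed.

(** * Real roots of the convolution and level sets of split pencils *)

Section Clusters.
Variable R : rcfType.
Local Notation iota := (real_complex R).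

Lemma real_rooted_root_poly n (a : 'rV[R]_n) : real_rooted (root_poly a).
Proof. by rewrite root_polyE -[XsubCs _]scale1r; exact: real_rootedZ. Qed.

Lemma root_poly_neq0 n (a : 'rV[R]_n) : root_poly a != 0.
Proof. by rewrite -size_poly_eq0 size_root_poly. Qed.

Definition level n (a : 'rV[R]_n) (mu : R) : {set 'I_n} := [set i | a 0 i == mu]%SET.

Lemma in_level n (a : 'rV[R]_n) mu i : (i \in level a mu) = (a 0 i == mu).
Proof. by rewrite inE. Qed.

Lemma count_row n (a : 'rV[R]_n) mu :
  count_mem mu [seq a 0 i | i <- enum 'I_n] = #|level a mu|.
Proof.
rewrite count_map -sum1_count -sum1_card big_enum_cond /=.
by apply: eq_bigl => i; rewrite in_level.
Qed.

(** Over [C] the pairing has no zero in the open upper half plane when the roots of both arguments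
    are real, and the convolution is monic of degree n. *)
Lemma fconv_real_roots n (a b : 'rV[R]_n) :
  exists g : 'rV[R]_n, fconv n (root_poly a) (root_poly b) = root_poly g.
Proof.
set f := fconv _ _ _.
have fn : f`_n = 1.
  rewrite /f coef_fconv ltnSn subnn mul1r /fconv_coef big_ord1 /signed_coef !subn0 !mul1r.
  have lead (c : 'rV[R]_n) : (root_poly c)`_n = 1.
    have /monicP : root_poly c \is monic by exact: monic_prod_XsubC.
    by rewrite lead_coefE size_root_poly.
  by rewrite !lead !(mul1r, mulr1) divff // pnatr_eq0 muln_eq0 negb_or -!lt0n !fact_gt0.
have sf : size f = n.+1.
  apply/eqP; rewrite eqn_leq; apply/andP; split.
    by apply/leq_sizeP => m nm; rewrite /f coef_fconv ltnNge nm.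
  by rewrite ltnNge; apply/negP => le; move: fn; rewrite nth_default // => /esym/eqP; rewrite oner_eq0.
have lf : lead_coef f = 1 by rewrite lead_coefE sf.
have f0 : f != 0 by rewrite -size_poly_eq0 sf.
have [|s es] := real_rooted_roots f0.
  right => z z0; rewrite /f map_fconv; last first.
    by move=> m m0; rewrite unitfE pnatr_eq0 -lt0n.
  set P := map_poly _ _; set Q := map_poly _ _.
  have sP : size P = n.+1 by rewrite size_map_poly size_root_poly.
  have sQ : size Q = n.+1 by rewrite size_map_poly size_root_poly.
  have := fconv_derivn Q 0 z (eq_leq sP); rewrite !derivn0 => ->.
  rewrite mulf_neq0 ?invr_eq0 ?pnatr_eq0 -?lt0n ?fact_gt0 //.
  have eP : P = XsubCs (map iota [seq a 0 i | i <- enum 'I_n]).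
    by rewrite /P root_polyE map_XsubCs.
  have szl : size (map iota [seq a 0 i | i <- enum 'I_n]) = n.
    by rewrite size_map size_map size_enum_ord.
  have := @apolar_stable R (map iota [seq a 0 i | i <- enum 'I_n]) Q z.
  rewrite szl -eP; apply=> //.
  - by move=> _ /mapP[r _ ->] /=.
  - case: (real_rooted_root_poly b) => [b0|//].
    by have := root_poly_neq0 b; rewrite b0 eqxx.
  - by rewrite sQ.
have szs : size s = n.
  by apply: succn_inj; rewrite -size_XsubCs -sf [in RHS]es lf scale1r.
exists (\row_i s`_i); rewrite es lf scale1r /root_poly /XsubCs (big_nth 0) szs big_mkord.
by apply: eq_bigr => i _; rewrite mxE.
Qed.

Lemma fconv_cluster n m (a b c : 'rV[R]_n) (lam : R) :
  fconv n (root_poly a) (root_poly b) = root_poly c ->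
  (m.+2 <= #|level c lam|)%N ->
  exists mu nu, (n + m.+2 <= #|level a mu| + #|level b nu|)%N.
Proof.
move=> e; rewrite -count_row => cm.
have sP : size [seq a 0 i | i <- enum 'I_n] = n by rewrite size_map size_enum_ord.
have dv : ('X - lam%:P) ^+ m.+2 %| root_poly c.
  by rewrite root_polyE -mup_geq ?XsubCs_neq0 // mup_XsubCs.
have [k km|mu [nu [j [_ dj cnt]]]] := @apolar_multiple_root R m n
    [seq a 0 i | i <- enum 'I_n] (root_poly b) lam sP (size_root_poly b)
    (real_rooted_root_poly b).
  have n0 : n`!%:R^-1 != 0 :> R by rewrite invr_eq0 pnatr_eq0 -lt0n fact_gt0.
  apply: (mulfI n0); rewrite mulr0 -root_polyE -fconv_derivn ?size_root_poly // e.
  exact: derivn_root dv km.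
exists mu, nu; rewrite -!count_row; apply: leq_trans cnt _; rewrite leq_add2l.
by rewrite -mup_XsubCs mup_geq ?XsubCs_neq0 // -root_polyE.
Qed.

(** The splitting of h_w into factors x - A_i y - B_i t, a normalization that monicity in x allows,
    stated on values. *)
Definition split_pencil n (alpha beta u v : 'rV[R]_n) := exists A B : 'rV[R]_n,
  forall y t, fconv n (root_poly (y *: alpha + t *: u)) (root_poly (y *: beta + t *: v)) =
    root_poly (y *: A + t *: B).

Lemma card_fiber_inj n (a : 'rV[R]_n) mu : injective (a 0) ->
  (#|level a mu| <= 1)%N.
Proof.
move=> ai; apply/card_le1_eqP => i j; rewrite !in_level => /eqP ei /eqP ej.
by apply: ai; rewrite ei ej.
Qed.

(* The pair (y, t) being independent of (y', t'), the entries of alpha at two indices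
   common to both fibers would agree. *)
Lemma card_fibers_pencil n (alpha u : 'rV[R]_n) y t y' t' mu mu' :
  injective (alpha 0) -> y * t' != y' * t ->
  (#|level (y *: alpha + t *: u) mu|
   + #|level (y' *: alpha + t' *: u) mu'| <= n.+1)%N.
Proof.
move=> ai d; rewrite -cardsUI -[leqRHS]addn1 leq_add //.
  by rewrite -[leqRHS]card_ord max_card.
apply/card_le1_eqP => i j; rewrite !inE !mxE => /andP[/eqP i1 /eqP i2] /andP[/eqP j1 /eqP j2].
apply: ai; have d0 : y * t' - y' * t != 0 by rewrite subr_eq0.
apply: (mulfI d0); move: i1 i2 j1 j2.
move: (alpha 0 i) (alpha 0 j) (u 0 i) (u 0 j) => a1 a2 u1 u2 i1 i2 j1 j2.
transitivity (t' * mu - t * mu'); [rewrite -j1 -j2|rewrite -i1 -i2]; ring.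
Qed.

Lemma split_pencil_affine n (alpha beta u v : 'rV[R]_n) : (2 <= n)%N ->
  injective (alpha 0) -> injective (beta 0) -> split_pencil alpha beta u v ->
  exists c m m', u = c *: alpha + const_mx m /\ v = c *: beta + const_mx m'.
Proof.
move=> n2 ai bi [A [B h]].
pose i0 : 'I_n := Ordinal (ltnW n2); pose i1 : 'I_n := Ordinal n2.
have pair y t k l : k != l -> y * A 0 k + t * B 0 k = y * A 0 l + t * B 0 l ->
    exists mu nu, (n.+2 <= #|level (y *: alpha + t *: u) mu|
      + #|level (y *: beta + t *: v) nu|)%N.
  move=> kl e.
  have [|mu [nu]] := @fconv_cluster n 0 _ _ _ (y * A 0 k + t * B 0 k) (h y t).
    rewrite -(_ : #|[set k; l]| = 2)%N; last by rewrite cards2 kl.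
    apply/subset_leq_card/fintype.subsetP => i; rewrite in_level !inE !mxE.
    by move=> /orP[] /eqP -> //; rewrite e.
  by rewrite addn2 => c; exists mu, nu.
(* In the direction (1, 0) the rows are alpha and beta, whose level sets have at most one element; n
   + 2 <= 2 is impossible. *)
have Ai k l : k != l -> A 0 k != A 0 l.
  move=> kl; apply/eqP => e; have [|mu [nu c]] := pair 1 0 k l kl; first by rewrite e !mul0r.
  rewrite !scale1r !scale0r !addr0 in c.
  have := leq_trans c (leq_add (card_fiber_inj mu ai) (card_fiber_inj nu bi)).
  by rewrite !ltnS leqn0 => /eqP n0; have := n2; rewrite n0.
have par y t k l y' t' k' l' : k != l -> k' != l' ->
    y * A 0 k + t * B 0 k = y * A 0 l + t * B 0 l ->
    y' * A 0 k' + t' * B 0 k' = y' * A 0 l' + t' * B 0 l' -> y * t' = y' * t.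
  move=> kl kl' e e'; apply/eqP; apply: contraT => d.
  have [mu [nu c]] := pair y t k l kl e; have [mu' [nu' c']] := pair y' t' k' l' kl' e'.
  (* Two independent directions would give four level sets of total size at least 2 n + 4 and at
     most 2 n + 2. *)
  have ca := @card_fibers_pencil n alpha u y t y' t' mu mu' ai d.
  have cb := @card_fibers_pencil n beta v y t y' t' nu nu' bi d.
  by move: c c' ca cb; lia.
have i01 : i0 != i1 by [].
(* The direction in which the first two factors meet; by [par] every other factor meets the first
   one there too. *)
pose y0 := B 0 i1 - B 0 i0; pose t0 := A 0 i0 - A 0 i1.
have t00 : t0 != 0 by rewrite subr_eq0 Ai.
have e0 : y0 * A 0 i0 + t0 * B 0 i0 = y0 * A 0 i1 + t0 * B 0 i1 by rewrite /y0 /t0; ring.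
have all0 k : y0 * A 0 k + t0 * B 0 k = y0 * A 0 i0 + t0 * B 0 i0.
  have [->//|k0] := eqVneq k i0.
  have := @par y0 t0 i0 i1 (B 0 k - B 0 i0) (A 0 i0 - A 0 k) i0 k i01.
  rewrite eq_sym => /(_ k0 e0) p; apply/eqP; rewrite -subr_eq0.
  have /eqP : y0 * (A 0 i0 - A 0 k) = (B 0 k - B 0 i0) * t0 by apply: p; ring.
  by rewrite -subr_eq0 => /eqP p'; rewrite -oppr_eq0 -[X in _ == X]p'; apply/eqP; ring.
(* A root of multiplicity n forces the two level sets to have total size 2 n, so both rows are
   constant at (y0, t0); solving for u and v uses t0 != 0. *)
have [m em] : exists m, n = m.+2 by exists (n - 2)%N; rewrite -addn2 subnK.
have [|mu [nu c]] := @fconv_cluster n m _ _ _ (y0 * A 0 i0 + t0 * B 0 i0) (h y0 t0).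
  rewrite -em -[leqLHS]card_ord -cardsT; apply/subset_leq_card/fintype.subsetP => i _.
  by rewrite in_level !mxE all0.
move: c; rewrite -em => c.
have full (a : 'rV[R]_n) lam : (#|level a lam| <= n)%N.
  by rewrite -[leqRHS]card_ord max_card.
have fullE (a : 'rV[R]_n) lam : (n <= #|level a lam|)%N -> forall i, a 0 i = lam.
  move=> le i; have /eqP e : level a lam == [set: 'I_n]%SET.
    by rewrite eqEcard finset.subsetT cardsT card_ord.
  by apply/eqP; rewrite -in_level e.
have ca : forall i, (y0 *: alpha + t0 *: u) 0 i = mu.
  by apply: fullE; rewrite -(leq_add2r n); apply: leq_trans c _; rewrite leq_add2l full.
have cb : forall i, (y0 *: beta + t0 *: v) 0 i = nu.
  by apply: fullE; rewrite -(leq_add2l n); apply: leq_trans c _; rewrite leq_add2r full.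
exists (- y0 / t0), (mu / t0), (nu / t0); split; apply/rowP => i; rewrite !mxE.
  by have := ca i; rewrite !mxE => <-; field.
by have := cb i; rewrite !mxE => <-; field.
Qed.

(** Here y alpha + t u = (y + t c) alpha + t m, likewise for beta, so the roots of the convolution
    are the same affine image of the roots g for alpha and beta. *)
Lemma split_pencil_of_affine n (alpha beta u v : 'rV[R]_n) c m m' :
  u = c *: alpha + const_mx m -> v = c *: beta + const_mx m' ->
  split_pencil alpha beta u v.
Proof.
move=> -> ->; have [g eg] := fconv_real_roots alpha beta.
exists g, (c *: g + const_mx (m + m')) => y t.
have e (w : 'rV[R]_n) d :
    y *: w + t *: (c *: w + const_mx d) = (y + t * c) *: w + const_mx (t * d).
  by apply/rowP => i; rewrite !mxE; ring.
by rewrite !e (fconv_affine _ _ _ eg) mulrDr.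
Qed.

End Clusters.

(** * Split members of the family h_w *)

Lemma dhomog1E (A : comNzRingType) n (p : {mpoly A[n]}) : p \is 1.-homog ->
  p = \sum_(i < n) p@_U_(i) *: 'X_i.
Proof.
move=> hp; apply/mpolyP => m; rewrite raddf_sum /=.
have [|m1] := boolP (mdeg m == 1%N); first rewrite mdeg_eq1 => /existsP [i /eqP ->].
  rewrite (bigD1 i) //= mcoeffZ mcoeffXU eqxx mulr1 big1 ?addr0 // => j ji.
  by rewrite mcoeffZ mcoeffXU (negPf ji) mulr0.
rewrite (dhomog_nemf_coeff hp m1) big1 // => i _; rewrite mcoeffZ mcoeffX.
by case: eqVneq => [e|]; rewrite ?mulr0 //; move: m1; rewrite -e mdeg1 eqxx.
Qed.

Lemma ord3P (i : 'I_3) : [\/ i = ix, i = iy | i = it].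
Proof.
case: i => [[|[|[|m]]] h] //; [apply: Or31|apply: Or32|apply: Or33]; exact/val_inj.
Qed.

Lemma dhomog1_eval (A : comNzRingType) (p : {mpoly A[3]}) v : p \is 1.-homog ->
  p.@[v] = p@_U_(ix) * v ix + p@_U_(iy) * v iy + p@_U_(it) * v it.
Proof.
move=> /dhomog1E {1}->; rewrite raddf_sum /= !big_ord_recl big_ord0 addr0 addrA.
rewrite !mevalZ !mevalXU.
have -> : lift ord0 (ord0 : 'I_2) = iy by exact/val_inj.
have -> : lift ord0 (lift ord0 (ord0 : 'I_1)) = it by exact/val_inj.
by have -> : ord0 = ix by exact/val_inj.
Qed.

Definition linear_poly (K : nzRingType) (a b c : K) : {mpoly K[3]} :=
  a *: 'X_ix + b *: 'X_iy + c *: 'X_it.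

Lemma linear_poly_homog (K : nzRingType) (a b c : K) : linear_poly a b c \is 1.-homog.
Proof. by rewrite !(dhomogD, dhomogZ) // dhomogX /= mdeg1. Qed.

Definition linear_form (K : nzRingType) (a b c : K) : ternary_form K 1 :=
  DHomog (linear_poly_homog a b c).

Lemma linear_poly_eval (K : comNzRingType) (a b c : K) v :
  (linear_poly a b c).@[v] = a * v ix + b * v iy + c * v it.
Proof. by rewrite !mevalD !mevalZ !mevalXU. Qed.

Lemma linear_form_neq0 (K : comNzRingType) (a b c : K) : a != 0 -> linear_form a b c != 0.
Proof.
apply: contraNneq => /(congr1 val) /= /(congr1 (meval (fun i => (i == ix)%:R))).
by rewrite meval0 linear_poly_eval /= mulr1 !mulr0 !addr0 => ->.
Qed.

Section Preimage.
Variable R : rcfType.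

Lemma split_pencil_of_SplitForms n (alpha beta : 'rV[R]_n) w :
  SplitForms R n (Theta alpha beta w) ->
  split_pencil alpha beta (lsubmx w) (rsubmx w).
Proof.
case=> l [l0 /= e].
have /vlineP [c ec] : hform alpha beta w \in <[prod_linear l]>%VS by rewrite -e memv_line.
pose a i := (l i : {mpoly R[3]})@_U_(ix); pose b i := (l i : {mpoly R[3]})@_U_(iy).
pose d i := (l i : {mpoly R[3]})@_U_(it).
have ev x y t : (fconv n (root_poly (y *: alpha + t *: lsubmx w))
     (root_poly (y *: beta + t *: rsubmx w))).[x] = c * \prod_i (a i * x + b i * y + d i * t).
  rewrite -hpolyE hsubmxK; have /(congr1 (meval (tnth [tuple x; y; t]))) := congr1 val ec.
  rewrite /= mevalZ rmorph_prod => ->; congr (_ * _); apply: eq_bigr => i _.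
  rewrite /= dhomog1_eval //; exact: dhomog_is_dhomog.
(* Monicity in x, read off at (1, 0, 0): no factor has x-coefficient zero, so all of them can be
   normalized. *)
have c1 : c * \prod_i a i = 1.
  have := ev 1 0 0; rewrite !scale0r !addr0.
  have -> : root_poly (0 : 'rV[R]_n) = 'X^n.
    rewrite /root_poly (eq_bigr (fun=> 'X)) ?prodr_const ?card_ord // => i _.
    by rewrite mxE subr0.
  have sX : size ('X^n : {poly R}) = n.+1 by rewrite size_polyXn.
  have := fconv_derivn ('X^n) 0 1 (eq_leq sX); rewrite !derivn0 => ->.
  rewrite -[X in apolar _ X _ _]/(('X) ^+ n) -['X in X in apolar _ X _ _]subr0 -polyC0.
  rewrite apolar_exp ?sX // hornerXn subr0 expr1n mulr1 mulVf; last first.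
    by rewrite pnatr_eq0 -lt0n fact_gt0.
  by move=> e1; rewrite [RHS]e1; congr (_ * _); apply: eq_bigr => i _; rewrite mulr1 !mulr0 !addr0.
have a0 i : a i != 0.
  apply: contra_eq_neq c1 => ai; rewrite (bigD1 i) //= ai mul0r mulr0 eq_sym.
  exact: oner_neq0.
exists (\row_i (- b i / a i)), (\row_i (- d i / a i)) => y t.
apply: horner_inj => x; rewrite ev horner_prod; set r := \prod_(i < n) _.[x].
have -> : r = c * ((\prod_i a i) * r) by rewrite mulrA c1 mul1r.
rewrite /r -big_split /=.
apply: (congr1 ( *%R c)); apply: eq_bigr => i _; rewrite hornerXsubC !mxE.
by have := a0 i; move: (a i) (b i) (d i) => p q s p0; field.
Qed.

Lemma SplitForms_of_split_pencil n (alpha beta : 'rV[R]_n) w :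
  split_pencil alpha beta (lsubmx w) (rsubmx w) ->
  SplitForms R n (Theta alpha beta w).
Proof.
case=> A [B e]; exists (fun i => linear_form 1 (- A 0 i) (- B 0 i)); split.
  by move=> i; apply: linear_form_neq0; exact: oner_neq0.
rewrite /=; congr (<[_]>%VS); apply/val_inj => /=; apply: meval_inj => v.
have -> : (hpoly alpha beta w).@[v] = (hpoly alpha beta w).@[tnth [tuple v ix; v iy; v it]].
  by apply: meval_eq => i; case: (ord3P i) => ->.
rewrite -[w in LHS]hsubmxK hpolyE e horner_prod rmorph_prod; apply: eq_bigr => i _ /=.
by rewrite linear_poly_eval !hornerE !mxE; ring.
Qed.

(** Centering changes a row by a multiple of the all-ones row, which the free constants m and m'
    absorb. *)
Lemma Theta_spanP n (alpha beta : 'rV[R]_n) w :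
  reflect (exists c m m', lsubmx w = c *: alpha + const_mx m /\
                          rsubmx w = c *: beta + const_mx m')
          (w \in Theta_span alpha beta).
Proof.
rewrite /Theta_span !span_cons span_nil addv0.
apply: (iffP idP) => [/memv_addP [_ /vlineP [m ->] [_ /memv_addP
    [_ /vlineP [m' ->] [_ /vlineP [c ->] ->]] ->]]|[c [m [m' [e e']]]]].
  exists c, (m - c * (n%:R^-1 * \sum_(i < n) alpha 0 i)),
    (m' - c * (n%:R^-1 * \sum_(i < n) beta 0 i)).
  rewrite !scale_row_mx !add_row_mx row_mxKl row_mxKr !scaler0 !add0r.
  by split; apply/rowP => i; rewrite !mxE; ring.
have -> : w = (m + c * (n%:R^-1 * \sum_(i < n) alpha 0 i)) *: row_mx (ones R n) 0
    + ((m' + c * (n%:R^-1 * \sum_(i < n) beta 0 i)) *: row_mx 0 (ones R n)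
    + c *: row_mx (centered alpha) (centered beta)).
  rewrite -[LHS]hsubmxK e e' !scale_row_mx !add_row_mx !scaler0 !add0r.
  by congr row_mx; apply/rowP => i; rewrite !mxE; ring.
by rewrite !memv_add // memvZ // memv_line.
Qed.

Lemma Theta_preimage n (alpha beta : 'rV[R]_n) : (2 <= n)%N ->
  injective (alpha 0) -> injective (beta 0) ->
  (Theta alpha beta @^-1` SplitForms R n = [set w | w \in Theta_span alpha beta])%classic.
Proof.
move=> n2 ai bi; apply/seteqP; split=> w /=.
  move=> /split_pencil_of_SplitForms /(split_pencil_affine n2 ai bi).
  by move=> [c [m [m' h]]]; apply/Theta_spanP; exists c, m, m'.
move=> /Theta_spanP [c [m [m' [e e']]]]; apply: SplitForms_of_split_pencil.
exact: split_pencil_of_affine e e'.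
Qed.

Lemma dim_Theta_span n (alpha beta : 'rV[R]_n) : (2 <= n)%N -> injective (alpha 0) ->
  \dim (Theta_span alpha beta) = 3%N.
Proof.
move=> n2 ai; apply/eqP; rewrite -[_ == _]/(free _).
apply/(@freeP _ _ _ [tuple row_mx (ones R n) 0; row_mx 0 (ones R n);
        row_mx (centered alpha) (centered beta)]) => k.
rewrite !big_ord_recl big_ord0 addr0 /= !scale_row_mx !add_row_mx !scaler0 add0r.
move=> e; pose i0 : 'I_n := Ordinal (ltnW n2); pose i1 : 'I_n := Ordinal n2.
have el i : k ord0 + k (lift ord0 (lift ord0 ord0)) * centered alpha 0 i = 0.
  have /(congr1 lsubmx)/rowP/(_ i) := e.
  by rewrite row_mxKl linear0 !mxE mulr1.
have er i : k (lift ord0 ord0) + k (lift ord0 (lift ord0 ord0)) * centered beta 0 i = 0.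
  have /(congr1 rsubmx)/rowP/(_ i) := e.
  by rewrite row_mxKr linear0 !mxE mulr1 add0r.
have k2 : k (lift ord0 (lift ord0 ord0)) = 0.
  (* Subtracting two coordinates of the relation eliminates the coefficient of the all-ones row. *)
  have d : alpha 0 i0 - alpha 0 i1 != 0 by rewrite subr_eq0; apply/eqP => /ai.
  apply: (mulIf d); move: (el i0) (el i1); rewrite !mxE.
  move: (k _) (k _) (n%:R^-1 * _ * 1) => x y s; lra.
have k0 : k ord0 = 0 by have := el i0; rewrite k2 mul0r addr0.
have k1 : k (lift ord0 ord0) = 0 by have := er i0; rewrite k2 mul0r addr0.
move=> i; have : (i < 3)%N by [].
by case: (unliftP ord0 i) => [j ->|-> //]; case: (unliftP ord0 j) => [l ->|-> //]; rewrite ord1.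
Qed.

(** Stated over the integers, as 2 n - C(n, 2) is negative from n = 6 on. *)
Lemma excess_dim n : (2 <= n)%N ->
  3%:Z - ((2 * n)%:Z - 'C(n, 2)%:Z) = 'C(n - 2, 2)%:Z.
Proof.
case: n => [|[|n]] // _; rewrite subSS subSS subn0.
have : 'C(n.+2, 2) = (n.+1 + n + 'C(n, 2))%N.
  by rewrite !binS !bin0 !bin1; lia.
lia.
Qed.

End Preimage.

(** * Zariski closed and irreducible sets *)

Local Open Scope classical_set_scope.

Section HomogeneousFunctions.
Variables (K : fieldType) (V : vectType K).
Implicit Types (phi psi : V -> K) (p q : proj V) (Z : set (proj V)).
Local Notation b := (vbasis {:V}).

(** Forms are treated as functions on V. The degree is a parameter because the zero function has
    every degree. *)
Definition hfun d phi := exists2 F : {mpoly K[\dim {:V}]},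
  F \is d.-homog & forall v, poly_fun F v = phi v.

Lemma eq_hfun d phi psi : phi =1 psi -> hfun d phi -> hfun d psi.
Proof. by move=> e [F hF h]; exists F => // v; rewrite h e. Qed.

Lemma hfun0 d : hfun d (fun=> 0).
Proof. by exists 0; [exact: dhomog0|move=> v; rewrite /poly_fun meval0]. Qed.

Lemma hfun1 : hfun 0 (fun=> 1).
Proof. by exists 1; [exact: dhomog1|move=> v; rewrite /poly_fun meval1]. Qed.

Lemma hfunD d phi psi : hfun d phi -> hfun d psi -> hfun d (fun v => phi v + psi v).
Proof.
move=> [F hF h] [G hG g]; exists (F + G); first exact: dhomogD.
by move=> v; rewrite -h -g /poly_fun mevalD.
Qed.

Lemma hfunZ d c phi : hfun d phi -> hfun d (fun v => c * phi v).
Proof.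
move=> [F hF h]; exists (c *: F); first exact: dhomogZ.
by move=> v; rewrite -h /poly_fun mevalZ.
Qed.

Lemma hfunM d e phi psi : hfun d phi -> hfun e psi -> hfun (d + e) (fun v => phi v * psi v).
Proof.
move=> [F hF h] [G hG g]; exists (F * G); first exact: dhomogM.
by move=> v; rewrite -h -g /poly_fun mevalM.
Qed.

Lemma hfunX d k phi : hfun d phi -> hfun (d * k) (fun v => phi v ^+ k).
Proof.
move=> h; elim: k => [|k IH]; first by rewrite muln0; apply: eq_hfun hfun1.
by rewrite mulnS; apply: eq_hfun (hfunM h IH) => v; rewrite exprS.
Qed.

Lemma hfun_sum d (I : Type) (r : seq I) (phi : I -> V -> K) :
  (forall i, hfun d (phi i)) -> hfun d (fun v => \sum_(i <- r) phi i v).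
Proof.
move=> h; elim: r => [|i r IH].
  by apply: eq_hfun (hfun0 d) => v; rewrite big_nil.
by apply: eq_hfun (hfunD (h i) IH) => v; rewrite big_cons.
Qed.

Lemma hfun_linear (f : V -> K) :
  (forall c u v, f (c *: u + v) = c * f u + f v) -> hfun 1 f.
Proof.
move=> lf; have f0 : f 0 = 0 by have := lf (-1) 0 0; rewrite scaler0 add0r mulN1r addNr.
exists (\sum_(i < \dim {:V}) f b`_i *: 'X_i); first by apply: rpred_sum => i _; rewrite rpredZ // dhomogX /= mdeg1.
move=> v; rewrite /poly_fun raddf_sum /= [in RHS](coord_vbasis (memvf v)).
rewrite (big_morph f (id1 := 0) (op1 := +%R)) // => [|x y].
  apply: eq_bigr => i _; rewrite mevalZ mevalXU mulrC -[_ *: _ in RHS]addr0 lf f0 addr0.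
  by [].
by have := lf 1 x y; rewrite scale1r mul1r.
Qed.

Lemma hfun_coord i : hfun 1 (coord b i).
Proof. by apply: hfun_linear => c u v; rewrite linearP. Qed.

Lemma hfun_scale d phi c v : hfun d phi -> phi (c *: v) = c ^+ d * phi v.
Proof.
move=> [F hF h]; rewrite -!h /poly_fun !mevalE mulr_sumr !big_seq; apply: eq_bigr => m ms.
rewrite mulrCA; congr (_ * _).
have /eqP <- : mdeg m == d by apply/eqP; exact: (dhomog_mf hF).
rewrite mdegE -prodrXr -big_split; apply: eq_bigr => i _ /=.
by rewrite linearZ /= exprMn.
Qed.

Definition rep p : V := vpick (val p).

Lemma rep_neq0 p : rep p != 0.
Proof. by rewrite vpick0 -dimv_eq0; case: p => L /= /eqP ->. Qed.

Lemma val_rep p : val p = <[rep p]>%VS.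
Proof.
apply/eqP; rewrite eq_sym eqEdim dim_vline rep_neq0 -memvE memv_pick.
by case: p => L /= /eqP ->.
Qed.

Lemma mem_repP p v : v \in val p -> exists c, v = c *: rep p.
Proof. by rewrite val_rep => /vlineP. Qed.

Lemma rep_memP p v : v \in val p -> v != 0 -> exists2 c, c != 0 & rep p = c *: v.
Proof.
move=> /mem_repP [c ->]; rewrite scaler_eq0 negb_or => /andP[c0 _].
by exists c^-1; rewrite ?invr_eq0 // scalerA mulVf // scale1r.
Qed.

Lemma hfun_vanish d phi p v : hfun d phi -> v \in val p -> v != 0 ->
  phi (rep p) = 0 <-> phi v = 0.
Proof.
move=> h vp v0; have [c c0 ->] := rep_memP vp v0; rewrite (hfun_scale _ _ h).
split=> [/eqP|->]; last by rewrite mulr0.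
by rewrite mulf_eq0 expf_eq0 (negPf c0) andbF => /eqP.
Qed.

Lemma proj_of (v : V) : v != 0 -> exists p, v \in val p.
Proof. by move=> v0; exists (pclass v0); rewrite /= memv_line. Qed.

Definition vanishes phi Z := forall p, Z p -> phi (rep p) = 0.

Lemma zariski_closedP Z : zariski_closed Z <->
  exists S : set (V -> K), (forall phi, S phi -> exists d, hfun d phi) /\
    forall p, Z p <-> forall phi, S phi -> phi (rep p) = 0.
Proof.
split=> [[S [hS ->]]|[S [hS hZ]]].
  exists [set phi | exists2 F, S F & phi = poly_fun F]; split.
    by move=> _ [F /hS [d hd] ->]; exists d, F.
  move=> p; split=> [h _ [F SF ->]|h F SF v /mem_repP [c ->]].
    by apply: h => //; rewrite val_rep memv_line.
  have [d hd] := hS F SF; have hf : hfun d (poly_fun F) by exists F.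
  by rewrite (hfun_scale _ _ hf) h ?mulr0 //; exists F.
exists [set F | (exists d, F \is d.-homog) /\ exists2 phi, S phi & poly_fun F =1 phi].
split=> [F [[d hd] _]|]; first by exists d.
apply/seteqP; split=> p /=.
  move=> /hZ h F [[d hd] [phi Sphi e]] v /mem_repP [c ->].
  have hf : hfun d (poly_fun F) by exists F.
  by rewrite (hfun_scale _ _ hf) e h ?mulr0.
move=> h; apply/hZ => phi Sphi; have [d [F hF e]] := hS phi Sphi.
rewrite -e; apply: (h F); last by rewrite val_rep memv_line.
by split; [exists d|exists phi].
Qed.

(** The zero sets of the two factors are closed and cover Z. *)
Lemma irreducible_mul Z d e phi psi : irreducible_set Z -> hfun d phi -> hfun e psi ->
  vanishes (fun v => phi v * psi v) Z -> vanishes phi Z \/ vanishes psi Z.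
Proof.
move=> [_ irr] h g v0.
have cl c (f : V -> K) : hfun c f -> zariski_closed [set p | f (rep p) = 0].
  move=> hf; apply/zariski_closedP; exists [set f]; split=> [_ ->|p]; first by exists c.
  by split=> [fp _ ->|] //; apply.
have [|s|s] := irr _ _ (cl _ _ h) (cl _ _ g); last first.
- by right=> p /s.
- by left=> p /s.
by move=> p /v0 /eqP; rewrite mulf_eq0 => /orP[] /eqP; [left|right].
Qed.

Definition zclosure Z : set (proj V) :=
  [set p | forall d phi, hfun d phi -> vanishes phi Z -> phi (rep p) = 0].

Lemma zclosure_closed Z : zariski_closed (zclosure Z).
Proof.
apply/zariski_closedP; exists [set phi | (exists d, hfun d phi) /\ vanishes phi Z].
split=> [phi []//|p]; split=> [h phi [[d hd] v]|h d phi hd v]; first exact: h hd v.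
by apply: h; split=> //; exists d.
Qed.

Lemma sub_zclosure Z : Z `<=` zclosure Z.
Proof. by move=> p Zp d phi _ v; exact: v. Qed.

Lemma zclosureS Z1 Z2 : Z1 `<=` Z2 -> zclosure Z1 `<=` zclosure Z2.
Proof. by move=> s p h d phi hd v; apply: (h d) => // q /s /v. Qed.

Lemma zclosure_min Z A : zariski_closed A -> Z `<=` A -> zclosure Z `<=` A.
Proof.
move=> /zariski_closedP [S [hS hA]] ZA p h; apply/hA => phi Sphi.
by have [d hd] := hS _ Sphi; apply: (h d) => // q /ZA /hA; exact.
Qed.

Lemma irreducible_between Z Z' : irreducible_set Z -> Z `<=` Z' -> Z' `<=` zclosure Z ->
  irreducible_set Z'.
Proof.
move=> [[p Zp] irr] s1 s2; split; first by exists p; exact: s1.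
move=> A B cA cB sAB; have [|sA|sB] := irr A B cA cB; first exact: subset_trans sAB.
- by left; apply: subset_trans s2 _; exact: zclosure_min.
- by right; apply: subset_trans s2 _; exact: zclosure_min.
Qed.

(** A polynomial with coefficients in V, as a list of exponents and vectors. Exponents may repeat,
    so an expanded product needs no collecting of terms. *)
Definition polynomial_curve (g : K -> V) := exists L : seq (nat * V),
  forall s, g s = \sum_(kw <- L) s ^+ kw.1 *: kw.2.

Lemma polynomial_curve_line (v w : V) : polynomial_curve (fun s => v + s *: w).
Proof.
by exists [:: (0%N, v); (1%N, w)] => s; rewrite !big_cons big_nil addr0 scale1r.
Qed.

Lemma hfun_curve d phi g : hfun d phi -> polynomial_curve g ->
  exists f : {poly K}, forall s, f.[s] = phi (g s).
Proof.
move=> [F _ h] [L gL].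
pose c i : {poly K} := \sum_(kw <- L) coord b i kw.2 *: 'X^(kw.1).
exists (\sum_(m <- msupp F) F@_m *: \prod_i c i ^+ m i) => s.
rewrite -h /poly_fun mevalE horner_sum; apply: eq_bigr => m _.
rewrite hornerZ horner_prod; congr (_ * _); apply: eq_bigr => i _.
rewrite horner_exp gL linear_sum /= horner_sum; congr (_ ^+ _).
by apply: eq_bigr => kw _; rewrite hornerZ hornerXn linearZ /= mulrC.
Qed.

End HomogeneousFunctions.

Lemma nonroot_exists (K : numFieldType) (p : {poly K}) : p != 0 -> exists x, p.[x] != 0.
Proof.
move=> p0; apply: contrapT => h; case/eqP: p0; apply: horner_eq0 => x.
by apply/eqP; apply: contrapT => /negP px; apply: h; exists x.
Qed.

Section Curves.
Variables (K : numFieldType) (V : vectType K).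

(** If Z lies in neither A nor B, a form of A nonzero at p and a form of B nonzero at q restrict to
    nonzero polynomials on the curve from p to q. Off their roots and those of b, the curve gives a
    point of Z outside both A and B. *)
Lemma irreducible_curves (Z : set (proj V)) : Z !=set0 ->
  (forall p q, Z p -> Z q -> exists g b, [/\ polynomial_curve g,
     [/\ g 0 \in val p, g 0 != 0, g 1 \in val q & g 1 != 0], b != 0 :> {poly K} &
     forall s, b.[s] != 0 -> g s != 0 /\ forall r : proj V, g s \in val r -> Z r]) ->
  irreducible_set Z.
Proof.
move=> Z0 H; split=> // A B /zariski_closedP [SA [hA eA]] /zariski_closedP [SB [hB eB]] sAB.
have sub_or S (C : set (proj V)) : (forall p, C p <-> forall phi, S phi -> phi (rep p) = 0) ->
    ~ (Z `<=` C) -> exists p (phi : V -> K), [/\ Z p, S phi & phi (rep p) != 0].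
  move=> eC nC; apply: contrapT => h; apply: nC => p Zp; apply/eC => phi Sphi.
  by apply/eqP; apply: contrapT => /negP n; apply: h; exists p, phi.
apply: contrapT => /not_orP [nA nB].
have [p [phi [Zp Sp pn]]] := sub_or _ _ eA nA.
have [q [psi [Zq Sq qn]]] := sub_or _ _ eB nB.
have [g [b [pg [g0 g0n g1 g1n] b0 hb]]] := H p q Zp Zq.
have [d hd] := hA _ Sp; have [e he] := hB _ Sq.
have [f1 e1] := hfun_curve hd pg; have [f2 e2] := hfun_curve he pg.
have f10 : f1 != 0.
  apply: contraNneq pn => f10; apply/eqP/(hfun_vanish hd g0 g0n).
  by rewrite -e1 f10 horner0.
have f20 : f2 != 0.
  apply: contraNneq qn => f20; apply/eqP/(hfun_vanish he g1 g1n).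
  by rewrite -e2 f20 horner0.
have [s] : exists s, (b * (f1 * f2)).[s] != 0 by apply: nonroot_exists; rewrite !mulf_neq0.
rewrite !hornerM !mulf_eq0 !negb_or e1 e2 => /and3P[/hb [gs hr] n1 n2].
have [r rg] := proj_of gs; have [] := sAB r (hr r rg).
  move=> /eA /(_ _ Sp) /(hfun_vanish hd rg gs) /eqP; exact/negP.
move=> /eB /(_ _ Sq) /(hfun_vanish he rg gs) /eqP; exact/negP.
Qed.

(* A coordinate of v that does not vanish gives the polynomial whose roots are avoided. *)
Lemma line_neq0 (v w : V) : v != 0 -> exists2 b : {poly K}, b != 0 &
  forall s, b.[s] != 0 -> v + s *: w != 0.
Proof.
move=> v0; have [i vi] : exists i, coord (vbasis {:V}) i v != 0.
  apply: contrapT => h; case/eqP: v0; rewrite (coord_vbasis (memvf v)) big1 // => i _.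
  have [->|ci] := eqVneq (coord (vbasis {:V}) i v) 0; first exact: scale0r.
  by case: h; exists i.
exists ((coord (vbasis {:V}) i v)%:P + coord (vbasis {:V}) i w *: 'X).
  apply: contraNneq vi => /(congr1 (horner^~ 0)).
  by rewrite horner0 hornerD hornerC hornerZ hornerX mulr0 addr0 => ->.
move=> s; apply: contraNneq => e; rewrite hornerD hornerC hornerZ hornerX mulrC.
by have := congr1 (coord (vbasis {:V}) i) e; rewrite linearD linearZ linear0 /= => ->.
Qed.

End Curves.

(** * An upper bound for chains of irreducible closed sets *)

Section Independent.
Variables (K : fieldType) (V : vectType K).

Definition independent_on (Z : set (proj V)) (I : finType) (g : I -> V -> K) :=
  forall c : I -> K, vanishes (fun v => \sum_x c x * g x v) Z -> forall x, c x = 0.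

(** Write a relation on Z' as a sum of f^k f0^(N-k) G_k. Once the coefficients below k are zero, f^k
    can be cancelled because Z' is irreducible. On Z, where f = 0, only f0^(N-k) G_k is left, and
    cancelling f0 shows that G_k vanishes there. The powers of f0 keep all degrees equal. *)
Lemma independent_step (Z Z' : set (proj V)) (f f0 : V -> K) D M (I : finType) (g : I -> V -> K) N :
  irreducible_set Z -> irreducible_set Z' -> Z `<=` Z' ->
  hfun D f -> hfun D f0 -> vanishes f Z -> ~ vanishes f Z' -> ~ vanishes f0 Z ->
  (forall x, hfun M (g x)) -> independent_on Z g ->
  independent_on Z' (fun (kx : 'I_N.+1 * I) v => f v ^+ kx.1 * f0 v ^+ (N - kx.1) * g kx.2 v).
Proof.
move=> iZ iZ' ZZ' hf hf0 fZ fZ' f0Z hg ind c c0.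
pose G (k : 'I_N.+1) v := \sum_x c (k, x) * g x v.
have hG k : hfun M (G k) by apply: hfun_sum => x; exact: hfunZ.
suff ck k : (forall x, c (k, x) = 0) by move=> [k x]; exact: ck.
case: k => k; elim/ltn_ind: k => k IH kN.
pose H v := \sum_(j < N.+1 | (k <= j)%N) f v ^+ (j - k) * f0 v ^+ (N - j) * G j v.
have hH : hfun (D * (N - k) + M) H.
  rewrite /H; apply: (@eq_hfun _ _ _ (fun v => \sum_(j <- index_enum 'I_N.+1)
     (k <= j)%N%:R * (f v ^+ (j - k) * f0 v ^+ (N - j) * G j v))) => [v|].
    by rewrite [RHS]big_mkcond; apply: eq_bigr => j _; case: leqP; rewrite ?mul1r ?mul0r.
  apply: hfun_sum => j; case: (leqP k j) => kj; last first.
    by apply: eq_hfun (hfun0 _ _) => v; rewrite mul0r.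
  apply: hfunZ; apply: hfunM => //.
  have -> : (D * (N - k) = D * (j - k) + D * (N - j))%N.
    have jN : (j <= N)%N by rewrite -ltnS.
    by rewrite -mulnDr; congr (_ * _)%N; lia.
  by apply: hfunM; exact: hfunX.
have fH v : \sum_kx c kx * (f v ^+ kx.1 * f0 v ^+ (N - kx.1) * g kx.2 v) = f v ^+ k * H v.
  rewrite (eq_bigr (fun kx => c (kx.1, kx.2) *
     (f v ^+ kx.1 * f0 v ^+ (N - kx.1) * g kx.2 v))) => [|[? ?] //].
  rewrite -(pair_bigA _ (fun j x => c (j, x) * (f v ^+ j * f0 v ^+ (N - j) * g x v))) /=.
  rewrite /H mulr_sumr [RHS]big_mkcond; apply: eq_bigr => j _.
  case: leqP => kj.
    rewrite /G !mulr_sumr; apply: eq_bigr => x _.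
    by rewrite mulrCA !mulrA -exprD subnKC.
  apply: big1 => x _; have -> : j = Ordinal (ltn_ord j) by exact/val_inj.
  by rewrite IH ?mul0r.
have [/fZ'//|HZ'] : vanishes f Z' \/ vanishes H Z'.
  apply: (irreducible_mul iZ' hf hH) => p /c0; rewrite fH => /eqP.
  rewrite mulf_eq0 expf_eq0 => /orP[/andP[_ /eqP ->]|/eqP ->]; first by rewrite mul0r.
  by rewrite mulr0.
have GZ : vanishes (G (Ordinal kN)) Z.
  have [/f0Z//|//] : vanishes f0 Z \/ vanishes (G (Ordinal kN)) Z.
  apply: (irreducible_mul iZ hf0 (hG _)) => p Zp.
  have := HZ' p (ZZ' p Zp); rewrite /H (bigD1 (Ordinal kN)) //= subnn expr0 mul1r.
  rewrite big1 => [|j /andP[kj jk]].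
    rewrite addr0 => /eqP; rewrite mulf_eq0 expf_eq0.
    by move=> /orP[/andP[_ /eqP ->]|/eqP ->]; rewrite ?mul0r ?mulr0.
  rewrite fZ // expr0n subn_eq0 leqNgt ltn_neqAle kj andbT eq_sym.
  by rewrite -(inj_eq val_inj) /= in jk; rewrite jk !mul0r.
by move=> x; exact: (ind (fun x => c (Ordinal kN, x)) GZ x).
Qed.

(** Each step of the chain multiplies the number of independent functions by N + 1 and raises their
    degree by D N. *)
Lemma independent_chain e (Z : nat -> set (proj V)) (f : nat -> V -> K) f0 D :
  (forall i, (i <= e)%N -> irreducible_set (Z i)) ->
  (forall i, (i < e)%N -> Z i `<=` Z i.+1) ->
  hfun D f0 -> ~ vanishes f0 (Z 0%N) ->
  (forall i, (i < e)%N -> [/\ hfun D (f i), vanishes (f i) (Z i) & ~ vanishes (f i) (Z i.+1)]) ->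
  forall N, exists (I : finType) (g : I -> V -> K),
    [/\ #|I| = (N.+1 ^ e)%N, forall x, hfun (D * N * e) (g x) & independent_on (Z e) g].
Proof.
move=> irr sub hf0 f0n hf N.
suff H i : (i <= e)%N -> ~ vanishes f0 (Z i) /\ exists (I : finType) (g : I -> V -> K),
    [/\ #|I| = (N.+1 ^ i)%N, forall x, hfun (D * N * i) (g x) & independent_on (Z i) g].
  by have [] := H e (leqnn e).
elim: i => [_|i IH ie].
  split=> //; exists unit, (fun _ _ => 1); split; first by rewrite card_unit.
    by move=> _; rewrite muln0; exact: hfun1.
  move=> c c0 []; have [[p Zp] _] := irr 0%N (leq0n _).
  have := c0 p Zp; rewrite (bigD1 tt) //= big1 ?addr0 ?mulr1 // => -[] //.
have [fn [I [g [cI hg ind]]]] := IH (ltnW ie).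
have [hfi fZ fZ'] := hf i ie.
split=> [v|]; first by apply: fn => p Zp; apply: v; exact: sub.
exists ('I_N.+1 * I)%type, (fun (kx : 'I_N.+1 * I) v => f i v ^+ kx.1 * f0 v ^+ (N - kx.1) * g kx.2 v).
split; first by rewrite card_prod card_ord cI expnS.
  move=> [k x] /=; rewrite mulnS; apply: hfunM => //.
  have kN : (k <= N)%N by rewrite -ltnS.
  have -> : (D * N = D * k + D * (N - k))%N by rewrite -mulnDr subnKC.
  by apply: hfunM; exact: hfunX.
by apply: (independent_step (irr _ (ltnW ie)) (irr _ ie) (sub _ ie) hfi hf0 fZ fZ' fn hg ind).
Qed.

(** Each strict inclusion supplies a form vanishing on one member but not on the next. Powers bring
    these forms to a common degree D; f0 is a power of a coordinate that is nonzero at a point of Z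
    0. *)
Lemma chain_forms (Y : set (proj V)) e Z : irreducible_chain Y e Z ->
  exists D f0 f, [/\ hfun D f0, ~ vanishes f0 (Z 0%N) &
   forall i, (i < e)%N ->
     [/\ hfun D (f i), vanishes (f i) (Z i) & ~ vanishes (f i) (Z i.+1)]].
Proof.
move=> [hZ sZ].
have /choice [df hdf] : forall i, exists df : nat * (V -> K), (i < e)%N ->
    [/\ (0 < df.1)%N, hfun df.1 df.2, vanishes df.2 (Z i) & ~ vanishes df.2 (Z i.+1)].
  move=> i; have [ie|] := ltnP i e; last by exists (0%N, fun=> 0).
  have [s ns] := sZ i ie; have [[A cA eA] [[r Zr] _]] := hZ i (ltnW ie).
  have [[B cB eB] _] := hZ i.+1 ie.
  have /zariski_closedP [S [hS hA]] := cA.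
  apply: contrapT => h; apply: ns => p Zp; rewrite eA.
  have Yp : Y p by move: Zp; rewrite eB => -[].
  split=> //; apply/hA => phi Sphi; apply: contrapT => np; apply: h.
  have [d hd] := hS _ Sphi.
  have vr q : Z i q -> phi (rep q) = 0 by rewrite eA => -[_ /hA]; apply.
  exists (d, phi) => _; split=> //=; last by move=> /(_ p Zp).
  (* A function of degree 0 is constant: its values at [rep p] and [rep r] both equal its value at
     0. *)
  rewrite lt0n; apply/eqP => d0; rewrite d0 in hd; apply: np.
  have := hfun_scale 0 (rep p) hd; have := hfun_scale 0 (rep r) hd.
  by rewrite !scale0r !expr0 !mul1r vr // => ->.
pose D := (\prod_(i < e) (df i).1)%N.
have [[p Z0] _] := (hZ 0%N (leq0n _)).2.
have [j cj] : exists j, coord (vbasis {:V}) j (rep p) != 0.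
  apply: contrapT => h; have := rep_neq0 p; case/eqP.
  rewrite (coord_vbasis (memvf (rep p))) big1 // => i _.
  have [->|ci] := eqVneq (coord (vbasis {:V}) i (rep p)) 0; first exact: scale0r.
  by case: h; exists i.
exists D, (fun v => coord (vbasis {:V}) j v ^+ D),
  (fun i v => (df i).2 v ^+ (D %/ (df i).1)); split.
- by have := hfunX D (hfun_coord j); rewrite mul1n.
- by move=> /(_ p Z0) /eqP; rewrite expf_eq0 (negPf cj) andbF.
move=> i ie; have [d0 hd v nv] := hdf i ie.
have dD : ((df i).1 %| D)%N by rewrite /D (bigD1 (Ordinal ie)) //= dvdn_mulr.
have D0 : (0 < D)%N.
  rewrite /D; elim/big_rec: _ => // l m _ m0; rewrite muln_gt0 m0 andbT.
  by have [] := hdf l (ltn_ord l).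
split.
- by have := hfunX (D %/ (df i).1) hd; rewrite mulnC divnK.
- by move=> q /v ->; rewrite expr0n eqn0Ngt divn_gt0 // dvdn_leq.
move=> h; apply: nv => q /h /eqP; rewrite expf_eq0 => /andP[_ /eqP].
by [].
Qed.

End Independent.

Lemma linear_dependence (K : fieldType) (I J : finType) (A : I -> J -> K) :
  (#|J| < #|I|)%N -> exists2 c : I -> K, (exists x, c x != 0) &
    forall j, \sum_x c x * A x j = 0.
Proof.
move=> JI; pose M := \matrix_(x < #|I|, j < #|J|) A (enum_val x) (enum_val j).
have : kermx M != 0.
  rewrite -mxrank_eq0 mxrank_ker -lt0n subn_gt0.
  exact: leq_ltn_trans (rank_leq_col _) JI.
move=> /rowV0Pn [v /sub_kermxP vM v0].
exists (fun x => v 0 (enum_rank x)).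
  apply: contrapT => h; case/eqP: v0; apply/rowP => x; rewrite mxE.
  apply/eqP; apply: contrapT => /negP n; apply: h; exists (enum_val x).
  by rewrite enum_valK.
move=> j; have /rowP /(_ (enum_rank j)) := vM; rewrite !mxE => e; rewrite -[RHS]e.
rewrite [RHS](reindex _ (onW_bij _ (@enum_rank_bij I))) /=.
by apply: eq_bigr => x _; rewrite mxE !enum_rankK.
Qed.

Section Bound.
Variables (K : fieldType) (V : vectType K).

(** A bound on the Hilbert function in place of a dimension count: pulled back along [pi], the forms
    of degree M span at most (M + 1)^k dimensions. *)
Definition parametrized (Y : set (proj V)) (k : nat) :=
  exists (T : Type) (pi : T -> V),
    (forall p, Y p -> exists t, pi t \in val p /\ pi t != 0) /\
    forall M, exists (J : finType) (psi : J -> T -> K), (#|J| <= M.+1 ^ k)%N /\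
      forall phi, hfun M phi -> exists c : J -> K, forall t,
        phi (pi t) = \sum_j c j * psi j t.

(** A chain of length e gives (N + 1)^e independent forms of degree D N e, so (N + 1)^e <= (D N e +
    1)^k for every N. Growth in N forces e <= k. *)
Lemma parametrized_bound (Y : set (proj V)) k e Z :
  parametrized Y k -> irreducible_chain Y e Z -> (e <= k)%N.
Proof.
move=> [T [pi [cov hJ]]] ch; have [D [f0 [f [hf0 f0n hf]]]] := chain_forms ch.
have [hZ sZ] := ch.
have card_le N : (N.+1 ^ e <= (D * N * e).+1 ^ k)%N.
  have [||I [g [cI hg ind]]] := @independent_chain _ _ e Z f f0 D _ _ hf0 f0n hf N.
  - by move=> i /hZ [].
  - by move=> i /sZ [].
  have [J [psi [cJ hpsi]]] := hJ (D * N * e)%N.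
  rewrite -cI; apply: leq_trans cJ; rewrite leqNgt; apply/negP => JI.
  have /choice [A hA] : forall x, exists c : J -> K, forall t,
      g x (pi t) = \sum_j c j * psi j t by move=> x; exact: hpsi.
  have [c [x /eqP cx] cA] := linear_dependence A JI; apply: cx; apply: ind => p Zp.
  have Yp : Y p by have [[B _ eB] _] := hZ e (leqnn e); move: Zp; rewrite eB => -[].
  have [t [tp t0]] := cov p Yp.
  have hs : hfun (D * N * e) (fun v => \sum_x c x * g x v).
    by apply: hfun_sum => y; exact: hfunZ.
  apply/(hfun_vanish hs tp t0).
  under eq_bigr => y _ do rewrite hA mulr_sumr.
  rewrite exchange_big big1 // => j _.
  by under eq_bigr => y _ do rewrite mulrA; rewrite -mulr_suml cA mul0r.
rewrite leqNgt; apply/negP => ke.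
(* If k < e, the choice N = C^k gives (D N e + 1)^k <= C^k (N + 1)^k < (N + 1)^(k+1) <= (N +
   1)^e. *)
pose C := (D * e).+1; have C0 : (0 < C ^ k)%N by rewrite expn_gt0.
have := card_le (C ^ k)%N; apply/negP; rewrite -ltnNge.
set N := (C ^ k)%N.
have le1 : ((D * N * e).+1 <= C * N.+1)%N by rewrite /C; nia.
have le2 : ((D * N * e).+1 ^ k <= C ^ k * N.+1 ^ k)%N.
  by rewrite -expnMn; case: (k) => // k'; rewrite leq_exp2r.
apply: leq_ltn_trans le2 _; apply: leq_trans (leq_pexp2l _ ke) => //.
by rewrite expnS ltn_pmul2r ?expn_gt0.
Qed.

End Bound.

(** * Multihomogeneous parametrizations *)

Section Multihomogeneous.
Variables (K : fieldType) (r s : nat).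
Local Notation var := ('I_r * 'I_s.+1)%type.
Implicit Types (e : {ffun var -> nat}) (t : var -> K) (f g : (var -> K) -> K).

Definition monomial e t := \prod_x t x ^+ e x.

Definition multidegree M e := forall i, (\sum_c e (i, c) = M)%N.

(** The same degree M is required in each of the r groups of s + 1 variables; this is what pulling
    back a form of degree M along a multilinear map produces. *)
Definition multihom M f := exists L : seq (K * {ffun var -> nat}),
  (forall ce, ce \in L -> multidegree M ce.2) /\
  forall t, f t = \sum_(ce <- L) ce.1 * monomial ce.2 t.

Lemma eq_multihom M f g : f =1 g -> multihom M f -> multihom M g.
Proof. by move=> e [L [h1 h2]]; exists L; split=> // t; rewrite -e. Qed.

Lemma multihom_monomial M e : multidegree M e -> multihom M (monomial e).
Proof.
move=> h; exists [:: (1, e)]; split=> [ce|t]; first by rewrite inE => /eqP ->.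
by rewrite big_seq1 mul1r.
Qed.

Lemma multihom0 M : multihom M (fun=> 0).
Proof. by exists [::]; split=> // t; rewrite big_nil. Qed.

Lemma multihom1 : multihom 0 (fun=> 1).
Proof.
apply: (@eq_multihom _ (monomial [ffun=> 0%N])).
  by move=> t; rewrite /monomial big1 // => x _; rewrite ffunE.
by apply: multihom_monomial => i; rewrite big1 // => c _; rewrite ffunE.
Qed.

Lemma multihomD M f g : multihom M f -> multihom M g -> multihom M (fun t => f t + g t).
Proof.
move=> [L1 [h1 e1]] [L2 [h2 e2]]; exists (L1 ++ L2); split=> [ce|t].
  by rewrite mem_cat => /orP[/h1|/h2].
by rewrite big_cat e1 e2.
Qed.

Lemma multihomZ M c f : multihom M f -> multihom M (fun t => c * f t).
Proof.
move=> [L [h e]]; exists [seq (c * ce.1, ce.2) | ce <- L]; split=> [ce|t].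
  by move=> /mapP[ce' /h ? ->].
by rewrite e big_map mulr_sumr; apply: eq_bigr => ce _; rewrite mulrA.
Qed.

Lemma multihom_sum M (I : Type) (l : seq I) (F : I -> (var -> K) -> K) :
  (forall i, multihom M (F i)) -> multihom M (fun t => \sum_(i <- l) F i t).
Proof.
move=> h; elim: l => [|i l IH].
  by apply: eq_multihom (multihom0 M) => t; rewrite big_nil.
by apply: eq_multihom (multihomD (h i) IH) => t; rewrite big_cons.
Qed.

Lemma multihomM M N f g : multihom M f -> multihom N g -> multihom (M + N) (fun t => f t * g t).
Proof.
move=> [L1 [h1 e1]] [L2 [h2 e2]].
exists [seq (c1.1 * c2.1, [ffun x => (c1.2 x + c2.2 x)%N]) | c1 : K * {ffun var -> nat} <- L1,
  c2 : K * {ffun var -> nat} <- L2].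
split=> [ce|t].
  move=> /allpairsP[[c1 c2] /= [/h1 m1 /h2 m2 ->]] i /=.
  by under eq_bigr => c _ do rewrite ffunE; rewrite big_split /= m1 m2.
rewrite e1 e2 big_allpairs_dep mulr_suml; apply: eq_bigr => c1 _.
rewrite mulr_sumr; apply: eq_bigr => c2 _ /=.
rewrite mulrACA; congr (_ * _); rewrite -big_split; apply: eq_bigr => x _.
by rewrite /= ffunE exprD.
Qed.

Lemma multihomX M k f : multihom M f -> multihom (M * k) (fun t => f t ^+ k).
Proof.
move=> h; elim: k => [|k IH]; first by rewrite muln0; apply: eq_multihom multihom1.
by rewrite mulnS; apply: eq_multihom (multihomM h IH) => t; rewrite exprS.
Qed.

Lemma multihom_prod (I : Type) (l : seq I) (M : I -> nat) (F : I -> (var -> K) -> K) :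
  (forall i, multihom (M i) (F i)) ->
  multihom (\sum_(i <- l) M i) (fun t => \prod_(i <- l) F i t).
Proof.
move=> h; elim: l => [|i l IH].
  by rewrite big_nil; apply: eq_multihom multihom1 => t; rewrite big_nil.
by rewrite big_cons; apply: eq_multihom (multihomM (h i) IH) => t; rewrite big_cons.
Qed.

(* An exponent of multidegree M is determined by its values off the last variable of each
   group, hence the bound. *)
Lemma multihom_spanned M : exists (J : finType) (psi : J -> (var -> K) -> K),
  (#|J| <= M.+1 ^ (r * s))%N /\
  forall f, multihom M f -> exists c : J -> K, forall t, f t = \sum_j c j * psi j t.
Proof.
pose J := {ffun 'I_r * 'I_s -> 'I_M.+1}.
pose ex (j : J) : {ffun var -> nat} := [ffun x : var =>
  if unlift ord_max x.2 is Some c then j (x.1, c) : nat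
  else (M - \sum_c j (x.1, c))%N].
exists J, (fun j => monomial (ex j)); split.
  by rewrite card_ffun card_prod !card_ord.
move=> f [L [h e]].
pose ka (e : {ffun var -> nat}) : J := [ffun x => inord (e (x.1, lift ord_max x.2))].
have kaK e' : multidegree M e' -> ex (ka e') = e'.
  move=> he; apply/ffunP => -[i c]; rewrite ffunE /=.
  have le c' : (e' (i, c') <= M)%N by rewrite -(he i) (bigD1 c') //= leq_addr.
  have eka c' : ka e' (i, c') = e' (i, lift ord_max c') :> nat.
    by rewrite ffunE inordK // ltnS.
  case: unliftP => [c' ->|->]; first exact: eka.
  under eq_bigr => c' _ do rewrite eka.
  rewrite -(he i) big_ord_recr /= -[X in (X + _ - _)%N](@eq_bigr _ _ _ _ _ _
    (fun c' => e' (i, lift ord_max c'))) ?addKn // => c' _.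
  by congr (e' (i, _)); apply/val_inj; rewrite /= /bump leqNgt ltn_ord.
exists (fun j => \sum_(ce <- L | ka ce.2 == j) ce.1) => t.
rewrite e big_seq.
transitivity (\sum_(ce <- L) ce.1 * monomial (ex (ka ce.2)) t).
  by rewrite [RHS]big_seq; apply: eq_bigr => ce /h /kaK ->.
rewrite (partition_big (fun ce => ka ce.2) predT) //=; apply: eq_bigr => j _.
by rewrite mulr_suml; apply: eq_bigr => ce /eqP ->.
Qed.

Variable V : vectType K.

Lemma hfun_multihom M (phi : V -> K) (pi : (var -> K) -> V) : hfun M phi ->
  (forall i, multihom 1 (fun t => coord (vbasis {:V}) i (pi t))) ->
  multihom M (fun t => phi (pi t)).
Proof.
move=> [F hF e] hc.
apply: (@eq_multihom _ (fun t => \sum_(m <- msupp F) F@_m *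
    \prod_(i < \dim {:V}) coord (vbasis {:V}) i (pi t) ^+ m i)).
  by move=> t; rewrite -e /poly_fun mevalE.
have H m : m \in msupp F -> multihom M (fun t => F@_m *
    \prod_(i < \dim {:V}) coord (vbasis {:V}) i (pi t) ^+ m i).
  move=> mF; apply: multihomZ.
  have <- : (\sum_(i < \dim {:V}) 1 * m i)%N = M.
    by rewrite -(dhomog_mf hF mF) /= mdegE; apply: eq_bigr => i _; rewrite mul1n.
  apply: (@multihom_prod _ (index_enum 'I_(\dim {:V})) (fun i => (1 * m i)%N)
    (fun i t => coord (vbasis {:V}) i (pi t) ^+ m i)) => i.
  exact: (multihomX (m i) (hc i)).
elim: (msupp F) H => [|m l IH] H.
  by apply: eq_multihom (multihom0 M) => t; rewrite big_nil.
have h1 := H m (mem_head _ _).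
have h2 := IH (fun m' m'l => H m' (@mem_behead _ (m :: l) _ m'l)).
by apply: eq_multihom (multihomD h1 h2) => t; rewrite big_cons.
Qed.

Lemma parametrized_multihom (Y : set (proj V)) (pi : (var -> K) -> V) :
  (forall p, Y p -> exists t, pi t \in val p /\ pi t != 0) ->
  (forall i, multihom 1 (fun t => coord (vbasis {:V}) i (pi t))) ->
  parametrized Y (r * s).
Proof.
move=> cov hc; exists (var -> K), pi; split=> // M.
have [J [psi [cJ hJ]]] := multihom_spanned M.
by exists J, psi; split=> // phi /hfun_multihom /(_ hc) /hJ.
Qed.

End Multihomogeneous.

(** * The dimension of projective space *)

Section ProjectiveSpace.
Variables (K : numFieldType) (V : vectType K) (N : nat).
Hypothesis dimV : \dim {:V} = N.+1.
Local Notation b := (vbasis {:V}).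

Lemma parametrized_proj : parametrized [set: proj V] N.
Proof.
pose pi (t : 'I_1 * 'I_N.+1 -> K) : V :=
  \sum_(i < \dim {:V}) t (ord0, cast_ord dimV i) *: b`_i.
have cpi i t : coord b i (pi t) = t (ord0, cast_ord dimV i).
  by rewrite /pi coord_sum_free // (basis_free (vbasisP _)).
rewrite -[N]mul1n; apply: (@parametrized_multihom _ _ _ _ _ pi).
  move=> p _; pose t (x : 'I_1 * 'I_N.+1) := coord b (cast_ord (esym dimV) x.2) (rep p); exists t.
  suff -> : pi t = rep p by rewrite val_rep memv_line rep_neq0.
  rewrite [RHS](coord_vbasis (memvf _)); apply: eq_bigr => i _ /=.
  by rewrite /t cast_ord_comp cast_ord_id.
move=> i; apply: (@eq_multihom _ _ _ _ (monomial [ffun x => (x == (ord0, cast_ord dimV i)) : nat])).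
  move=> t; rewrite cpi /monomial (bigD1 (ord0, cast_ord dimV i)) //= ffunE eqxx expr1.
  by rewrite big1 ?mulr1 // => x /negPf xi; rewrite ffunE xi.
apply: multihom_monomial => j; rewrite (bigD1 (cast_ord dimV i)) //= ffunE [j]ord1 eqxx.
by rewrite big1 // => c /negPf ci; rewrite ffunE xpair_eqE ci andbF.
Qed.

(** The chain consists of the coordinate subspaces, irreducible because any two of their points are
    joined by a line. *)
Lemma has_dim_proj : has_dim [set: proj V] N.
Proof.
split; last by move=> e Z; exact: parametrized_bound parametrized_proj.
pose Z i : set (proj V) := [set p | forall j : 'I_(\dim {:V}), (i < j)%N -> coord b j (rep p) = 0].
have inZ i (p : proj V) v : v \in val p -> v != 0 ->
    (forall j : 'I_(\dim {:V}), (i < j)%N -> coord b j v = 0) -> Z i p.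
  by move=> vp v0 h j /h h'; apply/(hfun_vanish (hfun_coord j) vp v0).
have coordb (i j : 'I_(\dim {:V})) : coord b i b`_j = (i == j)%:R.
  by rewrite coord_free ?(basis_free (vbasisP _)) // eq_sym.
have b0 (i : 'I_(\dim {:V})) : b`_i != 0.
  apply: contra_eq_neq (coordb i i) => ->; rewrite linear0 eqxx eq_sym; exact: oner_neq0.
have bZ (i : 'I_(\dim {:V})) (p : proj V) : b`_i \in val p -> Z i p.
  move=> bp; apply: (inZ _ _ _ bp (b0 i)) => j ij; rewrite coordb.
  by rewrite -(inj_eq val_inj) /= gtn_eqF.
exists Z; split=> [i iN|i iN].
  split.
    exists (Z i); last by rewrite setTI.
    apply/zariski_closedP; exists [set phi | exists2 j : 'I_(\dim {:V}), (i < j)%N & phi = coord b j].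
    split=> [_ [j _ ->]|p]; first by exists 1%N; exact: hfun_coord.
    by split=> [h _ [j ij ->]|h j ij]; [exact: h|apply: h; exists j].
  apply: irreducible_curves.
    have iN' : (i < \dim {:V})%N by rewrite dimV ltnS.
    have [p hp] := proj_of (b0 (Ordinal iN')); exists p; exact: (bZ (Ordinal iN')).
  move=> p q Zp Zq; have [c c0 hc] := line_neq0 (rep q - rep p) (rep_neq0 p).
  exists (fun s => rep p + s *: (rep q - rep p)), c; split=> //.
  - exact: polynomial_curve_line.
  - rewrite scale0r addr0 scale1r addrC subrK.
    by rewrite !rep_neq0 !val_rep !memv_line.
  - move=> s /hc n; split=> // x sx; apply: (inZ _ _ _ sx n) => j ij.
    by rewrite linearD linearZ linearB /= Zp // Zq // subrr mulr0 addr0.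
split=> [p h j ij|h]; first by apply: h; exact: ltnW.
have iN' : (i.+1 < \dim {:V})%N by rewrite dimV ltnS.
have [p hp] := proj_of (b0 (Ordinal iN')).
have := h p (bZ _ _ hp) (Ordinal iN') (ltnSn i).
move=> /(hfun_vanish (hfun_coord _) hp (b0 _)); rewrite coordb eqxx => /eqP.
by rewrite oner_eq0.
Qed.

End ProjectiveSpace.

(** * The variety of products of linear forms *)

Section Split.
Variables (K : numFieldType) (n : nat).
Local Notation V := (ternary_form K n).
Local Notation b := (vbasis {:V}).

Lemma prod_linear_neq0 (l : 'I_n -> ternary_form K 1) :
  (forall i, l i != 0) -> prod_linear l != 0.
Proof.
move=> l0; rewrite -val_eqE /=; apply/prodf_neq0 => i _.
by have := l0 i; rewrite -val_eqE.
Qed.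

Lemma linear_formE (l : ternary_form K 1) : l = linear_form
  (l : {mpoly K[3]})@_U_(ix) (l : {mpoly K[3]})@_U_(iy) (l : {mpoly K[3]})@_U_(it).
Proof.
apply/val_inj/meval_inj => v; rewrite linear_poly_eval dhomog1_eval //.
exact: dhomog_is_dhomog.
Qed.

Lemma SplitForms_neq0P (p : proj V) : SplitForms K n p <->
  exists l : 'I_n -> ternary_form K 1, (forall i, l i != 0) /\ prod_linear l \in val p.
Proof.
split=> -[l [l0 h]]; exists l; split=> //; first by rewrite h memv_line.
have [c c0 e] := rep_memP h (prod_linear_neq0 l0).
apply/eqP; rewrite eq_sym eqEdim dim_vline prod_linear_neq0 // -memvE h.
by case: (p) => L /= /eqP ->.
Qed.

Lemma prod_linear_distr (T : finType) (c : 'I_n -> T -> K)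
    (f : 'I_n -> T -> ternary_form K 1) :
  prod_linear (fun i => \sum_x c i x *: f i x) =
  \sum_(s : {ffun 'I_n -> T}) (\prod_i c i (s i)) *: prod_linear (fun i => f i (s i)).
Proof.
apply/val_inj; rewrite /= raddf_sum /=.
under eq_bigr => i _ do rewrite raddf_sum /=.
rewrite bigA_distr_bigA; apply: eq_bigr => s _ /=.
by rewrite scaler_prod.
Qed.

(** The coefficients of the factors form n groups of three variables, and the expanded product has
    degree one in each group. *)
Lemma parametrized_SplitForms : parametrized (SplitForms K n) (2 * n).
Proof.
pose x1 (c : 'I_3) : ternary_form K 1 := DHomog (linear_poly_homog
  (c == ix)%:R (c == iy)%:R (c == it)%:R).
pose pi (t : 'I_n * 'I_3 -> K) : V := prod_linear (fun i => \sum_c t (i, c) *: x1 c).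
have x1E a0 a1 a2 : a0 *: x1 ix + a1 *: x1 iy + a2 *: x1 it = linear_form a0 a1 a2.
  apply/val_inj/meval_inj => v /=; rewrite !mevalD !mevalZ !linear_poly_eval /=.
  by rewrite !mevalXU; ring.
rewrite mulnC; apply: (@parametrized_multihom _ _ _ _ _ pi).
  move=> p /SplitForms_neq0P [l [l0 lp]].
  exists (fun x => (l x.1 : {mpoly K[3]})@_U_(x.2)).
  suff -> : pi (fun x => (l x.1 : {mpoly K[3]})@_U_(x.2)) = prod_linear l.
    by split=> //; exact: prod_linear_neq0.
  apply/val_inj; apply: eq_bigr => i _; congr (val _); rewrite [RHS]linear_formE -x1E.
  rewrite !big_ord_recl big_ord0 addr0 addrA.
  have -> : lift ord0 (ord0 : 'I_2) = iy by exact/val_inj.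
  have -> : lift ord0 (lift ord0 (ord0 : 'I_1)) = it by exact/val_inj.
  by have -> : ord0 = ix by exact/val_inj.
move=> j; apply: (@eq_multihom _ _ _ _ (fun t => \sum_(s : {ffun 'I_n -> 'I_3})
    coord b j (prod_linear (fun i => x1 (s i))) * monomial [ffun x => (x.2 == s x.1) : nat] t)).
  move=> t; rewrite /pi prod_linear_distr linear_sum; apply: eq_bigr => s _ /=.
  rewrite linearZ mulrC; congr (_ * _); rewrite /monomial.
  rewrite (eq_bigr (fun x => t (x.1, x.2) ^+ (x.2 == s x.1))) => [|[i c] _]; last by rewrite ffunE.
  rewrite -(pair_bigA _ (fun i c => t (i, c) ^+ (c == s i))) /=.
  apply: eq_bigr => i _; rewrite (bigD1 (s i)) //= eqxx expr1 big1 ?mulr1 // => c.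
  by move=> /negPf ->.
apply: multihom_sum => s; apply: multihomZ; apply: multihom_monomial => i.
rewrite (bigD1 (s i)) //= ffunE eqxx big1 // => c /negPf cs.
by rewrite ffunE /= cs.
Qed.

Lemma polynomial_curve_prod (l d : 'I_n -> ternary_form K 1) :
  polynomial_curve (fun s => prod_linear (fun i => l i + s *: d i)).
Proof.
exists [seq ((\sum_i f i)%N, prod_linear (fun i => if f i then d i else l i))
  | f : {ffun 'I_n -> bool} <- enum {ffun 'I_n -> bool}] => s.
rewrite big_map big_enum /=.
transitivity (prod_linear (fun i => \sum_(c : bool) (s ^+ c) *: (if c then d i else l i))).
  apply/val_inj; apply: eq_bigr => i _; congr (val _).
  by rewrite big_bool /= expr1 expr0 scale1r addrC.
by rewrite prod_linear_distr; apply: eq_bigr => f _; rewrite prodrXr.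
Qed.

(* x, y, t have the weights 0, 1, 2. In the chain of flags below, the k-th member has total
   weight k, and the coefficient of a monomial of weight k + 1 separates it from the next. *)
Definition weight (m : 'X_{1..3}) : nat := (m iy + 2 * m it)%N.

Definition weight_le d (p : {mpoly K[3]}) := {in msupp p, forall m, (weight m <= d)%N}.

Lemma weight_leM d e p q : weight_le d p -> weight_le e q -> weight_le (d + e) (p * q).
Proof.
move=> hp hq m /msuppM_le /allpairsP [[m1 m2] /= [/hp h1 /hq h2 ->]].
by move: h1 h2; rewrite /weight !mnmDE; lia.
Qed.

Lemma weight_le_prod (d : 'I_n -> nat) (p : 'I_n -> {mpoly K[3]}) :
  (forall i, weight_le (d i) (p i)) -> weight_le (\sum_i d i) (\prod_i p i).
Proof.
move=> h; elim: (index_enum _) => [|i l IH].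
  by rewrite !big_nil => m; rewrite msupp1 inE => /eqP ->; rewrite /weight !mnm0E.
by rewrite !big_cons; exact: weight_leM.
Qed.

Lemma weight_le_line d p q s : weight_le d p -> weight_le d q -> weight_le d (p + s *: q).
Proof. by move=> hp hq m /msuppD_le; rewrite mem_cat => /orP[/hp|/msuppZ_le /hq]. Qed.

(** The i-th factor ranges over the nonzero forms in the span of x, in the span of x and y, or over
    all nonzero linear forms, as [d i] is 0, 1 or at least 2. *)
Definition SplitFlag (d : 'I_n -> nat) : set (proj V) := [set p : proj V |
  exists l : 'I_n -> ternary_form K 1,
    (forall i, l i != 0 /\ weight_le (d i) (l i)) /\ prod_linear l \in val p].

Lemma SplitFlag_sub d : SplitFlag d `<=` SplitForms K n.
Proof. by move=> p [l [h lp]]; apply/SplitForms_neq0P; exists l; split=> // i; have [] := h i. Qed.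

Lemma SplitFlagS (d d' : 'I_n -> nat) : (forall i, (d i <= d' i)%N) -> SplitFlag d `<=` SplitFlag d'.
Proof.
move=> dd' p [l [h lp]]; exists l; split=> // i; have [l0 w] := h i; split=> // m /w le.
exact: leq_trans le (dd' i).
Qed.

Lemma SplitFlag2 : SplitFlag (fun=> 2%N) = SplitForms K n.
Proof.
apply/seteqP; split; first exact: SplitFlag_sub.
move=> p /SplitForms_neq0P [l [l0 lp]]; exists l; split=> // i; split=> // m ml.
have := dhomog_mf (dhomog_is_dhomog (l i)) ml; rewrite /= mdegE !big_ord_recl big_ord0 addn0.
have -> : lift ord0 (ord0 : 'I_2) = iy by exact/val_inj.
have -> : lift ord0 (lift ord0 (ord0 : 'I_1)) = it by exact/val_inj.
by rewrite /weight; lia.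
Qed.

(** The variable of largest weight not exceeding d. *)
Definition flag_var (d : nat) : 'I_3 := inord (minn 2 d).

Definition flag_form (d : nat) : ternary_form K 1 :=
  DHomog (linear_poly_homog (flag_var d == ix)%:R (flag_var d == iy)%:R (flag_var d == it)%:R).

Lemma flag_formE d : val (flag_form d) = 'X_(flag_var d).
Proof.
apply: meval_inj => v; rewrite linear_poly_eval mevalXU.
by case: (ord3P (flag_var d)) => -> /=; rewrite ?mul1r ?mul0r ?addr0 ?add0r.
Qed.

Lemma weight_flag_var d : weight U_(flag_var d) = minn 2 d.
Proof.
have e : flag_var d = minn 2 d :> nat by rewrite inordK // ltnS geq_minl.
rewrite /weight !mnm1E -!(inj_eq val_inj) /= e.
by case: (minn 2 d) (geq_minl 2 d) => [|[|[|]]].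
Qed.

Lemma flag_form_neq0 d : flag_form d != 0.
Proof.
rewrite -val_eqE flag_formE; apply/eqP => /(congr1 (mcoeff U_(flag_var d))) /eqP.
by rewrite mcoeffXU eqxx mcoeff0 oner_eq0.
Qed.

Lemma weight_le_flag_form d : weight_le d (val (flag_form d)).
Proof. by move=> m; rewrite flag_formE msuppX inE => /eqP ->; rewrite weight_flag_var geq_minr. Qed.

Lemma SplitFlag_flag_form d (p : proj V) :
  prod_linear (fun i => flag_form (d i)) \in val p -> SplitFlag d p.
Proof.
move=> h; exists (fun i => flag_form (d i)); split=> // i.
by split; [exact: flag_form_neq0|exact: weight_le_flag_form].
Qed.

(** All factors move along lines simultaneously; the product of the polynomials from [line_neq0]
    marks the parameters at which a factor might vanish. *)
Lemma irreducible_SplitFlag d : irreducible_set (SplitFlag d).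
Proof.
have l0 : prod_linear (fun i => flag_form (d i)) != 0.
  by apply: prod_linear_neq0 => i; exact: flag_form_neq0.
apply: irreducible_curves; first by have [p hp] := proj_of l0; exists p; exact: SplitFlag_flag_form.
move=> p q [l [hl lp]] [l' [hl' lq]].
have /choice [c hc] : forall i, exists c : {poly K}, c != 0 /\
    forall s, c.[s] != 0 -> l i + s *: (l' i - l i) != 0.
  by move=> i; have [c c0 h] := line_neq0 (l' i - l i) (hl i).1; exists c.
exists (fun s => prod_linear (fun i => l i + s *: (l' i - l i))), (\prod_i c i); split.
- exact: polynomial_curve_prod.
- have -> : prod_linear (fun i => l i + 0 *: (l' i - l i)) = prod_linear l.
    by apply/val_inj; apply: eq_bigr => i _; rewrite scale0r addr0.
  have -> : prod_linear (fun i => l i + 1 *: (l' i - l i)) = prod_linear l'.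
    by apply/val_inj; apply: eq_bigr => i _; rewrite scale1r addrC subrK.
  by split=> //; apply: prod_linear_neq0 => i; [have [] := hl i|have [] := hl' i].
- by apply/prodf_neq0 => i _; have [] := hc i.
move=> s; rewrite horner_prod => /prodf_neq0 cs.
have n0 i : l i + s *: (l' i - l i) != 0 by apply: (hc i).2; exact: cs.
split=> [|r hr]; first exact: prod_linear_neq0.
exists (fun i => l i + s *: (l' i - l i)); split=> // i; split=> //=.
rewrite -[X in weight_le _ X]/(val (l i) + s *: (val (l' i) - val (l i))).
rewrite -[- val (l i)]scaleN1r.
apply: weight_le_line; first by have [] := hl i.
by apply: weight_le_line; [have [] := hl' i|have [] := hl i].
Qed.

Lemma irreducible_SplitForms : irreducible_set (SplitForms K n).
Proof. by rewrite -SplitFlag2; exact: irreducible_SplitFlag. Qed.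

Lemma SplitFlag_strict d d' : (\sum_i d i < \sum_i d' i)%N -> (forall i, (d' i <= 2)%N) ->
  ~ (SplitFlag d' `<=` zclosure (SplitFlag d)).
Proof.
move=> dd' d2 h; pose l i := flag_form (d' i).
have l0 : prod_linear l != 0 by apply: prod_linear_neq0 => i; exact: flag_form_neq0.
have [p hp] := proj_of l0.
pose M := (\sum_i U_(flag_var (d' i)))%MM.
have wM : weight M = (\sum_i d' i)%N.
  rewrite /weight /M !mnm_sumE mulnC big_distrl -big_split; apply: eq_bigr => i _ /=.
  by rewrite mulnC -[LHS]/(weight _) weight_flag_var (minn_idPr _).
have hM : hfun 1 (fun v : V => (v : {mpoly K[3]})@_M).
  by apply: hfun_linear => c u v /=; rewrite mcoeffD mcoeffZ.
have lM : (val (prod_linear l))@_M = 1.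
  rewrite /= (eq_bigr (fun i => 'X_[U_(flag_var (d' i))])) => [|i _]; last exact: flag_formE.
  by rewrite mprodXE mcoeffX eqxx.
have v0 : vanishes (fun v : V => (v : {mpoly K[3]})@_M) (SplitFlag d).
  move=> q [l' [hl' lq]].
  have l'0 : prod_linear l' != 0 by apply: prod_linear_neq0 => i; have [] := hl' i.
  apply/(hfun_vanish hM lq l'0) => /=; apply: memN_msupp_eq0; apply/negP.
  have w := @weight_le_prod d (fun i => val (l' i)) (fun i => (hl' i).2).
  by move=> /w; rewrite wM leqNgt dd'.
have /(hfun_vanish hM hp l0) := h p (SplitFlag_flag_form hp) _ _ hM v0.
by rewrite lM => /eqP; rewrite oner_eq0.
Qed.

Lemma has_dim_SplitForms : has_dim (SplitForms K n) (2 * n).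
Proof.
split; last by move=> e Z; exact: parametrized_bound parametrized_SplitForms.
(* The factors are filled in turn, two units each, so that the total is k. *)
pose d k (j : 'I_n) := minn 2 (k - 2 * j).
have sumd k : (k <= 2 * n)%N -> (\sum_j d k j = k)%N.
  suff -> : (\sum_j d k j = minn k (2 * n))%N by move=> /minn_idPl.
  rewrite /d; elim: (n) => [|m IH]; first by rewrite big_ord0 muln0 minn0.
  by rewrite big_ord_recr /= IH; lia.
pose Z k := SplitForms K n `&` zclosure (SplitFlag (d k)).
exists Z; split=> [k kn|k kn].
  split; first by exists (zclosure (SplitFlag (d k))) => //; exact: zclosure_closed.
  apply: (irreducible_between (irreducible_SplitFlag (d k))); last by move=> p [].
  by move=> p hp; split; [exact: SplitFlag_sub hp|exact: sub_zclosure].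
split=> [p [Sp cp]|h].
  split=> //; apply: zclosureS cp; apply: SplitFlagS => j; rewrite /d; lia.
apply: (@SplitFlag_strict (d k) (d k.+1)).
- by rewrite !sumd // ltnW.
- by move=> j; rewrite /d geq_minl.
move=> p hp; have [] := h p; last by [].
by split; [exact: SplitFlag_sub hp|exact: sub_zclosure].
Qed.

Lemma has_codim_SplitForms : has_codim (SplitForms K n) 'C(n, 2).
Proof.
(* There are C(n + 2, 2) = C(n, 2) + 2 n + 1 ternary monomials of degree n. *)
have dimV : \dim {:V} = (2 * n + 'C(n, 2)).+1.
  rewrite dimvf -[LHS]/'C(n + 2, n); have := bin_sub (leq_addl n 2); rewrite addnK addn2 => ->.
  by rewrite !binS !bin1 !bin0; lia.
exists (2 * n + 'C(n, 2))%N, (2 * n)%N; split=> //; first exact: has_dim_proj.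
exact: has_dim_SplitForms.
Qed.

End Split.

(** * Closedness of the variety of products *)

Local Notation esyms R n := [tuple (@mesym n R i.+1) | i < n].

Section Mmap.
Variables (A B : comNzRingType) (n : nat) (f : {rmorphism A -> B}) (v : 'I_n -> B).

Lemma mmap_comp k (p : {mpoly A[k]}) (q : k.-tuple {mpoly A[n]}) :
  mmap f v (p \mPo q) = mmap f (fun i => mmap f v (tnth q i)) p.
Proof.
rewrite comp_mpolyE raddf_sum /=; apply: eq_bigr => m _.
by rewrite mmapZ rmorph_prod; congr (_ * _); apply: eq_bigr => i _; rewrite rmorphXn.
Qed.

Lemma mmap_mesym k : mmap f v (@mesym n A k) = (@mesym n B k).@[v].
Proof.
rewrite /mesym !raddf_sum; apply: eq_bigr => h _ /=; rewrite !rmorph_prod.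
by apply: eq_bigr => i _ /=; rewrite mmapX mmap1U mevalXU.
Qed.

Lemma mmap_comp_esyms (p : {mpoly A[n]}) :
  mmap f v (p \mPo esyms A n) = mmap f (fun i => (@mesym n B i.+1).@[v]) p.
Proof.
rewrite mmap_comp; apply: eq_bigr => m _; congr (_ * _); apply: mmap1_eq => i.
by rewrite tnth_mktuple mmap_mesym.
Qed.

End Mmap.

Section RootsProduct.
Variables (K : fieldType) (n : nat).

(** Zero exactly when, for some matching of the a_i with the b_i, the corresponding product of
    linear forms takes the value w at (x, y, t). *)
Definition roots_product (x y t : K) (a b : 'I_n -> K) (w : K) : K :=
  \prod_(s : 'S_n) (w - \prod_i (x - y * a i - t * b (s i))).

(* The product is symmetric in the a_i and in the b_i separately, hence a polynomial
   in their elementary symmetric functions. *)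
Lemma roots_product_esym x y t : exists P : {mpoly {mpoly {poly K}[n]}[n]},
  forall a b w, roots_product x y t a b w =
    mmap (mmap (horner_eval w) (fun i => (@mesym n K i.+1).@[b]))
         (fun i => (@mesym n K i.+1).@[a]) P.
Proof.
(* Three layers of variables: the outer ones stand for the a_i, the inner ones for the b_i, and the
   univariate X for w. *)
pose c (k : K) : {mpoly {mpoly {poly K}[n]}[n]} := k%:P%:MP%:MP.
pose fac (s : 'S_n) : {mpoly {mpoly {poly K}[n]}[n]} :=
  'X%:MP%:MP - \prod_i (c x - c y * 'X_i - c t * ('X_(s i))%:MP).
pose E := \prod_s fac s.
have evE a b w : mmap (mmap (horner_eval w) b) a E = roots_product x y t a b w.
  pose f : {rmorphism {mpoly {mpoly {poly K}[n]}[n]} -> K} := mmap (mmap (horner_eval w) b) a.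
  rewrite -[LHS]/(f E).
  have fC q : f q%:MP%:MP = q.[w] by exact: etrans (mmapC _ _ _) (mmapC _ _ _).
  have fX i : f 'X_i = a i by exact: etrans (mmapX _ _ _) (mmap1U _ _).
  have fY i : f ('X_i)%:MP = b i.
    exact: etrans (mmapC _ _ _) (etrans (mmapX _ _ _) (mmap1U _ _)).
  rewrite /E rmorph_prod; apply: eq_bigr => s _; rewrite rmorphB /= fC hornerX.
  rewrite rmorph_prod; congr (_ - _); apply: eq_bigr => i _.
  by rewrite !rmorphB !rmorphM /= !fC !hornerC fX fY.
have Eout s : msym s E = E.
  rewrite rmorph_prod [RHS](reindex_inj (mulgI s^-1%g)); apply: eq_bigr => s' _.
  rewrite /fac rmorphB /= {1}/msym mmapC; congr (_ - _).
  rewrite rmorph_prod [RHS](reindex_inj (@perm_inj _ s)); apply: eq_bigr => i _.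
  rewrite !rmorphB !rmorphM /= /c /msym !mmapC mmapX mmap1U.
  by rewrite permM permK.
have Ein s : map_mpoly (msym s) E = E.
  rewrite rmorph_prod [RHS](reindex_inj (mulIg s)); apply: eq_bigr => s' _.
  rewrite /fac rmorphB /= map_mpolyC /= {1}/msym mmapC; congr (_ - _).
  rewrite rmorph_prod; apply: eq_bigr => i _.
  rewrite !rmorphB !rmorphM /= /c !map_mpolyC /= map_mpolyX /msym !mmapC mmapX mmap1U.
  by rewrite permM.
have symE : E \is symmetric by apply/issymP.
have [P0 [eP0 _]] := sym_fundamental symE.
have map_esym s k : map_mpoly (msym s) (@mesym n {mpoly {poly K}[n]} k) = @mesym n _ k.
  rewrite /mesym raddf_sum; apply: eq_bigr => h _ /=; rewrite rmorph_prod.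
  by apply: eq_bigr => j _; rewrite /= map_mpolyX.
have map_esyms s : [tuple of [seq map_mpoly (msym s) q | q <- esyms {mpoly {poly K}[n]} n]]
    = esyms {mpoly {poly K}[n]} n.
  apply: eq_from_tnth => i; rewrite tnth_map tnth_mktuple; exact: map_esym.
(* Uniqueness in the fundamental theorem, applied to the outer variables, makes the coefficients of
   P0 symmetric in the inner ones; the theorem then applies to each coefficient. *)
have mapP0 s : map_mpoly (msym s) P0 = P0.
  apply: msym_fundamental_un; rewrite -{1}(map_esyms s) -map_mpoly_comp; last exact: inj_msym.
  rewrite eP0; exact: Ein.
have symc m : P0@_m \is symmetric.
  by apply/issymP => s; rewrite -[in RHS](mapP0 s) mcoeff_map_mpoly.
pose u m := sval (sym_fundamental (symc m)).
have eu m : u m \mPo esyms {poly K} n = P0@_m by rewrite /u; case: sym_fundamental => q [].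
exists (\sum_(m <- msupp P0) u m *: 'X_[m]) => a b w.
rewrite -evE -eP0 mmap_comp_esyms raddf_sum; apply: eq_bigr => m _ /=.
by rewrite mmapZ mmapX -eu mmap_comp_esyms.
Qed.

End RootsProduct.

Section Regular.
Variables (K : fieldType) (V : vectType K) (c : V -> K).
Hypothesis hc : hfun 1 c.

(** Functions h / c^M of degree zero on the chart where c is nonzero; multiplying by c^M later
    recovers a form. *)
Definition regular (phi : V -> K) := exists M h, hfun M h /\
  forall v, c v != 0 -> h v = c v ^+ M * phi v.

Lemma eq_regular phi psi : phi =1 psi -> regular phi -> regular psi.
Proof. by move=> e [M [h [hM he]]]; exists M, h; split=> // v /he ->; rewrite e. Qed.

Lemma regular_const a : regular (fun=> a).
Proof.
exists 0%N, (fun=> a * 1); split; first by apply: hfunZ; exact: hfun1.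
by move=> v _; rewrite mul1r mulr1.
Qed.

Lemma regular_div psi : hfun 1 psi -> regular (fun v => psi v / c v).
Proof. by move=> h; exists 1%N, psi; split=> // v c0; rewrite expr1 mulrCA divff // mulr1. Qed.

Lemma regularD phi psi : regular phi -> regular psi -> regular (fun v => phi v + psi v).
Proof.
move=> [M [h [hM he]]] [N [g [gN ge]]].
have hcX k : hfun k (fun v => c v ^+ k) by have := hfunX k hc; rewrite mul1n.
exists (M + N)%N, (fun v => h v * c v ^+ N + c v ^+ M * g v); split.
  by apply: hfunD; apply: hfunM.
by move=> v c0; rewrite he // ge // exprD; ring.
Qed.

Lemma regularM phi psi : regular phi -> regular psi -> regular (fun v => phi v * psi v).
Proof.
move=> [M [h [hM he]]] [N [g [gN ge]]]; exists (M + N)%N, (fun v => h v * g v).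
split; first exact: hfunM.
by move=> v c0; rewrite he // ge // exprD mulrACA.
Qed.

Lemma regularX phi k : regular phi -> regular (fun v => phi v ^+ k).
Proof.
move=> h; elim: k => [|k IH]; first exact: regular_const.
by apply: eq_regular (regularM h IH) => v; rewrite exprS.
Qed.

Lemma regular_sum (I : Type) (r : seq I) (phi : I -> V -> K) :
  (forall i, regular (phi i)) -> regular (fun v => \sum_(i <- r) phi i v).
Proof.
move=> h; elim: r => [|i r IH].
  by apply: eq_regular (regular_const 0) => v; rewrite big_nil.
by apply: eq_regular (regularD (h i) IH) => v; rewrite big_cons.
Qed.

Lemma regular_prod (I : Type) (r : seq I) (phi : I -> V -> K) :
  (forall i, regular (phi i)) -> regular (fun v => \prod_(i <- r) phi i v).
Proof.
move=> h; elim: r => [|i r IH].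
  by apply: eq_regular (regular_const 1) => v; rewrite big_nil.
by apply: eq_regular (regularM (h i) IH) => v; rewrite big_cons.
Qed.

Lemma regular_mmap n (A : nzRingType) (f : V -> A -> K) (a : 'I_n -> V -> K) (P : {mpoly A[n]}) :
  (forall x, regular (fun v => f v x)) -> (forall i, regular (a i)) ->
  regular (fun v => mmap (f v) (fun i => a i v) P).
Proof.
move=> hf ha; apply: regular_sum => m; apply: regularM => //.
by apply: regular_prod => i; exact: regularX.
Qed.

Lemma regular_horner (w : V -> K) (p : {poly K}) : regular w -> regular (fun v => p.[w v]).
Proof.
move=> hw; apply: (@eq_regular (fun v => \sum_(i < size p) p`_i * w v ^+ i)).
  by move=> v; rewrite horner_coef.
by apply: regular_sum => i; apply: regularM; [exact: regular_const|exact: regularX].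
Qed.

End Regular.

Section Closed.
Variables (K : numClosedFieldType) (n : nat).
Local Notation V := (ternary_form K n).

(** Vieta, applied to the roots of the monic polynomial with the prescribed coefficients. *)
Lemma esym_roots (e : nat -> K) : exists a : 'I_n -> K,
  forall i : 'I_n, (@mesym n K i.+1).@[a] = e i.+1.
Proof.
pose p : {poly K} := \poly_(k < n.+1) (if k == n then 1 else (-1) ^+ (n - k) * e (n - k)%N).
have pn : p`_n = 1 by rewrite coef_poly ltnSn eqxx.
have sp : size p = n.+1.
  apply/eqP; rewrite eqn_leq size_poly ltnNge; apply/negP => le.
  by move/eqP: pn; rewrite nth_default // eq_sym oner_eq0.
have [rs ers] := closed_field_poly_normal p.
have lp : lead_coef p = 1 by rewrite lead_coefE sp.
rewrite lp scale1r in ers.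
have srs : size rs == n by rewrite -eqSS -sp ers size_prod_XsubC.
exists (tnth (Tuple srs)) => i.
have iN : (i.+1 < n.+1)%N by rewrite ltnS.
have := mroots_coeff (Tuple srs) (Ordinal iN); rewrite /= -ers coef_poly.
rewrite ltnS leq_subr subKn // ltn_eqF; last by rewrite ltn_subrL /= (leq_ltn_trans _ (ltn_ord i)).
have s0 : (-1) ^+ i.+1 != 0 :> K by rewrite expf_neq0 // oppr_eq0 oner_neq0.
by move=> /(mulfI s0) ->.
Qed.

(* The chart f(1, p2, p3) <> 0, in coordinates that move (1, p2, p3) to the x-axis. *)
Variables p2 p3 : K.

Definition chart_eval (x y t : K) (f : {mpoly K[3]}) : K :=
  f.@[tnth [tuple x; p2 * x + y; p3 * x + t]].

Definition chart_lead (f : V) : K := chart_eval 1 0 0 f.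

Definition chart_poly (y t : K) (f : {mpoly K[3]}) : {poly K} :=
  mmap (@polyC K) (tnth [tuple 'X; p2 *: 'X + y%:P; p3 *: 'X + t%:P]) f.

Lemma hfun_chart_eval x y t : hfun 1 (fun f : V => chart_eval x y t f).
Proof. by apply: hfun_linear => a u v; rewrite /chart_eval mevalD mevalZ. Qed.

Lemma hfun_chart_poly y t k : hfun 1 (fun f : V => (chart_poly y t f)`_k).
Proof.
by apply: hfun_linear => a u v; rewrite /chart_poly mmapD mmapZ coefD coefCM.
Qed.

(* The value of the elementary symmetric function e_k at the roots of f(., y, t) in the chart;
   k is at most n, and division by zero occurs off the chart. *)
Definition chart_esym y t (f : V) (k : nat) : K :=
  (-1) ^+ k * (chart_poly y t f)`_(n - k) / chart_lead f.

Lemma regular_chart_esym y t k : regular chart_lead (fun f => chart_esym y t f k).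
Proof.
apply: (@regular_div _ _ chart_lead (fun f : V => (-1) ^+ k * (chart_poly y t f)`_(n - k))).
by apply: hfunZ; exact: hfun_chart_poly.
Qed.

(** In the chart the x-coefficient of each factor is its value at (1, p2, p3), nonzero by
    hypothesis. Dividing by it yields a_i and b_i, and Vieta identifies their elementary symmetric
    functions. *)
Lemma chart_prod_linear (l : 'I_n -> ternary_form K 1) :
  chart_lead (prod_linear l) != 0 ->
  exists a b : 'I_n -> K,
    [/\ forall i : 'I_n, chart_esym 1 0 (prod_linear l) i.+1 = (@mesym n K i.+1).@[a],
        forall i : 'I_n, chart_esym 0 1 (prod_linear l) i.+1 = (@mesym n K i.+1).@[b] &
        forall x y t, chart_eval x y t (prod_linear l) =
          chart_lead (prod_linear l) * \prod_i (x - y * a i - t * b i)].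
Proof.
pose A i := (l i : {mpoly K[3]})@_U_(ix); pose B i := (l i : {mpoly K[3]})@_U_(iy).
pose D i := (l i : {mpoly K[3]})@_U_(it).
pose P i := A i + B i * p2 + D i * p3.
have ev x y t : chart_eval x y t (prod_linear l) = \prod_i (P i * x + B i * y + D i * t).
  rewrite /chart_eval rmorph_prod; apply: eq_bigr => i _ /=.
  rewrite dhomog1_eval; last exact: dhomog_is_dhomog.
  by rewrite !(tnth_nth 0) /P /A /B /D /=; ring.
have leadE : chart_lead (prod_linear l) = \prod_i P i.
  by rewrite /chart_lead ev; apply: eq_bigr => i _; rewrite mulr1 !mulr0 !addr0.
rewrite leadE => /prodf_neq0 P0.
have evp y t : chart_poly y t (prod_linear l) =
    \prod_i (P i *: 'X + (B i * y + D i * t)%:P).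
  apply: horner_inj => x.
  have -> : (chart_poly y t (prod_linear l)).[x] = chart_eval x y t (prod_linear l).
    rewrite /chart_poly /chart_eval mevalE horner_sum; apply: eq_bigr => m _.
    rewrite hornerM hornerC horner_prod; congr (_ * _); apply: eq_bigr => i _.
    rewrite horner_exp; congr (_ ^+ _).
    by case: (ord3P i) => ->; rewrite ?(tnth_nth 0) /= !hornerE.
  by rewrite ev horner_prod; apply: eq_bigr => i _; rewrite !hornerE -?addrA ?addrA.
have es y t (a : 'I_n -> K) : (forall i, a i = - (B i * y + D i * t) / P i) ->
    forall i : 'I_n, chart_esym y t (prod_linear l) i.+1 = (@mesym n K i.+1).@[a].
  move=> ha i; rewrite /chart_esym leadE evp.
  have -> : \prod_i (P i *: 'X + (B i * y + D i * t)%:P) =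
      (\prod_i P i) *: \prod_(r <- [tuple a i | i < n]) ('X - r%:P).
    rewrite big_tuple -scaler_prod; apply: eq_bigr => j _.
    rewrite tnth_mktuple scalerBr -[_ *: _%:P]mul_polyC -polyCM ha mulrCA divff ?P0 //.
    by rewrite mulr1 polyCN opprK.
  have iN : (i.+1 < n.+1)%N by rewrite ltnS.
  have /= := mroots_coeff [tuple a i | i < n] (Ordinal iN); rewrite coefZ => ->.
  have Q0 : \prod_i P i != 0 by apply/prodf_neq0.
  have -> : (mesym n K i.+1).@[tnth [tuple a i | i < n]] = (mesym n K i.+1).@[a].
    by apply: meval_eq => j; rewrite tnth_mktuple.
  have sq : (-1) ^+ i.+1 * (-1) ^+ i.+1 = 1 :> K by rewrite -expr2 sqrr_sign.
  rewrite [X in X / _]mulrCA [(-1) ^+ _ * (_ * _)]mulrA sq mul1r mulrC mulKf //.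
exists (fun i => - B i / P i), (fun i => - D i / P i); split.
- by apply: es => i; rewrite mulr1 mulr0 addr0.
- by apply: es => i; rewrite mulr1 mulr0 add0r.
move=> x y t; rewrite ev -big_split; apply: eq_bigr => i _ /=.
by have := P0 i isT; move: (P i) (B i) (D i) => q r s q0; field.
Qed.

(** The product of the G s over all permutations vanishes at every point, hence as a polynomial. The
    polynomial ring is a domain, so a single matching s works for all (x, y, t). *)
Lemma split_of_roots_product (f : V) (a b : 'I_n -> K) : f != 0 ->
  chart_lead f != 0 ->
  (forall x y t, roots_product x y t a b (chart_eval x y t f / chart_lead f) = 0) ->
  exists2 l : 'I_n -> ternary_form K 1, forall i, l i != 0 & f = chart_lead f *: prod_linear l.
Proof.
move=> f0 c0 h.
pose g : {mpoly K[3]} := (f : {mpoly K[3]}) \mPo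
  [tuple 'X_ix; p2 *: 'X_ix + 'X_iy; p3 *: 'X_ix + 'X_it].
pose G (s : 'S_n) := (chart_lead f)^-1 *: g - \prod_i linear_poly 1 (- a i) (- b (s i)).
have gE v : g.@[v] = chart_eval (v ix) (v iy) (v it) f.
  rewrite comp_mpoly_meval; apply: meval_eq => i.
  case: (ord3P i) => ->; rewrite !(tnth_nth 0) /=.
  - by rewrite mevalXU.
  - by rewrite mevalD mevalZ !mevalXU.
  - by rewrite mevalD mevalZ !mevalXU.
have /eqP/prodf_eq0 [s _ /eqP Gs] : \prod_s G s = 0.
  apply: meval_eq0 => v; rewrite -[RHS](h (v ix) (v iy) (v it)) rmorph_prod.
  apply: eq_bigr => s _ /=; rewrite mevalB mevalZ gE mulrC rmorph_prod; congr (_ - _).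
  by apply: eq_bigr => i _; rewrite /= linear_poly_eval; ring.
(* Undoing the coordinate change, y - p2 x and t - p3 x are substituted in x - a_i y - b_(s i) t. *)
pose l i : ternary_form K 1 :=
  linear_form (1 + p2 * a i + p3 * b (s i)) (- a i) (- b (s i)).
have fl : f = chart_lead f *: prod_linear l.
  apply/val_inj/meval_inj => v /=.
  have := congr1 (meval (fun i => if i == ix then v ix else if i == iy then v iy - p2 * v ix
    else v it - p3 * v ix)) Gs.
  rewrite meval0 mevalB mevalZ gE /= => /eqP; rewrite subr_eq0 => /eqP e.
  have -> : f.@[v] = chart_eval (v ix) (v iy - p2 * v ix) (v it - p3 * v ix) f.
    apply: meval_eq => i; case: (ord3P i) => ->; rewrite !(tnth_nth 0) /= //; ring.
  rewrite mevalZ; apply: (mulfI (x := (chart_lead f)^-1)); first by rewrite invr_eq0.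
  rewrite e mulrA mulVf // mul1r !rmorph_prod; apply: eq_bigr => i _ /=.
  by rewrite !linear_poly_eval /=; ring.
exists l => // i; apply: contraNneq f0 => li.
rewrite fl; suff -> : prod_linear l = 0 by rewrite scaler0.
by apply/val_inj; rewrite -[LHS]/(\prod_j val (l j)) (bigD1 i) // li /= mul0r.
Qed.

End Closed.

(** There is one equation for each chart (p2, p3) and each point z = (x, y, t): the product of
    [roots_product], written in the coefficients of f, with denominators cleared. *)
Lemma closed_SplitForms (K : numClosedFieldType) n : zariski_closed (SplitForms K n).
Proof.
apply/zariski_closedP.
pose V := ternary_form K n.
have /choice [P hP] : forall z : K * K * K, exists P : {mpoly {mpoly {poly K}[n]}[n]},
    forall a b w, roots_product z.1.1 z.1.2 z.2 a b w =
      mmap (mmap (horner_eval w) (fun i : 'I_n => (@mesym n K i.+1).@[b]))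
         (fun i : 'I_n => (@mesym n K i.+1).@[a]) P.
  by move=> z; exact: roots_product_esym.
pose phi (p2 p3 : K) (z : K * K * K) (f : V) : K :=
  mmap (mmap (horner_eval (chart_eval p2 p3 z.1.1 z.1.2 z.2 f / chart_lead p2 p3 f))
             (fun i : 'I_n => chart_esym p2 p3 0 1 f i.+1))
       (fun i : 'I_n => chart_esym p2 p3 1 0 f i.+1) (P z).
have hlead p2 p3 : hfun 1 (chart_lead p2 p3 : V -> K) by exact: hfun_chart_eval.
have reg p2 p3 z : regular (chart_lead p2 p3) (phi p2 p3 z).
  apply: regular_mmap; [exact: hlead| |by move=> i; exact: regular_chart_esym].
  move=> x; apply: regular_mmap; [exact: hlead| |by move=> i; exact: regular_chart_esym].
  move=> q; apply: regular_horner; first exact: hlead.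
  by apply: regular_div; exact: hfun_chart_eval.
exists [set psi | exists p2 p3 z, exists M h, [/\ hfun M h,
   forall f, chart_lead p2 p3 f != 0 -> h f = chart_lead p2 p3 f ^+ M * phi p2 p3 z f &
   psi = (fun f => chart_lead p2 p3 f * h f)]]; split.
  by move=> _ [p2 [p3 [z [M [h [hM _ ->]]]]]]; exists (1 + M)%N; apply: hfunM.
move=> p; split=> [/SplitForms_neq0P [l [l0 lp]]|hp].
  move=> _ [p2 [p3 [z [M [h [hM he ->]]]]]].
  have hH := hfunM (hlead p2 p3) hM; apply/(hfun_vanish hH lp (prod_linear_neq0 l0)).
  have [->|c0] := eqVneq (chart_lead p2 p3 (prod_linear l)) 0; first by rewrite mul0r.
  rewrite he //; suff -> : phi p2 p3 z (prod_linear l) = 0 by rewrite !mulr0.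
  have [a [b [ea eb ev]]] := chart_prod_linear c0.
  have -> : phi p2 p3 z (prod_linear l) = roots_product z.1.1 z.1.2 z.2 a b
      (chart_eval p2 p3 z.1.1 z.1.2 z.2 (prod_linear l) / chart_lead p2 p3 (prod_linear l)).
    rewrite hP /phi; congr (mmap (mmap _ _) _ _); apply/funext => i; [exact: eb|exact: ea].
  (* The a_i and b_i come from the same factors, so the identity permutation gives a zero factor. *)
  rewrite /roots_product (bigD1 1%g) //= ev mulrAC divff // mul1r.
  rewrite (eq_bigr (fun i => z.1.1 - z.1.2 * a i - z.2 * b ((1%g : 'S_n) i))) => [|i _]; last by rewrite perm1.
  by rewrite subrr mul0r.
pose f : V := rep p; have f0 : f != 0 by exact: rep_neq0.
(* A point where both f and x are nonzero, scaled to x = 1, provides the chart. *)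
have [p2 [p3 c0]] : exists p2 p3, chart_lead p2 p3 f != 0.
  have [v] : exists v, ((f : {mpoly K[3]}) * 'X_ix).@[v] != 0.
    apply: contrapT => h; have : (f : {mpoly K[3]}) * 'X_ix = 0.
      by apply: meval_eq0 => v; apply/eqP; apply: contrapT => /negP nv; apply: h; exists v.
    move/eqP; rewrite mulf_eq0 -[X in X || _]/(val f == val (0 : V)) val_eqE (negPf f0) /=.
    by move=> /eqP /(congr1 (mcoeff U_(ix))) /eqP; rewrite mcoeffXU eqxx mcoeff0 oner_eq0.
  rewrite mevalM mevalXU mulf_eq0 negb_or => /andP[fv v0].
  exists (v iy / v ix), (v it / v ix); apply: contraNneq fv => e.
  have hom : (f : {mpoly K[3]}).@[v] = v ix ^+ n * chart_lead (v iy / v ix) (v it / v ix) f.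
    rewrite /chart_lead /chart_eval !mevalE mulr_sumr !big_seq; apply: eq_bigr => m ms.
    rewrite mulrCA; congr (_ * _).
    have <- : mdeg m = n by have := dhomog_mf (dhomog_is_dhomog f) ms.
    rewrite mdegE -prodrXr -big_split; apply: eq_bigr => i _ /=; rewrite -exprMn.
    by congr (_ ^+ _); case: (ord3P i) => ->; rewrite !(tnth_nth 0) /= ?mulr1 ?addr0 // mulrC divfK.
  by rewrite hom e mulr0.
have [a ea] := esym_roots n (chart_esym p2 p3 1 0 f).
have [b eb] := esym_roots n (chart_esym p2 p3 0 1 f).
have [|l l0 fl] := @split_of_roots_product K n p2 p3 f a b (rep_neq0 p) c0.
  move=> x y t; rewrite -[LHS]/(roots_product (x, y, t).1.1 (x, y, t).1.2 (x, y, t).2 _ _ _) hP.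
  have -> : (fun i : 'I_n => (@mesym n K i.+1).@[a]) = fun i => chart_esym p2 p3 1 0 f i.+1.
    by apply/funext.
  have -> : (fun i : 'I_n => (@mesym n K i.+1).@[b]) = fun i => chart_esym p2 p3 0 1 f i.+1.
    by apply/funext.
  have [M [h [hM he]]] := reg p2 p3 (x, y, t).
  have /eqP : chart_lead p2 p3 f * h f = 0.
    by apply: (hp (fun f => chart_lead p2 p3 f * h f)); exists p2, p3, (x, y, t), M, h.
  by rewrite mulf_eq0 (negPf c0) /= he // mulf_eq0 expf_eq0 (negPf c0) andbF /= => /eqP.
apply/SplitForms_neq0P; exists l; split=> //.
rewrite val_rep -/f; apply/vlineP; exists (chart_lead p2 p3 f)^-1.
by rewrite {2}fl scalerA mulVf // scale1r.
Qed.

Theorem propositionC1 (R : realType) (n : nat) (n_ge2 : (2 <= n)%N) :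
  [/\ zariski_closed (SplitForms R[i] n),
      irreducible_set (SplitForms R[i] n),
      has_dim (SplitForms R[i] n) (2 * n) &
      has_codim (SplitForms R[i] n) 'C(n, 2)] /\
  forall alpha beta : 'rV[R]_n,
    injective (alpha 0) -> injective (beta 0) ->
    [/\ Theta alpha beta @^-1` SplitForms R n =
          [set w | w \in Theta_span alpha beta],
        \dim (Theta_span alpha beta) = 3%N &
        (\dim (Theta_span alpha beta))%:Z - ((2 * n)%:Z - 'C(n, 2)%:Z) =
          'C(n - 2, 2)%:Z].
Proof.
split.
  split; [exact: closed_SplitForms|exact: irreducible_SplitForms| |].
    exact: has_dim_SplitForms.
  exact: has_codim_SplitForms.
move=> alpha beta ai bi; rewrite dim_Theta_span //; split=> //.
  exact: Theta_preimage.
exact: excess_dim.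
Qed.
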